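(* If $V$ is a $(\mathfrak g,\mathfrak r)$-module with infinitesimal character (i.e. the center $Z(\mathfrak g)$ of $U(\mathfrak g)$ acts on $V$ by scalars), then $H(V)=H^0(V)=H_D(V)$.
   Context: Setting. $\mathfrak g$ is a complex reductive Lie algebra with a nondegenerate invariant symmetric bilinear form $B$, $\mathfrak r\subset\mathfrak g$ is a reductive subalgebra with $B|_{\mathfrak r\times\mathfrak r}$ nondegenerate, and $\mathfrak s=\mathfrak r^{\perp}$, so $\mathfrak g=\mathfrak r\oplus\mathfrak s$. $C(\mathfrak s)$ is the Clifford algebra of $\mathfrak s$ with relations $xy+yx=-2B(x,y)$, identified as a vector space with $\bigwedge(\mathfrak s)$ by Chevalley's antisymmetrization map. $S$ is a spin module (a simple module) for $C(\mathfrak s)$. Dirac operator. If $b_i$ and $d_i$ are bases of $\mathfrak s$ dual with respect to $B$, Kostant's cubic Dirac operator is $$D=\sum_i b_i\otimes d_i+\frac12\sum_{i<j<k}B([b_i,b_j],b_k)\,1\otimes (d_i\wedge d_j\wedge d_k)\in U(\mathfrak g)\otimes C(\mathfrak s).$$ $(\mathfrak g,\mathfrak r)$-modules. A $(\mathfrak g,\mathfrak r)$-module means a $\mathfrak g$-module $V$ of finite length, whose restriction to $\mathfrak r$ is a direct sum of finite-dimensional irreducible $\mathfrak r$-modules with finite multiplicities, and which is a direct sum of submodules with generalized infinitesimal character. ($W$ has generalized infinitesimal character $\chi:Z(\mathfrak g)\to\mathbb C$ if there is $N\in\mathbb N$ such that $(z-\chi(z))^N=0$ on $W$ for all $z\in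 Z(\mathfrak g)$.) $D$ acts on $V\otimes S$. Dirac cohomology. $H_D(V)=\operatorname{Ker}D/(\operatorname{Ker}D\cap\operatorname{Im}D)$. For an integer $k\ge 0$, $H^k(V)=(\operatorname{Im}D^{2k}\cap\operatorname{Ker}D)/(\operatorname{Im}D^{2k+1}\cap\operatorname{Ker}D)$, and the higher Dirac cohomology is $H(V)=\bigoplus_{k\ge0}H^k(V)$ (kernels and images are those of powers of $D$ acting on $V\otimes S$; $D^0$ is the identity). *)

(* Defs.v *)
From HB Require Import structures.
From mathcomp Require Import all_boot all_order all_algebra all_fingroup.
From mathcomp Require Import generic_quotient ring_quotient sesquilinear.
From mathcomp Require Import all_classical reals.
From mathcomp Require Import complex.

Set Implicit Arguments.
Unset Strict Implicit.
Unset Printing Implicit Defensive.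

Import GRing.Theory.

Local Open Scope ring_scope.
Local Open Scope classical_set_scope.

HB.mixin Record Vector_isLieAlgebra (K : fieldType) g of Vector K g := {
  lie : g -> g -> g;
  lie_linearl : forall y, linear (lie^~ y);
  lie_linearr : forall x, linear (lie x);
  lie_alt : forall x, lie x x = 0;
  lie_jacobi : forall x y z,
    lie x (lie y z) + lie y (lie z x) + lie z (lie x y) = 0
}.

#[short(type="lieAlgType")]
HB.structure Definition LieAlgebra (K : fieldType) :=
  {g of Vector K g & Vector_isLieAlgebra K g}.

Section Lie.
Variables (K : fieldType) (g : lieAlgType K).

Definition lie_subalgebra (r : {vspace g}) : Prop :=
  {in r &, forall x y, lie x y \in r}.

Definition ad_stable (r W : {vspace g}) : Prop :=
  forall x w, x \in r -> w \in W -> lie x w \in W.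

(* "r is reductive in g": g is a semisimple r-module under the adjoint action.
   This is stronger than r being reductive as an abstract Lie algebra: it also
   makes the center of r act diagonalizably on g. *)
Definition reductive_in (r : {vspace g}) : Prop :=
  forall W : {vspace g}, ad_stable r W ->
  exists W' : {vspace g},
    [/\ ad_stable r W', (W + W')%VS = fullv & (W :&: W')%VS = 0%VS].

Definition reductive : Prop := reductive_in fullv.

Definition invariant_form (B : g -> g -> K) : Prop :=
  forall x y z, B (lie x y) z = B x (lie y z).

Definition nondegenerate_on (B : g -> g -> K) (r : {vspace g}) : Prop :=
  forall x, x \in r -> {in r, forall y, B x y = 0} -> x = 0.

End Lie.

Arguments reductive {K} g.

Section TensorProducts.
Variable K : fieldType.

Definition is_tensor (V S T : lmodType K) (t : {bilinear V -> S -> T}) : Prop :=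
  forall (W : lmodType K) (f : {bilinear V -> S -> W}),
  exists F : {linear T -> W}, (forall v s, F (t v s) = f v s) /\
    forall G : {linear T -> W}, (forall v s, G (t v s) = f v s) -> G =1 F.

Record algTensor (A B : algType K) := AlgTensor {
  algTensor_sort :> algType K;
  atens : {bilinear A -> B -> algTensor_sort};
  atens_univ : is_tensor atens;
  atens1 : atens 1 1 = 1;
  atensM : forall a a' b b',
    atens a b * atens a' b' = atens (a * a') (b * b')
}.

Record algRep (A : algType K) := AlgRep {
  algRep_sort :> lmodType K;
  act : A -> {linear algRep_sort -> algRep_sort};
  act_linear : forall v, linear (fun a => act a v);
  act1 : forall v, act 1 v = v;
  actM : forall a b v, act (a * b) v = act a (act b v)
}.

Record repTensor (A B : algType K) (AB : algTensor A B)
    (V : algRep A) (S : algRep B) := RepTensor {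
  repTensor_rep :> algRep AB;
  rtens : {bilinear V -> S -> repTensor_rep};
  rtens_univ : is_tensor rtens;
  rtens_act : forall a b v s,
    act repTensor_rep (atens AB a b) (rtens v s) = rtens (act V a v) (act S b s)
}.

End TensorProducts.

Section EnvelopingAlgebra.
Variables (K : fieldType) (g : lieAlgType K).

Definition lie_map (A : algType K) (f : g -> A) : Prop :=
  forall x y, f (lie x y) = f x * f y - f y * f x.

Record envAlg := EnvAlg {
  envAlg_sort :> algType K;
  env_in : {linear g -> envAlg_sort};
  env_lie : lie_map env_in;
  env_univ : forall (A : algType K) (f : {linear g -> A}), lie_map f ->
    exists F : {lrmorphism envAlg_sort -> A}, (forall x, F (env_in x) = f x) /\
      forall G : {lrmorphism envAlg_sort -> A},
        (forall x, G (env_in x) = f x) -> G =1 F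
}.

End EnvelopingAlgebra.

Section CliffordAlgebra.
Variables (K : fieldType) (W : vectType K) (q : W -> W -> K).

Definition clifford_map (A : algType K) (f : W -> A) : Prop :=
  forall x y, f x * f y + f y * f x = (- 2 * q x y)%:A.

Record cliffordAlg := CliffordAlg {
  cliffordAlg_sort :> algType K;
  cliff_in : {linear W -> cliffordAlg_sort};
  cliff_rel : clifford_map cliff_in;
  cliff_univ : forall (A : algType K) (f : {linear W -> A}), clifford_map f ->
    exists F : {lrmorphism cliffordAlg_sort -> A},
      (forall x, F (cliff_in x) = f x) /\
      forall G : {lrmorphism cliffordAlg_sort -> A},
        (forall x, G (cliff_in x) = f x) -> G =1 F
}.

(* The image of x_0 /\ ... /\ x_(m-1) under Chevalley's antisymmetrization map
   from the exterior algebra of W to the Clifford algebra. *)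
Definition cliff_wedge (C : cliffordAlg) (m : nat) (x : m.-tuple W) : C :=
  (m`!%:R)^-1 *:
    \sum_(p : 'S_m) (-1) ^+ p *: \prod_(l < m) cliff_in C (tnth x (p l)).

End CliffordAlgebra.

Section Operators.
Variables (K : fieldType) (V : lmodType K).

(* Vector spaces here are possibly infinite-dimensional, so subspaces are sets;
   op is the family of operators through which a Lie algebra or an associative
   algebra acts on V. *)
Definition is_subspace (W : set V) : Prop :=
  W 0 /\ forall k u v, W u -> W v -> W (k *: u + v).

Definition finite_dim (W : set V) : Prop :=
  exists (n : nat) (e : 'I_n -> V), (forall i, W (e i)) /\
    forall v, W v -> exists c : 'I_n -> K, v = \sum_i c i *: e i.

Definition is_direct_sum (I : choiceType) (W : I -> set V) : Prop :=
  (forall v, exists (t : seq I) (w : I -> V),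
     (forall i, W i (w i)) /\ v = \sum_(i <- t) w i) /\
  (forall (t : seq I) (w : I -> V), uniq t -> (forall i, W i (w i)) ->
     \sum_(i <- t) w i = 0 -> {in t, forall i, w i = 0}).

Variables (X : Type) (op : X -> V -> V).

Definition is_submodule (W : set V) : Prop :=
  is_subspace W /\ forall x v, W v -> W (op x v).

Definition irreducible (W : set V) : Prop :=
  [/\ is_submodule W, W <> [set 0] &
      forall W' : set V, is_submodule W' -> W' `<=` W ->
        W' = [set 0] \/ W' = W].

Definition finite_length : Prop :=
  exists (n : nat) (M : nat -> set V),
    [/\ M 0%N = [set 0], M n = setT &
        forall i, (i < n)%N ->
          [/\ is_submodule (M i), is_submodule (M i.+1),
              M i `<=` M i.+1, M i <> M i.+1 &
              forall N : set V, is_submodule N -> M i `<=` N -> N `<=` M i.+1 ->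
                N = M i \/ N = M i.+1]].

Definition iso_submodules (W W' : set V) : Prop :=
  exists f : V -> V,
    [/\ forall k u v, W u -> W v -> f (k *: u + v) = k *: f u + f v,
        forall x v, W v -> f (op x v) = op x (f v) &
        set_bij W W' f].

(* Finiteness of multiplicities: every summand is isomorphic to only finitely
   many of the summands. *)
Definition admissible : Prop :=
  exists (I : choiceType) (W : I -> set V),
    [/\ is_direct_sum W,
        forall i, finite_dim (W i) /\ irreducible (W i) &
        forall i, finite_set [set j | iso_submodules (W i) (W j)]].

End Operators.

Section Modules.
Variables (K : fieldType) (g : lieAlgType K) (U : envAlg g).

(* g-modules are the same as U(g)-modules; g acts through env_in. *)
Definition lie_act (V : algRep U) (x : g) (v : V) : V := act V (env_in U x) v.

Definition sub_lie_act (V : algRep U) (r : {vspace g}) (x : subvs_of r) (v : V) :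
  V := lie_act (vsval x) v.

Definition env_center : set U := [set z | forall u : U, z * u = u * z].

(* Only the restriction of chi to the center of U(g) matters; if W is nonzero,
   that restriction is automatically an algebra morphism. *)
Definition gen_inf_char (V : algRep U) (W : set V) : Prop :=
  exists (chi : U -> K) (N : nat), forall z, env_center z -> forall w, W w ->
    iter N (fun v => act V z v - chi z *: v) w = 0.

Definition inf_char (V : algRep U) : Prop :=
  exists chi : U -> K, forall z, env_center z -> forall v,
    act V z v = chi z *: v.

Definition gr_module (r : {vspace g}) (V : algRep U) : Prop :=
  [/\ finite_length (@lie_act V),
      admissible (@sub_lie_act V r) &
      exists (I : choiceType) (W : I -> set V),
        is_direct_sum W /\
        forall i, is_submodule (@lie_act V) (W i) /\ gen_inf_char (W i)].

End Modules.

Definition spin_module (K : fieldType) (W : vectType K) (q : W -> W -> K)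
    (C : cliffordAlg q) (S : algRep C) : Prop :=
  irreducible (act S : C -> S -> S) setT.

Section DiracOperator.
Variables (K : fieldType) (g : lieAlgType K) (B : {symmetric g}).
Variable r : {vspace g}.

Local Notation s := (orthov B r).

Definition sform (x y : subvs_of s) : K := B (vsval x) (vsval y).

Definition dual_bases (n : nat) (b d : n.-tuple (subvs_of s)) : Prop :=
  [/\ basis_of fullv b, basis_of fullv d &
      forall i j, sform (tnth b i) (tnth d j) = (i == j)%:R].

Definition dirac (U : envAlg g) (C : cliffordAlg sform) (UC : algTensor U C)
    (n : nat) (b d : n.-tuple (subvs_of s)) : UC :=
  let bg i := vsval (tnth b i) in
  \sum_(i < n) atens UC (env_in U (bg i)) (cliff_in C (tnth d i)) +
  2^-1 *: \sum_(i < n) \sum_(j < n | (i < j)%N) \sum_(k < n | (j < k)%N)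
    B (lie (bg i) (bg j)) (bg k) *:
      atens UC 1 (cliff_wedge C [tuple tnth d i; tnth d j; tnth d k]).

End DiracOperator.

Section SubQuotient.
Variables (K : fieldType) (V : lmodType K).

Section Subspace.
Variable A : submodClosed V.

Record subsp := Subsp { subsp_val : V; _ : subsp_val \in (A : {pred V}) }.
HB.instance Definition _ := [isSub for subsp_val].
HB.instance Definition _ := [Choice of subsp by <:].
HB.instance Definition _ := [SubChoice_isSubLmodule of subsp by <:].

End Subspace.

Variables A N : submodClosed V.

Definition subsp_pred : {pred subsp A} := [pred x | val x \in (N : {pred V})].

Fact subsp_pred_closed : submod_closed subsp_pred.
Proof.
split=> [|k u v]; rewrite !inE ?linear0 ?rpred0 // => Nu Nv.
by rewrite linearP; apply: rpredD => //; apply: rpredZ.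
Qed.
HB.instance Definition _ :=
  GRing.isSubmodClosed.Build K (subsp A) subsp_pred subsp_pred_closed.

(* The quotient A / (A :&: N). *)
Definition subquot : Type := Quotient.quot subsp_pred.
HB.instance Definition _ := GRing.Zmodule.on subquot.
HB.instance Definition _ := EqQuotient.on subquot.

Definition subquot_pi (x : subsp A) : subquot := (\pi_subquot x)%qT.

Definition subquot_scale (k : K) (x : subquot) : subquot :=
  subquot_pi (k *: repr x).

Fact subquot_piP x y :
  (subquot_pi x == subquot_pi y) = (val (x - y) \in (N : {pred V})).
Proof. by rewrite /subquot_pi -Quotient.idealrBE. Qed.

Fact subquot_piD x y : subquot_pi (x + y) = subquot_pi x + subquot_pi y.
Proof. exact: Quotient.pi_add. Qed.

Fact subquot_reprK : cancel (repr : subquot -> subsp A) subquot_pi.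
Proof. exact: reprK. Qed.

Fact subquot_piZ k x : subquot_pi (k *: x) = subquot_scale k (subquot_pi x).
Proof.
apply/eqP; rewrite subquot_piP -scalerBr linearZ /=; apply: rpredZ.
by rewrite -subquot_piP subquot_reprK.
Qed.

Fact subquot_scaleA a b x :
  subquot_scale a (subquot_scale b x) = subquot_scale (a * b) x.
Proof. by rewrite -[x]subquot_reprK -!subquot_piZ scalerA. Qed.

Fact subquot_scale1 : left_id 1 subquot_scale.
Proof. by move=> x; rewrite -[x]subquot_reprK -!subquot_piZ scale1r. Qed.

Fact subquot_scaleDr : right_distributive subquot_scale +%R.
Proof.
move=> k x y; rewrite -[x]subquot_reprK -[y]subquot_reprK.
by rewrite -subquot_piD -!subquot_piZ -subquot_piD scalerDr.
Qed.

Fact subquot_scaleDl x : {morph subquot_scale^~ x : a b / a + b}.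
Proof.
by move=> a b; rewrite -[x]subquot_reprK -!subquot_piZ -subquot_piD scalerDl.
Qed.

HB.instance Definition _ := GRing.Zmodule_isLmodule.Build K subquot
  subquot_scaleA subquot_scale1 subquot_scaleDr subquot_scaleDl.

Fact subquot_pi_is_linear : linear subquot_pi.
Proof. by move=> k x y; rewrite subquot_piD subquot_piZ. Qed.
HB.instance Definition _ :=
  GRing.isLinear.Build K (subsp A) subquot *:%R subquot_pi subquot_pi_is_linear.

End SubQuotient.

Section DirectSum.
Variables (K : fieldType) (M : nat -> lmodType K).

Record dsum := DSum {
  dsum_fun :> forall k, M k;
  dsum_fin : exists n, forall k, (n <= k)%N -> dsum_fun k = 0
}.

HB.instance Definition _ := gen_eqMixin dsum.
HB.instance Definition _ := gen_choiceMixin dsum.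

Fact dsumP (f f' : dsum) : (forall k, f k = f' k) -> f = f'.
Proof.
case: f f' => [f ff] [f' ff'] /= ef.
have {ef} e := functional_extensionality_dep ef.
by case: _ / e in ff' *; congr DSum; apply: Prop_irrelevance.
Qed.

Fact dsum0_fin : exists n, forall k, (n <= k)%N -> (0 : M k) = 0.
Proof. by exists 0%N. Qed.
Definition dsum0 := DSum dsum0_fin.

Fact dsumN_fin (f : dsum) : exists n, forall k, (n <= k)%N -> - f k = 0.
Proof. by have [n fn] := dsum_fin f; exists n => k /fn ->; rewrite oppr0. Qed.
Definition dsumN f := DSum (dsumN_fin f).

Fact dsumD_fin (f f' : dsum) :
  exists n, forall k, (n <= k)%N -> f k + f' k = 0.
Proof.
have [[n fn] [n' fn']] := (dsum_fin f, dsum_fin f').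
by exists (maxn n n') => k; rewrite geq_max => /andP[/fn -> /fn' ->]; rewrite addr0.
Qed.
Definition dsumD f f' := DSum (dsumD_fin f f').

Fact dsumZ_fin a (f : dsum) : exists n, forall k, (n <= k)%N -> a *: f k = 0.
Proof. by have [n fn] := dsum_fin f; exists n => k /fn ->; rewrite scaler0. Qed.
Definition dsumZ a f := DSum (dsumZ_fin a f).

Fact dsumDA : associative dsumD.
Proof. by move=> *; apply: dsumP => k /=; rewrite addrA. Qed.
Fact dsumDC : commutative dsumD.
Proof. by move=> *; apply: dsumP => k /=; rewrite addrC. Qed.
Fact dsum0D : left_id dsum0 dsumD.
Proof. by move=> *; apply: dsumP => k /=; rewrite add0r. Qed.
Fact dsumND : left_inverse dsum0 dsumN dsumD.
Proof. by move=> *; apply: dsumP => k /=; rewrite addNr. Qed.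
HB.instance Definition _ := GRing.isZmodule.Build dsum dsumDA dsumDC dsum0D dsumND.

Fact dsumZA a b f : dsumZ a (dsumZ b f) = dsumZ (a * b) f.
Proof. by apply: dsumP => k /=; rewrite scalerA. Qed.
Fact dsumZ1 : left_id 1 dsumZ.
Proof. by move=> *; apply: dsumP => k /=; rewrite scale1r. Qed.
Fact dsumZDr : right_distributive dsumZ +%R.
Proof. by move=> *; apply: dsumP => k /=; rewrite scalerDr. Qed.
Fact dsumZDl f : {morph dsumZ^~ f : a b / a + b}.
Proof. by move=> *; apply: dsumP => k /=; rewrite scalerDl. Qed.
HB.instance Definition _ :=
  GRing.Zmodule_isLmodule.Build K dsum dsumZA dsumZ1 dsumZDr dsumZDl.

Section Injection.
Variable i : nat.

Fact dsum_in_fin (x : M i) :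
  exists n, forall k, (n <= k)%N -> dfwith (fun j => 0 : M j) i x k = 0.
Proof. by exists i.+1 => k ik; rewrite dfwithout // ltn_eqF. Qed.
Definition dsum_in x : dsum := DSum (dsum_in_fin x).

Fact dsum_in_is_linear : linear dsum_in.
Proof.
move=> a x y; apply: dsumP => k /=; have [<-|ik] := eqVneq i k.
  by rewrite !dfwithin.
by rewrite !dfwithout // scaler0 addr0.
Qed.
HB.instance Definition _ :=
  GRing.isLinear.Build K (M i) dsum *:%R dsum_in dsum_in_is_linear.

End Injection.

End DirectSum.

Section DiracCohomology.
Variables (K : fieldType) (T : lmodType K) (D : {linear T -> T}).

Definition kerD : {pred T} := [pred x | D x == 0].

Fact kerD_closed : submod_closed kerD.
Proof.
split=> [|k x y]; rewrite !inE ?linear0 // => /eqP Dx /eqP Dy.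
by rewrite linearP Dx Dy scaler0 addr0.
Qed.
HB.instance Definition _ := GRing.isSubmodClosed.Build K T kerD kerD_closed.

(* The intersection of Ker D with the image of D^m. *)
Definition kerimD (m : nat) : {pred T} :=
  [pred x | (D x == 0) && `[< exists y, iter m D y = x >]].

Fact kerimD_closed m : submod_closed (kerimD m).
Proof.
have iterP k x y : iter m D (k *: x + y) = k *: iter m D x + iter m D y.
  by elim: m => //= m ->; rewrite linearP.
have iter0 : iter m D 0 = 0 by elim: m {iterP} => //= m ->; rewrite linear0.
split=> [|k x y]; rewrite !inE.
  by rewrite linear0 eqxx; apply/asboolP; exists 0.
move=> /andP[/eqP Dx /asboolP[x' ex]] /andP[/eqP Dy /asboolP[y' ey]].
rewrite linearP Dx Dy scaler0 addr0 eqxx /=.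
by apply/asboolP; exists (k *: x' + y'); rewrite iterP ex ey.
Qed.
HB.instance Definition _ m :=
  GRing.isSubmodClosed.Build K T (kerimD m) (kerimD_closed m).

Definition dirac_coh : lmodType K := subquot kerD (kerimD 1).

Definition higher_dirac_coh (k : nat) : lmodType K :=
  subquot (kerimD (2 * k)) (kerimD (2 * k).+1).

Definition total_dirac_coh : lmodType K := dsum higher_dirac_coh.

End DiracCohomology.

(* Main.v *)
(* Write Y for the Clifford generators.  Kostant's computation gives
     D^2 = Omega_diag - Omega_g (x) 1 + 1 (x) c,
   where Omega_diag is the Casimir element of [r] embedded diagonally through
   X + spin_lift (ad X), and c lies in C(s).  Since [D] commutes with D^2, with
   Omega_diag and with Omega_g (x) 1, it commutes with 1 (x) c; as 1 and the
   elements of [g] are linearly independent in U(g), c is central in C(s) and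
   acts by a scalar on the spin module.  When [V] has an infinitesimal
   character, D^2 is therefore Omega_diag minus a scalar.  Every vector of
   V (x) S lies in a finite-dimensional [r]-stable subspace on which the center
   of [r] is diagonalizable, and there the Casimir operator is semisimple, so
   ker D^4 = ker D^2.  Hence Im D^k meets Ker D trivially for k >= 2, i.e.
   H^k = 0 for k >= 1.

   Semisimplicity of the Casimir operator is proved without Weyl's theorem or
   the Killing form: invariants lift along surjections of such modules, because
   either some Casimir element of a trace form has a nonzero eigenvalue, or all
   trace forms vanish on the derived algebra, which then acts nilpotently by
   Cartan's argument and Engel's theorem. *)

Require Import Defs.
From HB Require Import structures.
From mathcomp Require Import fingroup perm.
From mathcomp Require Import all_boot all_order all_algebra.
From mathcomp Require Import sesquilinear spectral.
From mathcomp Require Import all_classical reals.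
From mathcomp Require Import complex.
From mathcomp Require Import ring.

Set Implicit Arguments.
Unset Strict Implicit.
Unset Printing Implicit Defensive.

Import Order.TTheory GRing.Theory Num.Theory.

Local Open Scope ring_scope.

(** * Conjugate replicas of a matrix *)

(** The form on [r] is arbitrary: it may weigh the simple ideals so that the plain Casimir element
    vanishes on a nontrivial irreducible module, and no positivity singles out a better one. Hence
    Casimir elements are twisted by matrices commuting with the adjoint action. The decisive twist
    is a polynomial in the matrix of the trace form that conjugates its eigenvalues, so that the
    trace of the resulting operator is a sum of squared moduli. The same conjugate replica gives
    Cartan's criterion.

    Nothing is decomposed into simple ideals or weights: reductivity enters only through ideal
    complements, and pairs of dual families, possibly redundant, replace bases.

    The algebras and the tensor products are given by universal properties only. Uniqueness in these
    properties yields induction principles on generators, and existence yields functionals out of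
    representations.

    Matrices act on row vectors from the right. This reverses products and accounts for the minus
    signs and the exchanged dual families wherever abstract operators are turned into matrices. *)

Section Interpolation.
Variable F : fieldType.
Implicit Types (cs : seq F) (p : {poly F}).

Lemma coprimep_XsubC_prod cs c m :
  c \notin cs ->
  coprimep (('X - c%:P) ^+ m) (\prod_(a <- cs) ('X - a%:P) ^+ m).
Proof.
move=> cP; apply: coprimep_expl; elim: cs cP => [|a cs IH].
  by rewrite big_nil coprimep1.
rewrite inE negb_or big_cons => /andP[ca ccs].
rewrite coprimepMr IH // andbT; apply: coprimep_expr.
by rewrite coprimep_XsubC root_XsubC eq_sym.
Qed.

Lemma prod_XsubC_exp_dvdp cs m p : uniq cs ->
  {in cs, forall c, ('X - c%:P) ^+ m %| p} ->
  \prod_(c <- cs) ('X - c%:P) ^+ m %| p.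
Proof.
elim: cs => [|c cs IH] /=; first by rewrite big_nil dvd1p.
move=> /andP[ccs ucs] H; rewrite big_cons Gauss_dvdp ?coprimep_XsubC_prod //.
by rewrite H ?mem_head // IH // => a acs; rewrite H // inE acs orbT.
Qed.

(** The list may repeat values; its size bounds every multiplicity. With [cs] the diagonal of a
    triangular form, this gives divisibility by the characteristic polynomial without computing
    multiplicities. *)
Lemma prod_XsubC_dvdp cs p :
  {in cs, forall c, ('X - c%:P) ^+ size cs %| p} ->
  \prod_(c <- cs) ('X - c%:P) %| p.
Proof.
move=> H; apply: (@dvdp_trans _ (\prod_(c <- undup cs) ('X - c%:P) ^+ size cs)).
  rewrite -(prodr_undup_exp_count cs predT).
  elim: (undup cs) => [|c s IH]; first by rewrite !big_nil.
  by rewrite !big_cons dvdp_mul // dvdp_exp2l // count_size.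
by apply: prod_XsubC_exp_dvdp; rewrite ?undup_uniq // => c; rewrite mem_undup; apply: H.
Qed.

(** Chinese remainder theorem for the powers of the ['X - c%:P]. Evaluated at a matrix, such a [p]
    acts as the scalar [f c] on a generalized [c]-eigenspace of exponent at most [m]. *)
Lemma interpolation cs (f : F -> F) m :
  exists p, {in cs, forall c, ('X - c%:P) ^+ m %| p - (f c)%:P}.
Proof.
elim: cs => [|c cs [p IH]]; first by exists 0.
have [ccs|ccs] := boolP (c \in cs).
  by exists p => a; rewrite inE => /predU1P[->|]; apply: IH.
have /Bezout_eq1_coprimepP[[u v] /= uv1] := coprimep_XsubC_prod m ccs.
set a := _ ^+ m in uv1; set b := \prod_(_ <- _) _ in uv1.
(* Modulo [a] the Bezout relation reads [v * b = 1], and modulo each older power, which divides [b],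
   it reads [u * a = 1]. *)
exists (p * (u * a) + (f c)%:P * (v * b)) => d; rewrite inE => /predU1P[->|dcs].
  have -> : v * b = 1 - u * a by rewrite -uv1 addrC addKr.
  have -> : p * (u * a) + (f c)%:P * (1 - u * a) - (f c)%:P =
            ((p - (f c)%:P) * u) * a.
    by ring.
  by rewrite dvdp_mull.
have -> : u * a = 1 - v * b by rewrite -uv1 addrK.
have -> : p * (1 - v * b) + (f c)%:P * (v * b) - (f d)%:P =
          (p - (f d)%:P) + ((f c)%:P - p) * v * b.
  by ring.
apply: dvdp_add; first exact: IH.
by rewrite dvdp_mull // /b (big_rem d) //= dvdp_mulr.
Qed.

End Interpolation.

Section Triangular.
Variables (C : comNzRingType) (n : nat).
Implicit Types (A B : 'M[C]_n.+1).

Lemma is_trig_mulmx A B : is_trig_mx A -> is_trig_mx B ->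
  is_trig_mx (A *m B) /\ forall i, (A *m B) i i = A i i * B i i.
Proof.
move=> /is_trig_mxP tA /is_trig_mxP tB; split=> [|i].
  apply/is_trig_mxP => i j ij; rewrite mxE big1 // => k _.
  have [ik|ki] := ltnP i k; first by rewrite tA // mul0r.
  by rewrite tB ?mulr0 // (leq_ltn_trans ki).
rewrite mxE (bigD1 i) //= big1 ?addr0 // => k; rewrite neq_ltn => /orP[ki|ik].
  by rewrite tB ?mulr0.
by rewrite tA ?mul0r.
Qed.

Lemma is_trig_horner_mx A (p : {poly C}) : is_trig_mx A ->
  is_trig_mx (horner_mx A p) /\ forall i, horner_mx A p i i = p.[A i i].
Proof.
move=> tA; elim/poly_ind: p => [|p c [IHt IHd]].
  rewrite rmorph0 mx0_is_trig; split=> // i.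
  by rewrite horner0 mxE.
rewrite rmorphD rmorphM /= horner_mx_X horner_mx_C.
have [tM dM] := is_trig_mulmx IHt tA; split=> [|i].
  have /is_trig_mxP tS := scalar_mx_is_trig n.+1 c; move/is_trig_mxP: tM => tM.
  by apply/is_trig_mxP => i j ij; rewrite mxE tM // tS // addr0.
by rewrite mxE dM IHd hornerMXaddC !mxE eqxx.
Qed.

End Triangular.

Section Replica.
Variables (C : numClosedFieldType) (n : nat).
Local Notation N := n.+1.
Implicit Types (x u z : 'M[C]_N).

(** Left multiplication by [a] and right multiplication by [b] commute, so each term of the binomial
    expansion contains [a ^+ i] or [b ^+ j]. Induction on [i + j] replaces the expansion. *)
Lemma iter_sylvester (a b u : 'M[C]_N) i j :
  a ^+ i *m u = 0 -> u *m b ^+ j = 0 ->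
  iter (i + j) (fun u => a *m u - u *m b) u = 0.
Proof.
pose f u := a *m u - u *m b; rewrite -/f.
have itB k v w : iter k f (v - w) = iter k f v - iter k f w.
  elim: k => //= k ->; rewrite /f mulmxBr mulmxBl.
  by rewrite opprD addrACA -opprD.
have it0 k : iter k f 0 = 0.
  by elim: k => //= k ->; rewrite /f mulmx0 mul0mx subr0.
move: {2}(i + j)%N (erefl (i + j)%N) => s; elim: s i j u => [|s IH] i j u.
  by case: i j => [|i] [|j] // _; rewrite expr0 mul1mx => -> _; rewrite addn0 it0.
case: i => [|i] es.
  by rewrite expr0 mul1mx => -> _; rewrite it0.
case: j es => [|j] es au ub.
  by move: ub; rewrite expr0 mulmx1 => ->; rewrite it0.
rewrite es iterSr {2}/f itB.
have e1 : (i + j.+1 = s)%N by move: es; rewrite addSn => -[].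
have e2 : (i.+1 + j = s)%N by rewrite -e1 addnS.
have -> : iter s f (a *m u) = 0.
  rewrite -{1}e1; apply: IH => //.
    by rewrite mulmxA -[a ^+ i *m a]exprSr.
  by rewrite -mulmxA ub mulmx0.
have -> : iter s f (u *m b) = 0.
  rewrite -{1}e2; apply: IH => //.
    by rewrite mulmxA au mul0mx.
  by rewrite -mulmxA -[b *m b ^+ j]exprS.
by rewrite subr0.
Qed.

Definition ad_mx x : 'M[C]_(N * N) := lin_mulmx x - lin_mulmxr x.

Lemma mxvec_ad_mx x z : mxvec z *m ad_mx x = mxvec (x *m z - z *m x).
Proof. by rewrite mulmxBr !mul_vec_lin -linearB. Qed.

(** Here [u] lies in the generalized [(a - b)]-eigenspace of [ad x], with exponent [m + m] by
    [iter_sylvester]. The size [N * N] is convertible to [(n + n * N).+1], the successor form over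
    which matrices form a ring. *)
Lemma horner_ad_mx x p (q : {poly C}) a b m u :
    (x - a%:M) ^+ m *m u = 0 -> u *m (x - b%:M) ^+ m = 0 ->
    ('X - (a - b)%:P) ^+ (m + m) %| p - q ->
  mxvec u *m @horner_mx C (n + n * N) (ad_mx x) p =
  mxvec u *m @horner_mx C (n + n * N) (ad_mx x) q.
Proof.
move=> au ub /dvdpP[r epq]; apply/eqP; rewrite -subr_eq0 -mulmxBr; apply/eqP.
rewrite -rmorphB epq mulrC rmorphM rmorphXn rmorphB /= horner_mx_X horner_mx_C.
rewrite [LHS]mulmxA.
pose T : 'M[C]_((n + n * N).+1) := ad_mx x - (a - b)%:M; rewrite -/T.
have -> k : mxvec u *m (T ^+ k) =
  mxvec (iter k (fun u => (x - a%:M) *m u - u *m (x - b%:M)) u).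
  elim: k => [|k IH]; first by rewrite expr0 mulmx1.
  rewrite exprSr mulmxA IH mulmxBr [X in X - _]mxvec_ad_mx mul_mx_scalar.
  rewrite iterS; set w := iter _ _ _.
  rewrite mulmxBl mulmxBr mul_scalar_mx mul_mx_scalar opprD addrACA.
  rewrite -opprD -scalerBl !linearB; congr (_ - _); apply/esym/linearZ.
by rewrite (iter_sylvester au ub) linear0 mul0mx.
Qed.

(* [y] is the polynomial in [x] acting on the generalized [c]-eigenspace of [x]
   as the complex conjugate of [c]; then [ad y] acts on the generalized
   [(c - d)]-eigenspace of [ad x] as the conjugate of [c - d]. *)
Lemma replica x : exists p : {poly C}, let y := horner_mx x p in
  (\tr (x *m y) = 0 -> x ^+ N = 0) /\
  forall P : 'M[C]_(N * N), stablemx P (ad_mx x) -> stablemx P (ad_mx y).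
Proof.
have [U /unitarymx_unit Uu sT] := Schur x (ltn0Sn n).
pose T := U *m x *m invmx U.
have tT : is_trig_mx T by rewrite /T -conjumx.
pose cs := [seq T i i | i <- enum 'I_N].
have szcs : size cs = N by rewrite size_map size_enum_ord.
have hT q : horner_mx T q = U *m horner_mx x q *m invmx U.
  exact: horner_mx_uconj.
have hx q : horner_mx T q = 0 -> horner_mx x q = 0.
  rewrite hT => /(congr1 (fun M => invmx U *m M *m U)).
  by rewrite mulmx0 mul0mx !mulmxA mulVmx // mul1mx -mulmxA mulVmx // mulmx1.
(* Such a [q] is a multiple of the characteristic polynomial, so Cayley-Hamilton applies. All
   identities between polynomials in [x] below are checked by these divisibilities. *)
have CH q : {in cs, forall c, ('X - c%:P) ^+ N %| q} -> horner_mx x q = 0.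
  rewrite -szcs => /prod_XsubC_dvdp; rewrite big_map big_enum /=.
  rewrite -char_poly_trig // => /dvdpP[q' ->]; apply: hx.
  by rewrite rmorphM /= Cayley_Hamilton mulr0.
have [p ep] := interpolation cs Num.conj N.
exists p => /=; split=> [tr0|P stP].
  have [tTp dTp] := is_trig_horner_mx p tT.
  have Tcs i : T i i \in cs by apply: map_f; rewrite mem_enum.
  have pT i : p.[T i i] = (T i i)^*.
    have /dvdpP[q eq] := ep _ (Tcs i).
    apply/eqP; rewrite -subr_eq0 -[_ ^*](hornerC _ (T i i)) -hornerN -hornerD eq.
    by rewrite hornerM horner_exp hornerXsubC subrr expr0n mulr0.
  have trT : \tr (T *m horner_mx T p) = 0.
    rewrite hT !mulmxA -(mulmxA _ (invmx U) U) mulVmx // mulmx1.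
    by rewrite mxtrace_mulC !mulmxA mulVmx // mul1mx.
  have T0 i : T i i = 0.
    have [_ d] := is_trig_mulmx tT tTp.
    (* The diagonal of the triangular matrix [horner_mx T p] is the conjugate of that of [T], so the
       trace is a sum of squared moduli and all eigenvalues vanish. *)
    have : \sum_i `|T i i| ^+ 2 = 0.
      apply: etrans trT; apply: eq_bigr => j _.
      by rewrite d dTp pT normCK.
    move/(psumr_eq0P (fun j _ => exprn_ge0 2 (normr_ge0 (T j j)))) => /(_ i isT).
    by move/eqP; rewrite expf_eq0 normr_eq0 => /eqP.
  rewrite -(horner_mx_X x) -rmorphXn; apply: hx.
  have <- : char_poly T = 'X^N; last exact: Cayley_Hamilton.
  rewrite char_poly_trig // (eq_bigr (fun _ => 'X)) ?prodr_const ?card_ord //.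
  by move=> i _; rewrite T0 subr0.
(* The [E c] below are the spectral projections of [x]. Cutting a matrix by them on both sides
   leaves pieces on which [ad x] has the single generalized eigenvalue [c - d]. *)
pose ds := undup cs; have dsE c : (c \in ds) = (c \in cs) by rewrite mem_undup.
have /choice[e eP] : forall c, exists q,
    {in cs, forall d, ('X - d%:P) ^+ N %| q - (d == c)%:R%:P}.
  by move=> c; apply: (interpolation cs (fun d => (d == c)%:R) N).
pose E c := horner_mx x (e c).
have E1 : \sum_(c <- ds) E c = 1.
  apply/eqP; rewrite -subr_eq0 -raddf_sum -(rmorph1 (horner_mx x)) -rmorphB.
  apply/eqP/CH => d dcs.
  have -> : \sum_(c <- ds) e c - 1 = \sum_(c <- ds) (e c - (d == c)%:R%:P).
    rewrite sumrB; congr (_ - _); rewrite (bigD1_seq d) ?dsE ?undup_uniq //= eqxx.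
    by rewrite big1 ?addr0 // => c; rewrite eq_sym => /negPf ->.
  by apply: (big_ind (fun q => _ %| q)) => [||c _]; [exact: dvdp0|exact: dvdp_add|exact: eP].
have EX c : c \in cs -> horner_mx x (e c * ('X - c%:P) ^+ N) = 0.
  move=> ccs; apply: CH => d dcs; have [->|dc] := eqVneq d c.
    by rewrite dvdp_mull.
  by apply: dvdp_mulr; have := eP c d dcs; rewrite (negPf dc) subr0.
have hXc c : horner_mx x ('X - c%:P) = x - c%:M.
  by rewrite rmorphB /= horner_mx_X horner_mx_C.
have EXl c : c \in cs -> (x - c%:M) ^+ N *m E c = 0.
  by move=> /EX; rewrite mulrC rmorphM rmorphXn /= hXc.
have EXr c : c \in cs -> E c *m (x - c%:M) ^+ N = 0.
  by move=> /EX; rewrite rmorphM rmorphXn /= hXc.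
have pE c : c \in cs -> horner_mx x (e c * p) = c^* *: E c.
  move=> ccs; rewrite -horner_mxZ; apply/eqP; rewrite -subr_eq0 -rmorphB.
  apply/eqP/CH => d dcs; rewrite -mul_polyC mulrC -mulrBl.
  have [->|dc] := eqVneq d c; first by rewrite dvdp_mulr // ep.
  by apply: dvdp_mull; have := eP c d dcs; rewrite (negPf dc) subr0.
have pEl c : c \in cs -> horner_mx x p *m E c = c^* *: E c.
  by move=> /pE <-; rewrite mulrC rmorphM.
have pEr c : c \in cs -> E c *m horner_mx x p = c^* *: E c.
  by move=> /pE <-; rewrite rmorphM.
(* Conjugation is additive, so interpolating it at the differences [c - d] describes [ad y] as a
   polynomial in [ad x]; subspaces stable under [ad x] are then stable under [ad y]. The exponent
   [N + N] is the one required by [horner_ad_mx]. *)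
have [h eh] := interpolation [seq c - d | c <- cs, d <- cs] Num.conj (N + N).
suff -> : ad_mx (horner_mx x p) = @horner_mx C (n + n * N) (ad_mx x) h.
  exact: (@horner_mx_stable C (n + n * N) (n + n * N)).
apply/row_matrixP => k; rewrite !rowE -[delta_mx 0 k]vec_mxK.
move: (vec_mx _) => z {k}.
have -> : z = \sum_(c <- ds) \sum_(d <- ds) E c *m z *m E d.
  rewrite -[LHS]mulmx1 -{1}[z]mul1mx -[1%:M]E1 mulmx_suml mulmx_suml.
  by apply: eq_bigr => c _; rewrite mulmx_sumr.
rewrite !linear_sum !mulmx_suml; apply: eq_big_seq => c; rewrite dsE => ccs.
rewrite !linear_sum !mulmx_suml; apply: eq_big_seq => d; rewrite dsE => dcs.
set u := _ *m E d.
have xu : (x - c%:M) ^+ N *m u = 0 by rewrite !mulmxA EXl // !mul0mx.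
have ux : u *m (x - d%:M) ^+ N = 0 by rewrite -mulmxA EXr // mulmx0.
rewrite (@horner_ad_mx x h (c - d)^*%:P c d N u) //; last first.
  by apply: eh; apply/allpairsP; exists (c, d).
rewrite horner_mx_C [RHS]mul_mx_scalar mxvec_ad_mx.
transitivity (mxvec ((c - d)^* *: u)); last by rewrite linearZ.
congr mxvec.
by rewrite rmorphB scalerBl /u !mulmxA pEl // -!mulmxA pEr // -!scalemxAl -!scalemxAr.
Qed.

End Replica.

(** * Engel's theorem *)

Section LieBracket.
Variables (K : fieldType) (g : lieAlgType K).
Implicit Types x y z : g.

HB.instance Definition _ x :=
  GRing.isLinear.Build K g g *:%R (lie x) (lie_linearr x).

Lemma lieDl y : {morph lie^~ y : x x' / x + x'}.
Proof. by move=> x x'; have := lie_linearl y 1 x x'; rewrite !scale1r. Qed.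

Lemma lie0l y : lie 0 y = 0.
Proof. by apply: (addIr (lie 0 y)); rewrite -lieDl !add0r. Qed.

Lemma lieZl a x y : lie (a *: x) y = a *: lie x y.
Proof. by have := lie_linearl y a x 0; rewrite !addr0 lie0l addr0. Qed.

Lemma lieC x y : lie x y = - lie y x.
Proof.
apply/eqP; rewrite -addr_eq0; apply/eqP.
have := lie_alt (x + y); rewrite lieDl !linearD /= !lie_alt.
by rewrite add0r addr0.
Qed.

Lemma lie_der x y z : lie x (lie y z) = lie (lie x y) z + lie y (lie x z).
Proof.
have /eqP := lie_jacobi x y z; rewrite -addrA addr_eq0 => /eqP ->.
by rewrite opprD addrC -lieC (lieC x z) linearN.
Qed.

Definition lie_rep m (rho : g -> 'M[K]_m) : Prop :=
  forall x y, rho (lie x y) = rho x *m rho y - rho y *m rho x.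

End LieBracket.

Section Engel.
Variables (F : fieldType) (L : lieAlgType F) (m : nat).
Variable rho : {linear L -> 'M[F]_m}.
Hypothesis rhoP : lie_rep rho.
Implicit Types (K : {vspace L}) (x : L).

Definition act_span K k (Y : 'M_(k, m)) : 'M_m :=
  (\sum_(i < \dim K) <<Y *m rho (vbasis K)`_i>>)%MS.

Lemma sub_act_span K k (Y : 'M_(k, m)) x :
  x \in K -> (Y *m rho x <= act_span K Y)%MS.
Proof.
move=> /coord_vbasis ->; rewrite linear_sum mulmx_sumr.
apply: summx_sub_sums => i _; rewrite linearZ -scalemxAr genmxE.
exact: scalemx_sub.
Qed.

Lemma act_span_subP K k l (Y : 'M_(k, m)) (Z : 'M_(l, m)) :
  {in K, forall x, Y *m rho x <= Z}%MS -> (act_span K Y <= Z)%MS.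
Proof.
move=> YZ; apply/sumsmx_subP => i _; rewrite genmxE; apply: YZ.
by apply: vbasis_mem; rewrite mem_nth // size_tuple.
Qed.

Lemma act_spanS K k l (Y : 'M_(k, m)) (Z : 'M_(l, m)) :
  (Y <= Z)%MS -> (act_span K Y <= act_span K Z)%MS.
Proof.
move=> YZ; apply: act_span_subP => x xK.
by apply: submx_trans (sub_act_span _ xK); apply: submxMr.
Qed.

(** Nilpotency of the associative algebra generated by [rho K], stated without a flag: the
    decreasing chain of iterated spans cannot become stationary before 0. *)
Definition act_nilp K := forall Y : 'M[F]_m, (Y <= act_span K Y)%MS -> Y = 0.

(** Let [Z] be the span of the translates of [Y] by powers of [rho x], and [W] its [K]-span, stable
    under [rho x] because [[K, x]] lies in [K]. The inclusion of [Y] gives [Z <= W + Z x];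
    iterating, [x] being nilpotent, gives [Z <= W], hence [Z = 0]. *)
Lemma act_nilp_ext K x n : act_nilp K -> {in K, forall k, lie k x \in K} ->
  rho x ^+ n = 0 -> act_nilp (K + <[x]>)%VS.
Proof.
move=> nK Kx xn Y subY.
pose Z := (\sum_(i < n.+1) Y *m rho x ^+ i)%MS.
have ZX : (Z *m rho x <= Z)%MS.
  rewrite sumsmxMr; apply/sumsmx_subP => i _; rewrite -mulmxA -[_ *m rho x]exprSr.
  have [lt|] := ltnP i.+1 n.+1; first by rewrite (sumsmx_sup (Ordinal lt)).
  by rewrite ltnS => ni; rewrite -(subnKC ni) exprS exprD xn mul0r mulr0 mulmx0 sub0mx.
have YZ : (Y <= Z)%MS by rewrite (sumsmx_sup ord0) // expr0 mulmx1.
pose W := act_span K Z.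
have WX : (W *m rho x <= W)%MS.
  rewrite sumsmxMr; apply/sumsmx_subP => i _.
  rewrite (eqmxMr _ (genmxE _)) -mulmxA; set k := _`_i.
  have kK : k \in K by rewrite vbasis_mem // mem_nth // size_tuple.
  have -> : rho k *m rho x = rho x *m rho k + rho (lie k x).
    by rewrite rhoP addrC subrK.
  rewrite mulmxDr addmx_sub ?sub_act_span ?Kx //.
  by rewrite mulmxA (submx_trans (submxMr _ ZX)) ?sub_act_span.
have ZWX : (Z <= W + Z *m rho x)%MS.
  apply/sumsmx_subP => -[[|i] lti] _ /=; last first.
    apply: submx_trans (addsmxSr _ _); rewrite exprSr mulmxA.
    by rewrite submxMr // (sumsmx_sup (Ordinal (ltnW lti))).
  rewrite expr0 mulmx1 (submx_trans subY) //.
  apply: act_span_subP => _ /memv_addP[k kK [_ /vlineP[a ->] ->]].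
  rewrite linearD linearZ mulmxDr -scalemxAr addmx_sub //.
    apply: submx_trans (addsmxSl _ _).
    by rewrite (submx_trans (submxMr _ YZ)) ?sub_act_span.
  by rewrite scalemx_sub // (submx_trans (submxMr _ YZ)) ?addsmxSr.
have ZWXj j : (Z <= W + Z *m rho x ^+ j)%MS.
  elim: j => [|j IH]; first by rewrite expr0 mulmx1 addsmxSr.
  apply: (submx_trans ZWX); rewrite addsmx_sub addsmxSl /=.
  rewrite (submx_trans (submxMr _ IH)) // addsmxMr addsmxS //.
  by rewrite exprSr mulmxA.
have ZW : (Z <= W)%MS.
  by rewrite (submx_trans (ZWXj n)) // addsmx_sub submx_refl xn mulmx0 sub0mx.
by apply/eqP; rewrite -submx0; move: YZ; rewrite (nK _ ZW).
Qed.

Let F_ K i := iter i (@act_span K m) (1%:M : 'M_m).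

(** The rank drops at each step until it is 0. *)
Lemma iter_act_span_eq0 K i : act_nilp K -> (m < i)%N -> F_ K i = 0.
Proof.
move=> nK mi.
have dec j : (F_ K j.+1 <= F_ K j)%MS.
  by elim: j => [|j IH]; [exact: submx1 | exact: act_spanS].
suff [//|] : F_ K i = 0 \/ (\rank (F_ K i) + i <= m)%N.
  by move/(leq_trans (leq_addl _ _)); rewrite leqNgt mi.
elim: i {mi} => [|i IH]; first by right; rewrite addn0 rank_leq_row.
have z0 : F_ K i = 0 -> F_ K i.+1 = 0.
  by move=> e; apply/eqP; rewrite -submx0 -e.
case: IH => [/z0|IH]; first by left.
have := mxrankS (dec i); rewrite leq_eqVlt => /orP[/eqP e|lt].
  left; apply/z0/nK.
  by have := mxrank_leqif_sup (dec i) => /geq_leqif; rewrite e leqnn => <-.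
by right; rewrite addnS; apply: leq_trans IH; rewrite ltn_add2r.
Qed.

(** A subspace [M] of [K] acting nilpotently is enlarged one vector at a time. It is not kept closed
    under brackets, since [act_nilp_ext] only asks for [[M, x]] in [M]. Starting from the part of
    [K] killed by [rho] avoids assuming [rho] faithful. *)
Lemma Engel K : {in K &, forall x y, lie x y \in K} ->
  {in K, forall x, exists n, rho x ^+ n = 0} -> act_nilp K.
Proof.
move=> KK nK.
suff H n : exists M : {vspace L}, [/\ (M <= K)%VS, act_nilp M,
    {in K, forall x, rho x = 0 -> x \in M} & (M == K) || (n <= \dim M)%N].
  have [M [MK nM _]] := H (\dim K).+1.
  by rewrite ltnNge dimvS // orbF => /eqP <-.
elim: n => [|n [M [MK nM kM /orP[/eqP eM|dimM]]]].
- exists (K :&: lker (linfun rho))%VS; split; rewrite ?capvSl ?orbT //; last first.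
    by move=> x xK r0; rewrite memv_cap xK memv_ker lfunE /= r0.
  move=> Y YY; apply/eqP; rewrite -submx0 (submx_trans YY) //.
  apply: act_span_subP => x; rewrite memv_cap memv_ker lfunE /= => /andP[_ /eqP ->].
  by rewrite mulmx0 sub0mx.
- by exists M; split => //; rewrite eM eqxx.
have [eM|neq] := eqVneq M K; first by exists M; split => //; rewrite eM eqxx.
have [x [xK xM Mx]] : exists x, [/\ x \in K, x \notin M &
    {in M, forall k, lie k x \in M}].
  apply: contrapT => /forallNP noX.
  have step x : x \in K -> x \notin M -> exists2 k, k \in M & lie k x \notin M.
    move=> xK xM; apply: contrapT => /forall2NP nk; apply: (noX x); split=> // k kM1.
    by case: (nk k) => // /negP; rewrite negbK.
  have [x0 x0K x0M] : exists2 x, x \in K & x \notin M.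
    by apply/subvPn; apply: contra neq => KM; rewrite eqEsubv MK.
  (* If no [x] normalizes [M], one can bracket with elements of [M] forever without entering [M].
     After [j] brackets, [rho x] is a sum of words with [j] letters from [M] around the image of
     [x0]. For [j = 2m + 1] one side has more than [m] letters, so [rho x = 0] and [x] is in [M]
     after all. The subtraction of [m] is truncated at 0. *)
  suff seqx j : exists x, [/\ x \in K, x \notin M &
      forall a, (F_ M a *m rho x <= F_ M (j + a - m))%MS].
    have [x [xK /negP xM /(_ 0%N)]] := seqx (m + m).+1.
    rewrite addn0 subSn ?leq_addr // addnK (iter_act_span_eq0 nM (ltnSn m)) submx0 mul1mx.
    by move=> /eqP /(kM _ xK).
  elim: j => [|j [x [xK xM Fx]]].
    exists x0; split=> // a; rewrite add0n; have [am|ma] := leqP a m.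
      by rewrite (eqP am) submx1.
    by rewrite (iter_act_span_eq0 nM ma) mul0mx sub0mx.
  have [k kM' kxM] := step x xK xM.
  have kK := subvP MK _ kM'.
  exists (lie k x); split=> [||a] //; first exact: KK.
  have [ja|ja] := leqP m (j + a); last by rewrite addSn (eqP ja) submx1.
  rewrite rhoP mulmxBr addmx_sub ?eqmx_opp // !mulmxA.
    rewrite addSnnS; apply: submx_trans (Fx a.+1).
    by rewrite submxMr // sub_act_span.
  rewrite addSn subSn //; apply: submx_trans (submxMr _ (Fx a)) _.
  exact: sub_act_span.
exists (M + <[x]>)%VS.
have xn : exists n, rho x ^+ n = 0 by apply: nK.
have [e xe] := xn.
split.
- by rewrite subv_add MK -memvE.
- exact: act_nilp_ext Mx xe.
- by move=> y yK /(kM y yK); apply/subvP/addvSl.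
- apply/orP; right; rewrite (leq_ltn_trans dimM) //.
  rewrite ltn_neqAle !(dimv_leqif_sup (addvSl M <[x]>)) andbT.
  by rewrite subv_add subvv -memvE xM.
Qed.

Lemma Engel_span K : (0 < m)%N -> {in K &, forall x y, lie x y \in K} ->
  {in K, forall x, exists n, rho x ^+ n = 0} -> ~~ (1%:M <= act_span K (1%:M : 'M_m))%MS.
Proof.
move=> m0 KK /(Engel KK) nK; apply/negP => /nK /eqP; apply/negP.
by rewrite -mxrank_eq0 mxrank1 -lt0n.
Qed.
End Engel.

(** * Reductive Lie algebras *)

Section Nilpotent.
Variables (C : numClosedFieldType) (n : nat).
Implicit Types A : 'M[C]_n.+1.

Lemma nilpotent_or_eigenvalue A :
  A ^+ n.+1 = 0 \/ exists2 a, a != 0 & eigenvalue A a.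
Proof.
have [r er] := closed_field_poly_normal (char_poly A).
rewrite (monicP (char_poly_monic A)) scale1r in er.
have [/allP r0|/allPn[a ar a0]] := boolP (all (pred1 0) r); last first.
  by right; exists a => //; rewrite eigenvalue_root_char er root_prod_XsubC.
left; rewrite -(horner_mx_X A) -rmorphXn /=.
suff <- : char_poly A = 'X^(n.+1) by exact: Cayley_Hamilton.
have sr : size r = n.+1.
  by apply: succn_inj; rewrite -(size_char_poly A) er size_prod_XsubC.
rewrite er -[in RHS]sr; elim: r r0 {er sr} => [|a r IH] r0; first by rewrite big_nil.
rewrite big_cons IH => [|b br]; last by rewrite r0 // inE br orbT.
by have /eqP -> := r0 a (mem_head a r); rewrite subr0 -exprS.
Qed.

Lemma mxtrace_nilpotent A k : A ^+ k = 0 -> \tr A = 0.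
Proof.
move=> Ak; have [U /unitarymx_unit Uu sT] := Schur A (ltn0Sn n).
pose T := U *m A *m invmx U.
have tT : is_trig_mx T by rewrite /T -conjumx.
have -> : \tr A = \tr T by rewrite /T mxtrace_mulC mulmxA mulVmx // mul1mx.
have Tk : horner_mx T 'X^k = 0.
  by rewrite horner_mx_uconj // rmorphXn /= horner_mx_X Ak mulmx0 mul0mx.
rewrite /mxtrace big1 // => i _.
have [_ /(_ i)] := is_trig_horner_mx 'X^k tT.
by rewrite Tk mxE hornerXn => /esym/eqP; rewrite expf_eq0 => /andP[_ /eqP].
Qed.

End Nilpotent.

Section IterLinear.
Variables (F : fieldType) (V : lmodType F) (phi : {linear V -> V}) (n : nat).

Fact iter_is_linear : linear (iter n phi).
Proof. by move=> a u v; elim: n => //= k ->; rewrite linearP. Qed.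
HB.instance Definition _ :=
  GRing.isLinear.Build F V V *:%R (iter n phi) iter_is_linear.

End IterLinear.

Section Reductive.
Variables (F : fieldType) (L : lieAlgType F).
Implicit Types (x y z u : L) (W : {vspace L}).

Definition derived : {vspace L} :=
  <<[seq lie x y | x <- vbasis {:L}, y <- vbasis {:L}]>>%VS.

Lemma lie_vspaceP W (S T : {vspace L}) :
  {in vbasis S & vbasis T, forall x y, lie x y \in W} ->
  {in S & T, forall x y, lie x y \in W}.
Proof.
move=> H x y xS yT.
have n (X : {vspace L}) (i : 'I_(\dim X)) : (vbasis X)`_i \in (vbasis X : seq L).
  by rewrite mem_nth // size_tuple.
rewrite (coord_vbasis xS) (coord_vbasis yT) linear_sum memv_suml // => j _.
rewrite linearZ memvZ //= (big_morph (fun u => lie u _) (lieDl _) (lie0l _)).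
by rewrite memv_suml // => i _; rewrite lieZl memvZ // H.
Qed.

Lemma lie_derived x y : lie x y \in derived.
Proof.
apply: (@lie_vspaceP _ fullv fullv); rewrite ?memvf // => a b aB bB.
by apply: memv_span; apply/allpairsP; exists (a, b).
Qed.

Lemma sub_derived W : (forall x y, lie x y \in W) -> (derived <= W)%VS.
Proof. by move=> H; apply/span_subvP => _ /allpairsP[[a b] [_ _ ->]]. Qed.

Lemma ad_stable_lie W x w : ad_stable fullv W -> w \in W -> lie x w \in W.
Proof. by move=> sW; apply: sW; rewrite memvf. Qed.

Lemma ad_stable_liel W x w : ad_stable fullv W -> w \in W -> lie w x \in W.
Proof. by move=> sW wW; rewrite lieC memvN ad_stable_lie. Qed.

Lemma ad_stable_derived : ad_stable fullv derived.
Proof. by move=> x w _ _; apply: lie_derived. Qed.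

Hypothesis Lred : reductive L.

Lemma ad_stable_compl_lie W W' x y : ad_stable fullv W -> ad_stable fullv W' ->
  (W :&: W' = 0)%VS -> x \in W -> y \in W' -> lie x y = 0.
Proof.
move=> sW sW' e xW yW'; apply/eqP; rewrite -memv0 -e memv_cap.
by rewrite ad_stable_liel // ad_stable_lie.
Qed.

(** A complementary ideal [W] of the derived algebra is central, because [[L, W]] lies both in [W]
    and in the derived algebra. *)
Lemma reductive_decomp x : exists z d,
  [/\ x = z + d, forall y, lie y z = 0 & d \in derived].
Proof.
have [W [sW eW cW]] := Lred ad_stable_derived.
have : x \in (derived + W)%VS by rewrite eW memvf.
case/memv_addP => d dD [z zW ->]; exists z, d; split=> [|y|//]; first exact: addrC.
apply/eqP; rewrite -memv0 -cW memv_cap lie_derived.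
exact: ad_stable_lie.
Qed.

(** The line of a central [u] is an ideal. If [W] is a complementary ideal, all brackets can be
    computed in [W], so [u] lies in [W] and in its complement. *)
Lemma center_derived u : (forall y, lie y u = 0) -> u \in derived -> u = 0.
Proof.
move=> cu uD.
have su : ad_stable fullv <[u]>%VS.
  by move=> x _ _ /vlineP[a ->]; rewrite linearZ /= cu scaler0 mem0v.
have [W [sW eW cW]] := Lred su.
have DW : (derived <= W)%VS.
  apply: sub_derived => x y.
  have dec v : exists a w, v = a *: u + w /\ w \in W.
    have : v \in (<[u]> + W)%VS by rewrite eW memvf.
    by case/memv_addP => _ /vlineP[a ->] [w wW ->]; exists a, w.
  have [a [w [-> wW]]] := dec x; have [b [w' [-> w'W]]] := dec y.
  rewrite linearD linearZ /= cu scaler0 add0r lieDl lieZl lieC cu oppr0 scaler0 add0r.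
  exact: ad_stable_lie.
apply/eqP; rewrite -memv0 -cW memv_cap memv_line.
exact: subvP DW _ uD.
Qed.

Variable phi : {linear L -> L}.
Hypothesis phi_ad : forall x y, phi (lie x y) = lie x (phi y).

Lemma equivariant_iter_lie n x y : iter n phi (lie x y) = lie x (iter n phi y).
Proof. by elim: n => //= n ->; rewrite phi_ad. Qed.

Lemma equivariant_iter_derived n u : u \in derived -> iter n phi u \in derived.
Proof.
elim: n => //= n IH /IH; set v := iter n phi u => vD.
suff /subvP/(_ _ vD) : (derived <= linfun phi @^-1: derived)%VS.
  by rewrite -memv_preim lfunE.
by apply: sub_derived => x y; rewrite -memv_preim lfunE /= phi_ad lie_derived.
Qed.

(* If [phi^(n+1)] kills the derived algebra D and [n > 0], then [phi^n D] is an
   abelian ideal of a reductive Lie algebra contained in D, so it is 0. *)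
Lemma equivariant_nilpotent n : (forall x, iter n phi x = 0) ->
  forall x y, phi (lie x y) = 0.
Proof.
move=> phin; suff H k : (forall x y, iter k.+1 phi (lie x y) = 0) ->
    forall x y, phi (lie x y) = 0.
  case: n phin => [|n] phin; last by apply: (H n) => x y; apply: phin.
  by move=> x y; rewrite (_ : lie x y = 0) ?linear0 // -[LHS]/(iter 0 phi _) phin.
elim: k => [|k IH] k0; first exact: k0.
apply: IH => x0 y0.
pose psi : {linear L -> L} := iter k.+1 phi.
have psi_ad x y : psi (lie x y) = lie x (psi y) by apply: equivariant_iter_lie.
have psi2 u : u \in derived -> psi (psi u) = 0.
  suff /subvP D0 : (derived <= lker (linfun psi \o linfun psi))%VS.
    by move=> /D0; rewrite memv_ker comp_lfunE !lfunE /= => /eqP.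
  apply: sub_derived => x y; rewrite memv_ker comp_lfunE !lfunE /=.
  suff : iter (k.+1 + k.+1) phi (lie x y) = 0 by rewrite iterD => /eqP.
  have -> : (k.+1 + k.+1 = k + k.+2)%N by rewrite !addnS.
  by rewrite iterD k0 linear0.
pose I := (linfun psi @: derived)%VS.
have sI : ad_stable fullv I.
  move=> x _ _ /memv_imgP[u uD ->]; rewrite lfunE /= -[lie x _]psi_ad.
  by rewrite -[psi _]lfunE memv_img // lie_derived.
have [W [sW eW cW]] := Lred sI.
have psiI u : u \in derived -> psi u \in I by move=> uD; rewrite -[psi u]lfunE memv_img.
apply: center_derived => [v|]; last exact/equivariant_iter_derived/lie_derived.
have psiu := psiI _ (lie_derived x0 y0); rewrite -/(psi (lie x0 y0)).
have : v \in (I + W)%VS by rewrite eW memvf.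
case/memv_addP => _ /memv_imgP[a aD ->] [w wW ->]; rewrite lfunE /= lieDl.
rewrite (lieC w) (ad_stable_compl_lie sI sW cW psiu wW) oppr0 addr0.
by rewrite -psi_ad lieC linearN -psi_ad psi2 ?lie_derived // oppr0.
Qed.

End Reductive.

(** * Casimir operators *)

Section LinearSums.
Variables (F : fieldType) (V : lmodType F) (A : lmodType F) (h : V -> A).
Hypothesis h_lin : linear h.

Lemma linear_suml (I : finType) (a : I -> F) (v : I -> V) :
  h (\sum_i a i *: v i) = \sum_i a i *: h (v i).
Proof.
pose hL := GRing.isLinear.Build F V A *:%R h h_lin.
pose h' : {linear V -> A} := HB.pack h hL.
rewrite -[h]/(h' : V -> A) linear_sum; apply: eq_bigr => i _; exact: linearZ.
Qed.

End LinearSums.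

Section DualFamilies.
Variables (F : fieldType) (V : lmodType F) (q : V -> V -> F).

(* The families may be longer than a basis, e.g. padded by zeros. *)
Definition dual_families (I : finType) (e f : I -> V) : Prop :=
  (forall u, u = \sum_k q u (f k) *: e k) /\
  (forall u, u = \sum_k q u (e k) *: f k).

Hypothesis q_sym : forall u v, q u v = q v u.
Variables (I : finType) (e f : I -> V).
Hypothesis ef : dual_families e f.

(** The tensor of the pairs [e k], [f k] is dual to [q], so an operator skew for [q] annihilates it:
    the expansions of [T (e k)] in [e] and of [T (f k)] in [f] have opposite coefficients.
    Centrality of the Casimir element of [g] and invariance of the spin lift, the cubic term and the
    Dirac operator are deduced from this. *)
Lemma dual_families_skew (T : V -> V) (A : lmodType F) (Phi : V -> V -> A) :
  (forall u v, q (T u) v = - q u (T v)) ->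
  (forall v, linear (Phi^~ v)) -> (forall u, linear (Phi u)) ->
  \sum_k (Phi (T (e k)) (f k) + Phi (e k) (T (f k))) = 0.
Proof.
move=> Tq Pl Pr; rewrite big_split /=.
under eq_bigr do rewrite [T _](ef.1 _) (linear_suml (Pl _)).
under [X in _ + X]eq_bigr do rewrite [T _](ef.2 _) (linear_suml (Pr _)).
rewrite [X in _ + X]exchange_big -big_split big1 //= => k _.
rewrite -big_split big1 //= => l _.
by rewrite [q (T (f l)) _]q_sym -[q (e k) _]opprK -Tq scaleNr subrr.
Qed.

Lemma dual_families_swap (A : lmodType F) (Phi : V -> V -> A) :
  (forall v, linear (Phi^~ v)) -> (forall u, linear (Phi u)) ->
  \sum_k Phi (e k) (f k) = \sum_k Phi (f k) (e k).
Proof.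
move=> Pl Pr.
under eq_bigr do rewrite {1}[f _](ef.1 _) (linear_suml (Pr _)).
under [RHS]eq_bigr do rewrite {1}[f _](ef.1 _) (linear_suml (Pl _)).
rewrite exchange_big; apply: eq_bigr => k _; apply: eq_bigr => l _.
by rewrite q_sym.
Qed.

End DualFamilies.

Section Casimir.
Variables (F : fieldType) (L : lieAlgType F) (q : L -> L -> F).
Hypotheses (q_sym : forall u v, q u v = q v u) (q_inv : invariant_form q).
Hypothesis q_lin : forall u, scalar (q u).
Variables (N : nat) (e f : 'I_N.+1 -> L).
Hypothesis ef : dual_families q e f.
Implicit Types (x y z : L) (M : 'M[F]_N.+1).

Definition ad_coord x : 'M[F]_N.+1 := \matrix_(k, l) q (lie x (e k)) (f l).

Lemma ad_coordE x k : lie x (e k) = \sum_l ad_coord x k l *: e l.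
Proof. by rewrite [LHS](ef.1 _); under [RHS]eq_bigr do rewrite mxE. Qed.

Lemma form_suml (I : finType) (a : I -> F) (v : I -> L) u :
  q u (\sum_i a i *: v i) = \sum_i a i * q u (v i).
Proof. exact: (@linear_suml F L F^o _ (q_lin u)). Qed.

Lemma formN u v : q u (- v) = - q u v.
Proof.
by have := form_suml (fun=> -1) (fun _ : 'I_1 => v) u; rewrite !big_ord1 scaleN1r mulN1r.
Qed.

Lemma lie_form_skew x u v : q (lie x u) v = - q u (lie x v).
Proof. by rewrite q_sym lieC formN q_sym q_inv. Qed.

Lemma ad_coordE' x k : lie x (f k) = - \sum_j ad_coord x j k *: f j.
Proof.
rewrite [LHS](ef.2 _) -sumrN; apply: eq_bigr => j _.
by rewrite lie_form_skew q_sym mxE scaleNr.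
Qed.

Lemma form_eq u v : (forall w, q u w = q v w) -> u = v.
Proof. by move=> H; rewrite (ef.1 u) (ef.1 v); apply: eq_bigr => k _; rewrite H. Qed.

(** The image of the invariant tensor of [q] with [M] applied to one leg; [M = 1] gives the usual
    Casimir operator. *)
Definition casimir m (rho : L -> 'M[F]_m) M : 'M[F]_m :=
  \sum_k \sum_l M k l *: (rho (e l) *m rho (f k)).

Variables (m : nat) (rho : {linear L -> 'M[F]_m}).
Hypothesis rhoP : lie_rep rho.

(** The bracket with [x] acts on the two legs by [M *m ad_coord x] and [- ad_coord x *m M], the sign
    coming from invariance of [q]. *)
Lemma casimir_comm M : (forall x, M *m ad_coord x = ad_coord x *m M) ->
  forall x, rho x *m casimir rho M = casimir rho M *m rho x.
Proof.
move=> Mad x; apply/eqP; rewrite -subr_eq0; apply/eqP.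
have -> : rho x *m casimir rho M - casimir rho M *m rho x =
   \sum_k \sum_l M k l *: (rho (lie x (e l)) *m rho (f k)) +
   \sum_k \sum_l M k l *: (rho (e l) *m rho (lie x (f k))).
  rewrite mulmx_sumr mulmx_suml -sumrB -big_split; apply: eq_bigr => k _ /=.
  rewrite mulmx_sumr mulmx_suml -sumrB -big_split; apply: eq_bigr => l _ /=.
  rewrite -scalemxAr -scalemxAl -scalerBr -scalerDr; congr (_ *: _).
  by rewrite !rhoP mulmxBl mulmxBr !mulmxA addrA subrK.
have -> : \sum_k \sum_l M k l *: (rho (lie x (e l)) *m rho (f k)) =
    \sum_k \sum_j (M *m ad_coord x) k j *: (rho (e j) *m rho (f k)).
  apply: eq_bigr => k _.
  under [RHS]eq_bigr do rewrite mxE scaler_suml.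
  rewrite exchange_big; apply: eq_bigr => l _ /=.
  rewrite ad_coordE linear_sum mulmx_suml scaler_sumr; apply: eq_bigr => j _.
  by rewrite linearZ -scalemxAl scalerA.
have -> : \sum_k \sum_l M k l *: (rho (e l) *m rho (lie x (f k))) =
    - \sum_k \sum_j (ad_coord x *m M) k j *: (rho (e j) *m rho (f k)).
  rewrite exchange_big [X in _ = - X]exchange_big -sumrN; apply: eq_bigr => l _ /=.
  under [in RHS]eq_bigr do rewrite mxE scaler_suml.
  rewrite exchange_big -sumrN; apply: eq_bigr => k _ /=.
  rewrite ad_coordE' linearN linear_sum mulmxN mulmx_sumr scalerN scaler_sumr.
  congr (- _); apply: eq_bigr => j _.
  by rewrite linearZ -scalemxAr scalerA mulrC.
by under eq_bigr do under eq_bigr do rewrite Mad; rewrite subrr.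
Qed.

End Casimir.

Section TraceForm.
Variables (C : numClosedFieldType) (L : lieAlgType C) (q : L -> L -> C).
Hypotheses (q_sym : forall u v, q u v = q v u) (q_inv : invariant_form q).
Hypothesis q_lin : forall u, scalar (q u).
Variables (N : nat) (e f : 'I_N.+1 -> L).
Hypothesis ef : dual_families q e f.
Hypothesis Lred : reductive L.
Variables (m : nat) (rho : {linear L -> 'M[C]_m.+1}).
Hypothesis rhoP : lie_rep rho.
Implicit Types (x y z : L) (M : 'M[C]_N.+1).

Let beta x y := \tr (rho x *m rho y).
(** The endomorphism representing the trace form of [rho] with respect to [q]; as both forms are
    invariant, it commutes with the adjoint action. *)
Definition trace_dual x := \sum_l beta x (f l) *: e l.
Local Notation phi := trace_dual.

Fact trace_dual_is_linear : linear phi.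
Proof.
move=> a x y; rewrite /trace_dual scaler_sumr -big_split; apply: eq_bigr => l _ /=.
by rewrite /beta linearD linearZ mulmxDl -scalemxAl mxtraceD mxtraceZ scalerDl scalerA.
Qed.
HB.instance Definition _ := GRing.isLinear.Build C L L *:%R phi trace_dual_is_linear.

Let phiE x y : q (phi x) y = beta x y.
Proof.
rewrite q_sym /trace_dual (form_suml q_lin) {2}(ef.2 y) /beta linear_sum mulmx_sumr.
rewrite raddf_sum; apply: eq_bigr => l _ /=.
by rewrite linearZ -scalemxAr mxtraceZ mulrC.
Qed.

Let beta_inv x y z : beta (lie x y) z = - beta y (lie x z).
Proof.
have trB (A B : 'M[C]_m.+1) : \tr (A - B) = \tr A - \tr B by rewrite raddfB.
rewrite /beta !rhoP mulmxBl mulmxBr !trB opprB.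
by rewrite -!mulmxA mxtrace_mulC -!mulmxA.
Qed.

Let phi_ad x y : phi (lie x y) = lie x (phi y).
Proof.
apply: (form_eq ef) => w; rewrite phiE (lie_form_skew q_sym q_inv q_lin) phiE.
exact: beta_inv.
Qed.

(* The tensor [M] is chosen so that the trace of its Casimir operator is the
   sum of the squared absolute values of the eigenvalues of [phi]. *)
Lemma trace_form_derived :
  (forall M, (forall x, M *m ad_coord q e f x = ad_coord q e f x *m M) ->
     exists k, casimir e f rho M ^+ k = 0) ->
  forall x y z, \tr (rho (lie x y) *m rho z) = 0.
Proof.
move=> nil.
pose A : 'M[C]_N.+1 := \matrix_(k, l) beta (e k) (f l).
have phi_e k : phi (e k) = \sum_l A k l *: e l.
  by rewrite /trace_dual; apply: eq_bigr => l _; rewrite mxE.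
have Aad x : A *m ad_coord q e f x = ad_coord q e f x *m A.
  apply/matrixP => k l; rewrite !mxE.
  transitivity (q (lie x (phi (e k))) (f l)).
    rewrite phi_e linear_sum /= q_sym.
    rewrite (eq_bigr (fun j => A k j *: lie x (e j))) => [|j _]; last first.
      by rewrite linearZ.
    rewrite (form_suml q_lin); apply: eq_bigr => j _.
    by rewrite [ad_coord _ _ _ _ _ _]mxE q_sym.
  rewrite -phi_ad phiE (ad_coordE ef) /beta linear_sum mulmx_suml raddf_sum.
  by apply: eq_bigr => j _ /=; rewrite linearZ -scalemxAl mxtraceZ [A _ _]mxE.
have [p [trp _]] := replica A.
have Mad x : horner_mx A p *m ad_coord q e f x = ad_coord q e f x *m horner_mx A p.
  by apply/esym/comm_mx_horner/esym/Aad.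
have [k /mxtrace_nilpotent trM] := nil _ Mad.
(* The trace of the Casimir operator of a tensor [M] is [\tr (M *m A)], where [A] is the matrix of
   the trace form; it vanishes because the operator is nilpotent. *)
have {trp}/trp An : \tr (A *m horner_mx A p) = 0.
  rewrite mxtrace_mulC -{}trM /casimir raddf_sum; apply: eq_bigr => i _ /=.
  rewrite mxE raddf_sum; apply: eq_bigr => j _ /=.
  by rewrite mxtraceZ [A _ _]mxE.
have phi_iter n i : iter n phi (e i) = \sum_l (A ^+ n) i l *: e l.
  elim: n => [|n IH] /=.
    rewrite expr0 (bigD1 i) //= big1 ?addr0 ?mxE ?eqxx ?scale1r // => j ji.
    by rewrite mxE eq_sym (negPf ji) scale0r.
  rewrite {}IH linear_sum /= exprSr.
  under [RHS]eq_bigr do rewrite mxE scaler_suml.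
  rewrite [RHS]exchange_big; apply: eq_bigr => l _ /=.
  rewrite linearZ /= phi_e scaler_sumr; apply: eq_bigr => j _.
  by rewrite scalerA.
(* Nilpotency of [A] passes to [phi] although [e] may be redundant; reductivity then makes [phi]
   kill all brackets. *)
have phin x : iter N.+1 phi x = 0.
  rewrite (ef.1 x) linear_sum big1 // => i _.
  rewrite linearZ /= -/(iter N.+1 phi _) phi_iter An big1 ?scaler0 // => j _.
  by rewrite mxE scale0r.
move=> x y z; rewrite -/(beta _ _) -phiE.
rewrite (equivariant_nilpotent Lred phi_ad phin) q_sym.
by have := form_suml q_lin (fun=> 0) (fun _ : 'I_0 => 0) z; rewrite !big_ord0.
Qed.

End TraceForm.

(** * Cartan's criterion *)

Section Cartan.
Variables (C : numClosedFieldType) (L : lieAlgType C).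
Hypothesis Lred : reductive L.

(** Modulo the center every element is in the derived algebra, so brackets with one entry in that
    algebra suffice. *)
Lemma sub_derived_lie (W : {vspace L}) :
  (forall a b, a \in derived L -> lie a b \in W) -> (derived L <= W)%VS.
Proof.
move=> H; apply: sub_derived => x y.
have [z [d [-> zc dD]]] := reductive_decomp Lred x.
by rewrite lieDl (lieC z) zc oppr0 add0r H.
Qed.

Variables (m : nat) (rho : {linear L -> 'M[C]_m.+1}).
Hypothesis rhoP : lie_rep rho.

(** Let [y] be the conjugate replica of [rho d]. It need not lie in [rho L], but [ad y] preserves
    [rho L], so moving [y] inside the trace turns [\tr (rho (lie a b) *m y)] into
    [- \tr (rho a *m rho c)] for some [c], which is 0 for [a] derived. By linearity
    [\tr (rho d *m y) = 0], and [replica] gives nilpotency. *)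
Lemma cartan_nilpotent : (forall x y z, \tr (rho (lie x y) *m rho z) = 0) ->
  forall d, d \in derived L -> rho d ^+ m.+1 = 0.
Proof.
move=> tr0 d dD; have [p [trp stp]] := replica (rho d).
apply: trp; set y := horner_mx _ p in stp *.
have lin_h (u : 'M[C]_m.+1) : linear (fun x => \tr (rho x *m u) : C^o).
  by move=> a x x'; rewrite linearP mulmxDl -scalemxAl mxtraceD mxtraceZ.
pose h u : {linear L -> C^o} := HB.pack (fun x => \tr (rho x *m u) : C^o)
  (GRing.isLinear.Build C L C^o *:%R _ (lin_h u)).
have ker_h u x : (x \in lker (linfun (h u))) = (\tr (rho x *m u) == 0).
  by rewrite memv_ker lfunE.
have trD a c : a \in derived L -> \tr (rho a *m rho c) = 0.
  move=> aD; apply/eqP; rewrite -ker_h; apply: subvP aD.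
  by apply: sub_derived => x x'; rewrite ker_h tr0.
pose P0 := \matrix_(i < \dim {:L}) mxvec (rho (vbasis {:L})`_i).
have inP x : (mxvec (rho x) <= P0)%MS.
  rewrite (coord_vbasis (memvf x)) !linear_sum summx_sub // => i _.
  rewrite !linearZ scalemx_sub // (_ : _ (rho _) = row i P0) ?row_sub //.
  by rewrite rowK.
have ofP z : (mxvec z <= P0)%MS -> exists x, z = rho x.
  move=> /submxP[D eD]; exists (\sum_i D 0 i *: (vbasis {:L})`_i).
  apply: (can_inj mxvecK); rewrite eD mulmx_sum_row !linear_sum.
  by apply: eq_bigr => i _; rewrite !linearZ rowK.
(* [replica] speaks of square matrices, so [P0] is replaced by a square matrix with the same row
   space. *)
have stP0 : stablemx <<P0>>%MS (ad_mx (rho d)).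
  rewrite (eqmxMr _ (genmxE _)) genmxE; apply/row_subP => i.
  by rewrite row_mul rowK mxvec_ad_mx -rhoP.
have {stP0}/stp stP : stablemx <<P0>>%MS (ad_mx (rho d)) by [].
have ady b : exists c, y *m rho b - rho b *m y = rho c.
  apply: ofP; rewrite -mxvec_ad_mx -(genmxE P0).
  by rewrite (submx_trans _ stP) // submxMr // genmxE.
rewrite mxtrace_mulC; apply/eqP; rewrite mxtrace_mulC -ker_h; apply: subvP dD.
apply: sub_derived_lie => a b aD; rewrite ker_h rhoP.
have [c ec] := ady b.
have -> : \tr ((rho a *m rho b - rho b *m rho a) *m y) = - \tr (rho a *m rho c).
  have trB (A B : 'M[C]_m.+1) : \tr (A - B) = \tr A - \tr B by rewrite raddfB.
  rewrite -ec mulmxBl mulmxBr !trB opprB -!mulmxA; congr (_ - _).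
  by rewrite mxtrace_mulC -mulmxA.
by rewrite trD // oppr0.
Qed.

End Cartan.

(** * Lifting invariants *)

Section Restriction.
Variables (F : fieldType) (L : lieAlgType F) (m n : nat).
Variables (rho : {linear L -> 'M[F]_n}) (Q : 'M[F]_(m, n)).
Hypotheses (rhoP : lie_rep rho) (Qfree : row_free Q).
Hypothesis Qst : forall x, stablemx Q (rho x).

Definition restrict_rep (x : L) : 'M[F]_m := conjmx Q (rho x).

Fact restrict_rep_is_linear : linear restrict_rep.
Proof.
move=> a x y; rewrite /restrict_rep /conjmx linearP mulmxDr mulmxDl.
by rewrite -scalemxAr -scalemxAl.
Qed.
HB.instance Definition _ :=
  GRing.isLinear.Build F L 'M[F]_m *:%R restrict_rep restrict_rep_is_linear.

Lemma restrict_repK x : restrict_rep x *m Q = Q *m rho x.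
Proof. exact/mulmxKpV/Qst. Qed.

Lemma restrict_repMK x y : restrict_rep x *m restrict_rep y *m Q = Q *m (rho x *m rho y).
Proof.
by rewrite -[LHS]mulmxA restrict_repK [LHS]mulmxA restrict_repK -[LHS]mulmxA.
Qed.

Lemma restrict_rep_lie : lie_rep restrict_rep.
Proof.
move=> x y; apply: (row_free_inj Qfree).
by rewrite /= mulmxBl !restrict_repMK restrict_repK rhoP mulmxBr.
Qed.

Lemma restrict_repX x k : restrict_rep x ^+ k *m Q = Q *m rho x ^+ k.
Proof.
elim: k => [|k IH]; first by rewrite !expr0 mulmx1 mul1mx.
by rewrite !exprS -[LHS]mulmxA IH [LHS]mulmxA restrict_repK -[LHS]mulmxA.
Qed.

Lemma restrict_casimir N (e f : 'I_N.+1 -> L) M :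
  casimir e f restrict_rep M *m Q = Q *m casimir e f rho M.
Proof.
rewrite /casimir mulmx_sumr mulmx_suml; apply: eq_bigr => k _.
rewrite mulmx_sumr mulmx_suml; apply: eq_bigr => l _.
by rewrite -scalemxAl -scalemxAr restrict_repMK.
Qed.

End Restriction.

Section Invariants.
Variables (C : numClosedFieldType) (L : lieAlgType C) (q : L -> L -> C).
Hypotheses (q_sym : forall u v, q u v = q v u) (q_inv : invariant_form q).
Hypothesis q_lin : forall u, scalar (q u).
Variables (N : nat) (e f : 'I_N.+1 -> L).
Hypothesis ef : dual_families q e f.
Hypothesis Lred : reductive L.
Variables (n : nat) (rho : {linear L -> 'M[C]_n}).
Hypothesis rhoP : lie_rep rho.
Hypothesis center_ss : forall z, (forall y, lie y z = 0) ->
  forall u : 'rV_n, u *m rho z *m rho z = 0 -> u *m rho z = 0.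

Lemma center_mx_nilpotent z k l (A : 'M[C]_(l, n)) : (forall y, lie y z = 0) ->
  A *m rho z ^+ k = 0 -> A *m rho z = 0.
Proof.
move=> zc Az; apply/row_matrixP => i; rewrite row_mul row0.
have : row i A *m rho z ^+ k.+1 = 0.
  by rewrite exprSr mulmxA -row_mul Az row0 mul0mx.
elim: k {Az} => [//|k IH] /=; rewrite !exprSr !mulmxA => /(center_ss zc) H.
by apply: IH; rewrite exprSr mulmxA.
Qed.

Section Step.
Variables (A : 'M[C]_n) (p : 'rV[C]_n).
Hypothesis Ast : forall x, stablemx A (rho x).
Hypothesis pA : forall x, (p *m rho x <= A)%MS.

(** The row [p'] is an invariant of the quotient by [A'], and [p' - a] is an invariant vector above
    it. *)
Definition lifts (A' : 'M[C]_n) : Prop := forall p' : 'rV_n,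
  (forall x, stablemx A' (rho x)) -> (forall x, p' *m rho x <= A')%MS ->
  exists2 a, (a <= A')%MS & forall x, (p' - a) *m rho x = 0.

(** With [H = G - c%:M], the image [A *m H] is smaller than [A] and [p *m H] is invariant modulo it,
    so some [p *m H - a1] is invariant. Since [p *m G] lies in [A], solving
    [p *m H = p *m G - c *: p] for [p] corrects [p] by an element of [A]. *)
Lemma lifts_eigen G c (v : 'rV_n) :
  (forall x, rho x *m G = G *m rho x) ->
  (forall p' : 'rV_n, (forall x, p' *m rho x <= A)%MS -> (p' *m G <= A)%MS) ->
  c != 0 -> v != 0 -> (v <= A)%MS -> v *m G = c *: v ->
  (forall A' : 'M_n, (\rank A' < \rank A)%N -> lifts A') ->
  exists2 a, (a <= A)%MS & forall x, (p - a) *m rho x = 0.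
Proof.
move=> comG augG c0 v0 vA vG IH.
pose H := G - c%:M; pose A1 := A *m H.
have comH x : rho x *m H = H *m rho x.
  by rewrite mulmxBl mulmxBr comG mul_mx_scalar mul_scalar_mx.
have AG : (A *m G <= A)%MS.
  apply/row_subP => i; rewrite row_mul; apply: augG => x.
  by rewrite -row_mul (submx_trans (row_sub _ _)) // Ast.
have A1A : (A1 <= A)%MS.
  by rewrite /A1 mulmxBr addmx_sub ?eqmx_opp // mul_mx_scalar scalemx_sub.
have rk : (\rank A1 < \rank A)%N.
  rewrite -(mxrank_mul_ker A H) -[ltnLHS]addn0 ltn_add2l lt0n mxrank_eq0.
  apply: contra v0 => /eqP e0; rewrite -submx0 -e0 sub_capmx vA.
  by apply/sub_kermxP; rewrite mulmxBr vG mul_mx_scalar subrr.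
have [x|x|a1 a1A Ha1] := IH A1 rk (p *m H).
- by rewrite -mulmxA -comH mulmxA submxMr.
- by rewrite -mulmxA -comH mulmxA submxMr.
exists (c^-1 *: (p *m G - a1)).
  by rewrite scalemx_sub // addmx_sub ?eqmx_opp ?augG // (submx_trans a1A).
move=> x; have -> : p - c^-1 *: (p *m G - a1) = - c^-1 *: (p *m H - a1).
  apply: (scalerI c0); rewrite scalerBr !scalerA mulfV // mulrN mulfV //.
  rewrite scaleN1r scale1r mulmxBr mul_mx_scalar.
  by rewrite !opprD !opprK -[RHS]addrA addrCA.
by rewrite -scalemxAl Ha1 scaler0.
Qed.

(** Each term of the Casimir operator starts with some [rho (e l)], which already sends [p'] into
    [A]. *)
Lemma augmentation_casimir M (p' : 'rV_n) :
  (forall x, p' *m rho x <= A)%MS -> (p' *m casimir e f rho M <= A)%MS.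
Proof.
move=> p'A; rewrite mulmx_sumr summx_sub // => k _.
rewrite mulmx_sumr summx_sub // => l _.
by rewrite -scalemxAr scalemx_sub // mulmxA (submx_trans (submxMr _ (p'A _))) ?Ast.
Qed.

End Step.

(** Induction on the rank of [A]. A nonzero eigenvalue of a suitable commuting operator shrinks [A]
    by [lifts_eigen]; otherwise [A] shrinks to the span of its images under the derived algebra,
    modulo which [p] is still invariant. *)
Lemma invariant_lift A : lifts A.
Proof.
move: {2}(\rank A).+1 (ltnSn (\rank A)) => k.
elim: k A => // k IHk A rkA p Ast pA.
have {IHk} IH (A' : 'M_n) : (\rank A' < \rank A)%N -> lifts A'.
  by move=> rk; apply/IHk/(leq_trans rk).
case rk: (\rank A) => [|m].
  exists 0; rewrite ?sub0mx // => x; rewrite subr0; apply/eqP.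
  by rewrite -submx0; move/eqP: rk; rewrite mxrank_eq0 => /eqP <-.
have [Q Qfree QA] : exists2 Q : 'M_(m.+1, n), row_free Q & (Q :=: A)%MS.
  by move: (row_base A) (row_base_free A) (eq_row_base A); rewrite rk => Q; exists Q.
have Qst x : stablemx Q (rho x) by rewrite (eqmxMr _ QA) QA Ast.
pose rho' : {linear L -> 'M_m.+1} := restrict_rep rho Q.
have rho'P : lie_rep rho' by apply: restrict_rep_lie.
have eigen G G' : (forall x, rho x *m G = G *m rho x) ->
    (forall p' : 'rV_n, (forall x, p' *m rho x <= A)%MS -> (p' *m G <= A)%MS) ->
    G' *m Q = Q *m G -> (G' ^+ m.+1 = 0) \/
    exists2 a, (a <= A)%MS & forall x, (p - a) *m rho x = 0.
  move=> comG augG eG; have [|[c c0 /eigenvalueP[v vG' v0]]] := nilpotent_or_eigenvalue G'.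
    by left.
  right; apply: (lifts_eigen Ast pA comG augG c0 (v := v *m Q)) => //.
  - by apply: contra v0 => /eqP e0; apply/eqP/(row_free_inj Qfree); rewrite mul0mx.
  - by rewrite -QA submxMl.
  - by rewrite -mulmxA -eG mulmxA vG' scalemxAl.
(* From here on the goal may be assumed false, so [eigen] makes every admissible commuting operator
   nilpotent on [A]. *)
have [//|nogoal] := pselect (exists2 a, (a <= A)%MS & forall x, (p - a) *m rho x = 0).
have tr0 x y z : \tr (rho' (lie x y) *m rho' z) = 0.
  apply: (trace_form_derived q_sym q_inv q_lin ef Lred rho'P) => M Mad.
  exists m.+1; have [|||//|//] := eigen (casimir e f rho M) (casimir e f rho' M).
  - exact: casimir_comm.
  - exact: augmentation_casimir.
  - exact: (restrict_casimir Qst).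
have nil d : d \in derived L -> exists k, rho' d ^+ k = 0.
  by move=> dD; exists m.+1; apply: cartan_nilpotent.
(* A central element is nilpotent on [A] by [eigen] and semisimple by [center_ss], hence zero there;
   applied once more, [center_ss] kills [p *m rho z]. *)
have Az z : (forall y, lie y z = 0) -> A *m rho z = 0.
  move=> zc; apply: (@center_mx_nilpotent z m.+1) => //.
  have [x|p' p'A||z0|//] := eigen (rho z) (rho' z).
  - by apply/eqP; rewrite -subr_eq0 -rhoP zc linear0.
  - exact: p'A.
  - exact: (restrict_repK Qst).
  apply/eqP; rewrite -submx0 -(eqmxMr _ QA) -(restrict_repX Qst) -[restrict_rep _ _ _]/(rho' z).
  by rewrite z0 mul0mx sub0mx.
have pz z : (forall y, lie y z = 0) -> p *m rho z = 0.
  move=> zc; apply: center_ss => //; apply/eqP; rewrite -submx0 -(Az z zc).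
  by rewrite submxMr.
(* [A1] contains [A *m rho x] for all [x], and it is smaller than [A] by Engel's theorem. Expanding
   [rho (lie a b)] shows that the derived algebra sends [p] into [A1]; the center kills [p]. *)
pose A1 := act_span rho (derived L) A.
have AA1 x : (A *m rho x <= A1)%MS.
  have [z [d [-> zc dD]]] := reductive_decomp Lred x.
  by rewrite linearD mulmxDr Az // add0r sub_act_span.
have A1A : (A1 <= A)%MS by apply: act_span_subP => x _; apply: Ast.
have [|x|x|a a1 Ha] := IH A1 _ p; last by exists a; rewrite // (submx_trans a1).
- rewrite ltn_neqAle mxrankS // andbT; apply/negP => /eqP rkA1.
  have AA : (A <= A1)%MS by have := mxrank_leqif_sup A1A => /geq_leqif; rewrite rkA1 leqnn => <-.
  have DD : {in derived L &, forall x y, lie x y \in derived L}.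
    by move=> x y _ _; apply: lie_derived.
  apply: (negP (Engel_span rho'P (ltn0Sn m) DD nil)).
  rewrite -(submxMfree _ _ Qfree) mul1mx QA (submx_trans AA) //.
  apply: (@submx_trans _ _ _ _ _ _ (act_span rho (derived L) Q)).
    by apply: act_spanS; rewrite QA.
  apply: act_span_subP => x xD; rewrite -(restrict_repK Qst) submxMr //.
  by have := sub_act_span rho' (1%:M : 'M_m.+1) xD; rewrite mul1mx.
- by rewrite (submx_trans (submxMr _ A1A)).
have [z [d [-> zc dD]]] := reductive_decomp Lred x.
rewrite linearD mulmxDr pz // add0r submxE.
have lin_p : linear (fun x => p *m rho x *m cokermx A1).
  by move=> a u v; rewrite linearP mulmxDr mulmxDl -scalemxAr -scalemxAl.
pose h : {linear L -> 'rV[C]_n} := HB.pack (fun x => p *m rho x *m cokermx A1)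
  (GRing.isLinear.Build C L 'rV[C]_n *:%R _ lin_p).
have ker_h y : (y \in lker (linfun h)) = (p *m rho y *m cokermx A1 == 0).
  by rewrite memv_ker lfunE.
rewrite -ker_h; apply: subvP dD; apply: sub_derived => a b.
rewrite ker_h -submxE rhoP mulmxBr !mulmxA addmx_sub ?eqmx_opp //.
  by rewrite (submx_trans (submxMr _ (pA a))).
by rewrite (submx_trans (submxMr _ (pA b))).
Qed.

End Invariants.

(** * Semisimplicity of the Casimir operator *)

Section CasimirSemisimple.
Variables (C : numClosedFieldType) (L : lieAlgType C) (q : L -> L -> C).
Hypotheses (q_sym : forall u v, q u v = q v u) (q_inv : invariant_form q).
Hypothesis q_lin : forall u, scalar (q u).
Variables (N : nat) (e f : 'I_N.+1 -> L).
Hypothesis ef : dual_families q e f.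
Hypothesis Lred : reductive L.
Variables (n : nat) (rho : {linear L -> 'M[C]_n}).
Hypothesis rhoP : lie_rep rho.

(** The order is opposite to that of [ad_mx]: acting on flattened rows from the right, it is this
    one that satisfies [lie_rep]. *)
Definition end_rep (x : L) : 'M[C]_(n * n) := lin_mulmxr (rho x) - lin_mulmx (rho x).

Lemma mxvec_end_rep a x : mxvec a *m end_rep x = mxvec (a *m rho x - rho x *m a).
Proof. by rewrite mulmxBr !mul_vec_lin -linearB. Qed.

Lemma eq_mx_mxvec k (A B : 'M[C]_(n * n, k)) :
  (forall a, mxvec a *m A = mxvec a *m B) -> A = B.
Proof. by move=> AB; apply/row_matrixP => i; rewrite !rowE -[delta_mx 0 i]vec_mxK AB. Qed.

Fact end_rep_is_linear : linear end_rep.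
Proof.
move=> c x y; apply: eq_mx_mxvec => a.
rewrite [RHS]mulmxDr -[X in _ = X + _]scalemxAr !mxvec_end_rep.
have -> : rho (c *: x + y) = c *: rho x + rho y by rewrite linearP.
rewrite mulmxDr mulmxDl -scalemxAr -scalemxAl opprD addrACA -scalerBr.
by rewrite linearD linearZ.
Qed.
HB.instance Definition _ :=
  GRing.isLinear.Build C L 'M[C]_(n * n) *:%R end_rep end_rep_is_linear.

Lemma end_rep_lie : lie_rep end_rep.
Proof.
move=> x y; apply: eq_mx_mxvec => a.
rewrite [RHS]mulmxBr 2!mulmxA !mxvec_end_rep -linearB rhoP; congr mxvec.
rewrite !mulmxBr !mulmxBl !mulmxA !opprB.
rewrite [RHS]addrACA !subrKA addrACA [RHS]addrACA; congr (_ + _).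
exact: addrC.
Qed.

Hypothesis center_ss : forall z, (forall y, lie y z = 0) ->
  forall a, let com b := b *m rho z - rho z *m b in com (com a) = 0 -> com a = 0.

(* An invariant projection onto an eigenspace of the Casimir operator is
   obtained by lifting an invariant from the quotient of the endomorphisms by
   those with image in the eigenspace and vanishing on it. *)
Lemma casimir_semisimple c (u : 'rV_n) :
  let O := \sum_k rho (e k) *m rho (f k) - c%:M in
  u *m O *m O = 0 -> u *m O = 0.
Proof.
move=> O uOO.
have comO x : rho x *m O = O *m rho x.
  have cas : casimir e f rho 1%:M = \sum_k rho (e k) *m rho (f k).
    apply: eq_bigr => k _; rewrite (bigD1 k) //= big1 ?addr0 ?mxE ?eqxx ?scale1r //.
    by move=> l lk; rewrite mxE eq_sym (negPf lk) scale0r.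
  have comC := @casimir_comm _ _ _ q_sym q_inv q_lin _ _ _ ef _ rho rhoP 1%:M.
  rewrite mulmxBr mulmxBl -cas comC ?mul_mx_scalar ?mul_scalar_mx //.
  by move=> y; rewrite mulmx1 mul1mx.
(* An arbitrary linear projection onto the eigenspace. Only [p_id] and [pO] are used; the lifting
   makes it equivariant. *)
pose p := proj_mx (kermx O) (kermx O)^C%MS.
have p_id k (v : 'M_(k, n)) : v *m O = 0 -> v *m p = v.
  by move=> /sub_kermxP vO; rewrite proj_mx_id // capmx_compl.
have pO : p *m O = 0.
  by apply/sub_kermxP; rewrite -[p]mul1mx; apply: proj_mx_sub.
clearbody p.
pose A : 'M_(n * n) := (kermx (lin_mulmxr O) :&: kermx (lin_mulmx p))%MS.
have AP a : reflect (a *m O = 0 /\ p *m a = 0) (mxvec a <= A)%MS.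
  rewrite sub_capmx; apply: (iffP andP) => -[].
    move=> /sub_kermxP + /sub_kermxP; rewrite !mul_vec_lin /=.
    by move=> /eqP + /eqP; rewrite !mxvec_eq0 => /eqP -> /eqP ->.
  by move=> aO pa; split; apply/sub_kermxP; rewrite mul_vec_lin /= ?aO ?pa linear0.
have pp : p *m p = p by apply: p_id.
have [|x|x|a aA Ha] := @invariant_lift _ _ _ q_sym q_inv q_lin _ _ _ ef Lred _
    end_rep end_rep_lie _ A (mxvec p).
- move=> z zc v; rewrite -[v]vec_mxK; move: (vec_mx v) => {}v.
  rewrite !mxvec_end_rep => /eqP; rewrite mxvec_eq0 => /eqP.
  by move=> /(center_ss zc) ->; rewrite linear0.
- apply/row_subP => i; rewrite row_mul -[row i A]vec_mxK mxvec_end_rep.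
  have : (mxvec (vec_mx (row i A)) <= A)%MS by rewrite vec_mxK row_sub.
  move: (vec_mx _) => a /AP[aO pa]; apply/AP; split.
    by rewrite mulmxBl -mulmxA comO mulmxA aO mul0mx -mulmxA aO mulmx0 subrr.
  have xp : p *m rho x *m p = p *m rho x.
    by apply: p_id; rewrite -mulmxA comO mulmxA pO mul0mx.
  have pxa : p *m rho x *m a = 0 by rewrite -xp -[LHS]mulmxA pa mulmx0.
  by rewrite mulmxBr !mulmxA pxa pa mul0mx subrr.
- rewrite mxvec_end_rep; apply/AP; split.
    by rewrite mulmxBl -mulmxA comO mulmxA pO mul0mx -mulmxA pO mulmx0 subrr.
  have xp : p *m rho x *m p = p *m rho x.
    by apply: p_id; rewrite -mulmxA comO mulmxA pO mul0mx.
  by rewrite mulmxBr !mulmxA pp xp subrr.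
move: aA Ha; rewrite -[a]vec_mxK; move: (vec_mx a) => {}a /AP[aO pa] Ha.
pose P := p - a.
have comP x : P *m rho x = rho x *m P.
  apply/eqP; rewrite -subr_eq0; apply/eqP; apply: (can_inj mxvecK).
  have mP : mxvec P = mxvec p - mxvec a by apply: linearB.
  by rewrite -mxvec_end_rep mP Ha linear0.
have PO : P *m O = 0 by rewrite mulmxBl pO aO subrr.
have comPO : P *m O = O *m P.
  rewrite [LHS]mulmxBr [RHS]mulmxBl mul_mx_scalar mul_scalar_mx mulmx_sumr mulmx_suml.
  by congr (_ - _); apply: eq_bigr => k _; rewrite mulmxA comP -mulmxA comP mulmxA.
(* By hypothesis [u *m O] lies in the kernel of [O], where [P] is the identity. As [P] commutes with
   [O] and [P *m O = 0], the vector vanishes. *)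
have uO_id : u *m O *m P = u *m O.
  have uOa : u *m O *m a = 0 by rewrite -(p_id _ _ uOO) -[LHS]mulmxA pa mulmx0.
  by rewrite [LHS]mulmxBr p_id // uOa subr0.
by rewrite -uO_id -mulmxA -comPO PO mulmx0.
Qed.

End CasimirSemisimple.

Section DiagonalizableCommutator.
Local Open Scope classical_set_scope.
Variables (F : fieldType) (n : nat) (Z : 'M[F]_n).

(** In an eigenbasis of [Z] the commutator multiplies the entry [(i, j)] by [d 0 j - d 0 i], hence
    is itself diagonal. *)
Lemma diagonalizable_commutator (a : 'M_n) : diagonalizable Z ->
  let com b := b *m Z - Z *m b in com (com a) = 0 -> com a = 0.
Proof.
move=> [P Pu /diagonalizable_forPex[d /(simmxP Pu) PZ]] com.
have ZP : Z *m invmx P = invmx P *m diag_mx d.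
  by rewrite -[LHS](mulKmx Pu) (mulmxA P) PZ mulmxK.
have comE b i j : (P *m com b *m invmx P) i j =
    (P *m b *m invmx P) i j * (d 0 j - d 0 i).
  have -> : P *m com b *m invmx P = P *m b *m invmx P *m diag_mx d -
      diag_mx d *m (P *m b *m invmx P).
    by rewrite mulmxBr mulmxBl !mulmxA PZ -mulmxA -mulmxA ZP !mulmxA.
  by rewrite mul_mx_diag mul_diag_mx !mxE mulrBr [d 0 i * _]mulrC.
move=> cc; suff : P *m com a *m invmx P = 0.
  move=> /(congr1 (fun B => invmx P *m B *m P)).
  by rewrite mulmx0 mul0mx -!mulmxA mulVmx // mulmx1 mulmxA mulVmx // mul1mx.
apply/matrixP => i j; rewrite comE [RHS]mxE.
have := comE (com a) i j; rewrite cc mulmx0 mul0mx comE [LHS]mxE => /esym/eqP.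
by rewrite !mulf_eq0 -orbA orbb -mulf_eq0 => /eqP.
Qed.

Lemma diagonalizable_span_eigen :
  (forall u : 'rV_n, exists2 l : seq (F * 'rV[F]_n),
     forall p, p \in l -> p.2 *m Z = p.1 *: p.2 & u = \sum_(p <- l) p.2) ->
  diagonalizable Z.
Proof.
move=> H; apply/diagonalizablePeigen.
have /choice[l lP] : forall i : 'I_n, exists l : seq (F * 'rV[F]_n),
    (forall p, p \in l -> p.2 *m Z = p.1 *: p.2) /\ delta_mx 0 i = \sum_(p <- l) p.2.
  by move=> i; have [l] := H (delta_mx 0 i); exists l.
pose rs := undup (flatten [seq [seq p.1 | p <- l i] | i <- enum 'I_n]).
exists rs; first exact: undup_uniq.
apply/eqmxP; rewrite submx1 /=; apply/row_subP => i.
rewrite row1 (lP i).2 big_seq summx_sub // => p pl.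
have prs : p.1 \in rs.
  rewrite mem_undup; apply/flattenP; exists [seq p.1 | p <- l i]; last exact: map_f.
  by apply: map_f; rewrite mem_enum.
rewrite (big_rem p.1) //=; apply: submx_trans (addsmxSl _ _).
by apply/eigenspaceP; apply: (lP i).1.
Qed.

End DiagonalizableCommutator.

(** * From finite-dimensional subspaces of an abstract module to matrices *)

Section FiniteDimensional.
Local Open Scope classical_set_scope.
Variables (F : fieldType) (V : lmodType F).

(** A spanning family of least size is free: a relation with [c j] nonzero would allow dropping
    [b j]. *)
Lemma finite_dim_basis (M : set V) : finite_dim M ->
  exists (n : nat) (b : 'I_n -> V), [/\ forall i, M (b i),
    forall v, M v -> exists c : 'I_n -> F, v = \sum_i c i *: b i &
    forall c : 'I_n -> F, \sum_i c i *: b i = 0 -> forall i, c i = 0].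
Proof.
move=> fdM.
pose Q n := `[< exists b : 'I_n -> V, (forall i, M (b i)) /\
  forall v, M v -> exists c : 'I_n -> F, v = \sum_i c i *: b i >].
have exQ : exists n, Q n by have [n Hn] := fdM; exists n; apply/asboolP.
case: (ex_minnP exQ) => n /asboolP[b [Mb spb]] minn; exists n, b; split=> // c c0 j.
apply: contrapT => /eqP cj; case: n => [|n] in b Mb spb minn c c0 j cj *; first by case: j cj.
suff /minn : Q n by rewrite ltnn.
apply/asboolP; exists (fun i => b (lift j i)); split=> [i|v /spb[a ->]]; first exact: Mb.
have bj : b j = \sum_i (- (c j)^-1 * c (lift j i)) *: b (lift j i).
  apply: (scalerI cj); move/eqP: c0; rewrite (bigD1_ord j) //= addr_eq0 => /eqP ->.
  rewrite scaler_sumr -sumrN; apply: eq_bigr => i _.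
  by rewrite scalerA mulrA mulrN mulfV // mulN1r scaleNr.
exists (fun i => a (lift j i) - a j * (c j)^-1 * c (lift j i)).
rewrite (bigD1_ord j) //= {1}bj scaler_sumr -big_split; apply: eq_bigr => i _ /=.
by rewrite scalerA scalerBl addrC mulNr mulrN mulrA scaleNr.
Qed.

End FiniteDimensional.

(** Diagonalizability stated vector by vector, with the eigenvectors kept inside [M]; in this form
    it passes to sums and tensor products without choosing bases. *)
Definition eigen_sum (F : fieldType) (V : lmodType F) (T : V -> V) (M : set V) v :=
  exists2 l : seq (F * V),
    forall p, p \in l -> M p.2 /\ T p.2 = p.1 *: p.2 & v = \sum_(p <- l) p.2.

Section AbstractCasimir.
Local Open Scope classical_set_scope.
Variables (C : numClosedFieldType) (L : lieAlgType C) (q : L -> L -> C).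
Hypotheses (q_sym : forall u v, q u v = q v u) (q_inv : invariant_form q).
Hypothesis q_lin : forall u, scalar (q u).
Variables (N : nat) (e f : 'I_N.+1 -> L).
Hypothesis ef : dual_families q e f.
Hypothesis Lred : reductive L.
Variables (V : lmodType C) (op : L -> {linear V -> V}) (M : set V).
Hypothesis op_lin : forall v, linear (op^~ v).
Hypothesis op_lie : forall x y v, op (lie x y) v = op x (op y v) - op y (op x v).
Hypothesis M_sub : is_subspace M.
Hypothesis M_fin : finite_dim M.
Hypothesis M_stable : forall x v, M v -> M (op x v).
Hypothesis M_center : forall z, (forall y, lie y z = 0) ->
  forall v, M v -> eigen_sum (op z) M v.

Lemma abstract_casimir_semisimple c w : M w ->
  let O v := \sum_k op (e k) (op (f k) v) - c *: v in
  O (O w) = 0 -> O w = 0.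
Proof.
have [n [b [Mb spb frb]]] := finite_dim_basis M_fin.
pose vec (u : 'rV[C]_n) := \sum_i u 0 i *: b i.
have vec_lin : linear vec.
  move=> a u v; rewrite scaler_sumr -big_split; apply: eq_bigr => i _ /=.
  by rewrite !mxE scalerDl scalerA.
pose vecL : {linear 'rV[C]_n -> V} := HB.pack vec (GRing.isLinear.Build C _ V *:%R vec vec_lin).
have vecD u v : vec (u + v) = vec u + vec v by exact: (linearD vecL).
have vecN u : vec (- u) = - vec u by exact: (linearN vecL).
have vec0 : vec 0 = 0 by exact: (linear0 vecL).
have vecZ a u : vec (a *: u) = a *: vec u.
  by rewrite -[a *: u]addr0 vec_lin vec0 addr0.
have vec_sum I (l : seq I) (u : I -> 'rV_n) : vec (\sum_(i <- l) u i) = \sum_(i <- l) vec (u i).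
  exact: (linear_sum vecL).
have vec_inj u v : vec u = vec v -> u = v.
  move=> /eqP; rewrite -subr_eq0 -vecN -vecD => /eqP /(frb _) H.
  by apply/rowP => i; apply/eqP; rewrite -subr_eq0; have := H i; rewrite !mxE => ->.
have vecM u : M (vec u).
  have [M0 MD] := M_sub; rewrite /vec; elim/big_ind: _ => [|v v'|i _] //.
    by rewrite -{2}[v]scale1r => ? ?; apply: MD.
  by rewrite -[X in M X]addr0; apply: MD.
have vecP v : M v -> exists u, v = vec u.
  move=> /spb[a ->]; exists (\row_i a i).
  by apply: eq_bigr => i _; rewrite mxE.
have /choice[co coP] : forall xi : L * 'I_n, exists u, op xi.1 (b xi.2) = vec u.
  by move=> [x i]; apply/vecP/M_stable.
(* Right multiplication of rows reverses products, so the sign is needed for [lie_rep]. *)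
pose R x : 'M[C]_n := - \matrix_i co (x, i).
have RP x u : vec (u *m R x) = - op x (vec u).
  rewrite mulmxN vecN; congr (- _).
  rewrite mulmx_sum_row vec_sum linear_sum; apply: eq_bigr => i _.
  by rewrite vecZ linearZ rowK -(coP (x, i)).
have eq_vec (A B : 'M[C]_n) : (forall u, vec (u *m A) = vec (u *m B)) -> A = B.
  by move=> AB; apply/row_matrixP => i; rewrite !rowE; apply/vec_inj/AB.
have R_lin : linear R.
  move=> a x y; apply: eq_vec => u; rewrite RP op_lin mulmxDr -scalemxAr.
  by rewrite vecD vecZ !RP opprD scalerN.
pose rho : {linear L -> 'M[C]_n} := HB.pack R (GRing.isLinear.Build C L 'M[C]_n *:%R R R_lin).
have RRP x y u : vec (u *m (R x *m R y)) = op y (op x (vec u)).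
  by rewrite mulmxA !RP linearN opprK.
have rhoP : lie_rep rho.
  move=> x y; apply: eq_vec => u; rewrite RP op_lie mulmxBr.
  by rewrite vecD vecN !RRP opprB.
(* For the same reason [op (e k)] after [op (f k)] becomes [rho (f k) *m rho (e k)]; the two signs
   cancel and the dual families change places. *)
have fe : dual_families q f e by case: ef.
have center_ss z : (forall y, lie y z = 0) -> forall a : 'M_n,
    let com b := b *m rho z - rho z *m b in com (com a) = 0 -> com a = 0.
  move=> zc a; apply: diagonalizable_commutator; apply: diagonalizable_span_eigen => u.
  have [l lP vl] := M_center zc (vecM u).
  have /choice[cv cvP] : forall v, exists u, M v -> v = vec u.
    move=> v; have [/vecP[u' ->]|] := pselect (M v); first by exists u'.
    by exists 0.
  exists [seq (- p.1, cv p.2) | p <- l].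
    move=> _ /mapP[p pl ->] /=; have [Mp Tp] := lP p pl.
    apply: vec_inj; rewrite RP vecZ.
    by rewrite -(cvP _ Mp) Tp scaleNr.
  apply: vec_inj; rewrite vl big_map vec_sum.
  by apply: eq_big_seq => p /lP[Mp _]; apply: cvP.
move=> /vecP[u ->] O OO.
have OP v : O (vec v) = vec (v *m (\sum_k rho (f k) *m rho (e k) - c%:M)).
  rewrite mulmxBr mul_mx_scalar mulmx_sumr vecD vecN vecZ vec_sum.
  by congr (_ - _); apply: eq_bigr => k _; rewrite RRP.
move: OO; rewrite !OP -mulmxA -[X in _ = X]vec0 => /vec_inj; rewrite mulmxA.
by move=> /(casimir_semisimple q_sym q_inv q_lin fe Lred rhoP center_ss) ->.
Qed.

End AbstractCasimir.

(** * Clifford algebras *)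

Section Commutator.
Variables (F : fieldType) (A : algType F).
Implicit Types a b c : A.

Definition com a b := a * b - b * a.

Fact com_is_linear a : linear (com a).
Proof.
move=> k b c; rewrite /com mulrDr mulrDl opprD addrACA -scalerAr -scalerAl.
by rewrite scalerBr.
Qed.
HB.instance Definition _ a := GRing.isLinear.Build F A A *:%R (com a) (com_is_linear a).

Lemma comNr a b : com a b = - com b a. Proof. by rewrite /com opprB. Qed.

Lemma comM a b c : com a (b * c) = com a b * c + b * com a c.
Proof. by rewrite /com mulrBl mulrBr !mulrA addrA subrK. Qed.

Lemma comMl a b c : com (a * b) c = a * com b c + com a c * b.
Proof. by rewrite /com mulrBl mulrBr !mulrA addrA subrK. Qed.

Lemma com_linearl c : linear (com^~ c).
Proof. by move=> k a b; rewrite comNr linearP opprD -scalerN -!comNr. Qed.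

End Commutator.

Definition skew (F : nzRingType) (s : Type) (q : s -> s -> F) (T : s -> s) :=
  forall u v, q (T u) v = - q u (T v).

Section Clifford.
Variables (F : numFieldType) (A : algType F) (s : lmodType F).
Variable q : s -> s -> F.
Hypotheses (q_sym : forall u v, q u v = q v u) (q_lin : forall u, scalar (q u)).
Variable Y : {linear s -> A}.
Hypothesis YY : forall u v, Y u * Y v + Y v * Y u = (- 2 * q u v)%:A.
Variables (I : finType) (b d : I -> s).
Hypothesis bd : dual_families q b d.
Implicit Types (T : {linear s -> s}) (u v w y : s).

Lemma clifford_swap u v : Y u * Y v = (- 2 * q u v)%:A - Y v * Y u.
Proof. by rewrite -YY addrK. Qed.

Lemma com_clifford2 u v y :
  com (Y u * Y v) (Y y) = (2 * q u y) *: Y v - (2 * q v y) *: Y u.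
Proof.
have -> : com (Y u * Y v) (Y y) = (- 2 * q v y) *: Y u - (- 2 * q y u) *: Y v.
  rewrite /com -mulrA (clifford_swap v) mulrBr mulr_algr [Y y * (_ * _)]mulrA.
  by rewrite (clifford_swap y u) mulrBl mulr_algl !mulrA opprB addrA subrK.
by rewrite !mulNr !scaleNr opprK addrC [q y u]q_sym.
Qed.

(** The map from the orthogonal Lie algebra to the Clifford algebra. For skew [T] the bracket of the
    unnormalized sum with [Y y] is [- 4 *: Y (T y)], two halves contributing [-2] each; this fixes
    the constant. *)
Definition spin_lift (T : s -> s) : A := (- 4%:R^-1) *: \sum_i Y (T (b i)) * Y (d i).

Lemma com_spin_lift T y : skew q T -> com (spin_lift T) (Y y) = Y (T y).
Proof.
move=> Tskew; rewrite comNr linearZ linear_sum /=.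
rewrite (eq_bigr (fun i => 2 *: (q (T y) (b i) *: Y (d i) + q y (d i) *: Y (T (b i))))).
  rewrite -scaler_sumr big_split /=.
  have -> : \sum_i q (T y) (b i) *: Y (d i) = Y (T y).
    by rewrite {2}[T y](bd.2 _) linear_sum; apply: eq_bigr => i _; rewrite linearZ.
  have -> : \sum_i q y (d i) *: Y (T (b i)) = Y (T y).
    by rewrite {2}[y](bd.1 _) !linear_sum; apply: eq_bigr => i _; rewrite !linearZ.
  rewrite -mulr2n -scaler_nat !scalerA -scaleNr -[RHS]scale1r; congr (_ *: _).
  by field.
move=> i _; rewrite comNr com_clifford2 opprB Tskew mulrN scaleNr opprK.
by rewrite scalerDr !scalerA addrC [q (b i) _]q_sym [q (d i) _]q_sym.
Qed.

(** The bracket with [spin_lift T] applies [T] to each Clifford factor in turn; [dual_families_skew]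
    moves it from [d i] to [b i] with a sign. *)
Lemma spin_lift_lie T T' (T2 : s -> s) : skew q T -> skew q T' ->
  (forall u, T2 u = T (T' u) - T' (T u)) ->
  com (spin_lift T) (spin_lift T') = spin_lift T2.
Proof.
move=> sT sT' T2E; rewrite {2}/spin_lift linearZ linear_sum /=; congr (_ *: _).
have H := dual_families_skew q_sym bd (Phi := fun u v => Y (T' u) * Y v) sT.
under eq_bigr do rewrite comM !com_spin_lift //.
rewrite big_split /=; under [RHS]eq_bigr do rewrite T2E linearB mulrBl.
rewrite sumrB; congr (_ + _); apply/eqP; rewrite -addr_eq0 addrC -big_split; apply/eqP/H.
  by move=> v k u u' /=; rewrite !linearP mulrDl -scalerAl.
by move=> u k v v' /=; rewrite !linearP mulrDr -scalerAr.
Qed.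

Section Cubic.
Variable tau : s -> s -> s -> F.
Hypothesis tau_lin : forall u v, scalar (tau u v).
Hypothesis tau_alt : forall u v w, tau v u w = - tau u v w.
Hypothesis tau_cyc : forall u v w, tau v w u = tau u v w.

Definition cubic : A :=
  \sum_i \sum_j \sum_k tau (b i) (b j) (b k) *: (Y (d i) * Y (d j) * Y (d k)).

Let lin1 v w : scalar (fun u => tau u v w).
Proof. by move=> k u u' /=; rewrite -!(tau_cyc _ v w) tau_lin. Qed.

Let lin2 u w : scalar (fun v => tau u v w).
Proof. by move=> k v v' /=; rewrite !(tau_alt _ u) lin1 opprD mulrN. Qed.

(** The bracket is a derivation, and moving [T] from each [d] to the matching [b] turns it into
    minus the infinitesimal variation of [tau]. *)
Lemma com_spin_lift_cubic T : skew q T ->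
  (forall u v w, tau (T u) v w + tau u (T v) w + tau u v (T w) = 0) ->
  com (spin_lift T) cubic = 0.
Proof.
move=> sT tauT.
pose S t := \sum_i \sum_j \sum_k t (b i) (b j) (b k) *: (Y (d i) * Y (d j) * Y (d k)).
have step1 : \sum_i \sum_j \sum_k tau (b i) (b j) (b k) *:
    (Y (T (d i)) * Y (d j) * Y (d k)) = - S (fun u v w => tau (T u) v w).
  apply/eqP; rewrite -addr_eq0 -big_split /=; apply/eqP.
  under eq_bigr do rewrite -big_split /=.
  rewrite exchange_big big1 //= => j _.
  under eq_bigr do rewrite -big_split /=.
  rewrite exchange_big big1 //= => k _.
  under eq_bigr do rewrite addrC.
  apply: (dual_families_skew q_sym bd
    (Phi := fun u v => tau u (b j) (b k) *: (Y v * Y (d j) * Y (d k))) sT).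
    by move=> v c u u'; rewrite lin1 scalerDl scalerA.
  by move=> u c v v'; rewrite linearP !mulrDl -!scalerAl scalerDr !scalerA mulrC.
have step2 : \sum_i \sum_j \sum_k tau (b i) (b j) (b k) *:
    (Y (d i) * Y (T (d j)) * Y (d k)) = - S (fun u v w => tau u (T v) w).
  apply/eqP; rewrite -addr_eq0 -big_split /=; apply/eqP.
  apply: big1 => i _; rewrite -big_split /=.
  under eq_bigr do rewrite -big_split /=.
  rewrite exchange_big big1 //= => k _.
  under eq_bigr do rewrite addrC.
  apply: (dual_families_skew q_sym bd
    (Phi := fun u v => tau (b i) u (b k) *: (Y (d i) * Y v * Y (d k))) sT).
    by move=> v c u u'; rewrite lin2 scalerDl scalerA.
  move=> u c v v'; rewrite linearP mulrDr mulrDl -scalerAr -scalerAl.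
  by rewrite scalerDr !scalerA mulrC.
have step3 : \sum_i \sum_j \sum_k tau (b i) (b j) (b k) *:
    (Y (d i) * Y (d j) * Y (T (d k))) = - S (fun u v w => tau u v (T w)).
  apply/eqP; rewrite -addr_eq0 -big_split /=; apply/eqP.
  apply: big1 => i _; rewrite -big_split /=; apply: big1 => j _.
  rewrite -big_split /=; under eq_bigr do rewrite addrC.
  apply: (dual_families_skew q_sym bd
    (Phi := fun u v => tau (b i) (b j) u *: (Y (d i) * Y (d j) * Y v)) sT).
    by move=> v c u u'; rewrite tau_lin scalerDl scalerA.
  by move=> u c v v'; rewrite linearP mulrDr -scalerAr scalerDr !scalerA mulrC.
rewrite /cubic linear_sum /=.
under eq_bigr do rewrite linear_sum /=.
under eq_bigr do under eq_bigr do rewrite linear_sum /=.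
under eq_bigr do under eq_bigr do under eq_bigr do
  rewrite linearZ /= !comM !com_spin_lift // mulrDl !scalerDr.
under eq_bigr do under eq_bigr do rewrite !big_split /=.
under eq_bigr do rewrite !big_split /=.
rewrite !big_split /= step1 step2 step3 -!opprD -!big_split /=.
rewrite big1 ?oppr0 // => i _; rewrite -!big_split big1 //= => j _.
rewrite -!big_split big1 //= => k _.
by rewrite -!scalerDl tauT scale0r.
Qed.

(** Moving [Y y] to the middle of the word from both ends takes an odd number of exchanges in all,
    so the remaining words cancel and only contractions survive. *)
Lemma clifford_anticom3 y u v w :
  Y y * (Y u * Y v * Y w) + Y u * Y v * Y w * Y y =
  - 2 *: (q y u *: (Y v * Y w) - q y v *: (Y u * Y w) + q y w *: (Y u * Y v)).
Proof.
have yu := clifford_swap y u; have yv := clifford_swap y v.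
have yw : Y u * Y v * Y w * Y y = (- 2 * q y w) *: (Y u * Y v) - Y u * Y v * (Y y * Y w).
  by rewrite -mulrA -[Y w * _](addKr (Y y * Y w)) YY addrC mulrBr mulr_algr.
have -> : Y y * (Y u * Y v * Y w) = (- 2 * q y u) *: (Y v * Y w) -
   ((- 2 * q y v) *: (Y u * Y w) - Y u * Y v * (Y y * Y w)).
  rewrite !mulrA yu !mulrBl -!scalerAl mul1r; congr (_ - _).
  rewrite -!mulrA [Y y * (_ * _)]mulrA yv mulrBl mulrBr.
  by rewrite -scalerAl mul1r -scalerAr !mulrA.
rewrite {}yw opprB; set m := _ * (Y y * Y w).
rewrite -addrA [m - _]addrC addrACA subrr addr0 addrA.
by rewrite scalerDr scalerBr !scalerA.
Qed.

(** The constant is [-2] from the Clifford relation times 3, the symmetries of [tau] making the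
    three signed contractions equal. *)
Lemma anticom_cubic y : Y y * cubic + cubic * Y y =
  (- 6%:R) *: \sum_i \sum_j tau (b i) (b j) y *: (Y (d i) * Y (d j)).
Proof.
have E1 : \sum_i \sum_j \sum_k tau (b i) (b j) (b k) *: (q y (d i) *: (Y (d j) * Y (d k))) =
    \sum_i \sum_j tau (b i) (b j) y *: (Y (d i) * Y (d j)).
  rewrite exchange_big; apply: eq_bigr => j _ /=.
  rewrite exchange_big; apply: eq_bigr => k _ /=.
  rewrite -[in RHS]tau_cyc -[in RHS]tau_cyc {2}[y](bd.1 _).
  rewrite (@linear_suml F s F^o _ (lin1 (b j) (b k))) scaler_suml.
  by apply: eq_bigr => i _; rewrite scalerA mulrC.
have E2 : \sum_i \sum_j \sum_k tau (b i) (b j) (b k) *: (q y (d j) *: (Y (d i) * Y (d k))) =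
    - \sum_i \sum_j tau (b i) (b j) y *: (Y (d i) * Y (d j)).
  rewrite -sumrN; apply: eq_bigr => i _ /=.
  rewrite exchange_big -sumrN; apply: eq_bigr => k _ /=.
  rewrite (tau_cyc y) (tau_alt (b i) y) scaleNr opprK {2}[y](bd.1 _).
  rewrite (@linear_suml F s F^o _ (lin2 (b i) (b k))) scaler_suml.
  by apply: eq_bigr => j _; rewrite scalerA mulrC.
have E3 : \sum_i \sum_j \sum_k tau (b i) (b j) (b k) *: (q y (d k) *: (Y (d i) * Y (d j))) =
    \sum_i \sum_j tau (b i) (b j) y *: (Y (d i) * Y (d j)).
  apply: eq_bigr => i _ /=; apply: eq_bigr => j _.
  rewrite {2}[y](bd.1 _) (@linear_suml F s F^o _ (@tau_lin (b i) (b j))) scaler_suml.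
  by apply: eq_bigr => k _; rewrite scalerA mulrC.
have -> : Y y * cubic + cubic * Y y = - 2 *: \sum_i \sum_j \sum_k
    (tau (b i) (b j) (b k) *: (q y (d i) *: (Y (d j) * Y (d k))) -
     tau (b i) (b j) (b k) *: (q y (d j) *: (Y (d i) * Y (d k))) +
     tau (b i) (b j) (b k) *: (q y (d k) *: (Y (d i) * Y (d j)))).
  rewrite mulr_sumr mulr_suml -big_split scaler_sumr; apply: eq_bigr => i _ /=.
  rewrite mulr_sumr mulr_suml -big_split scaler_sumr; apply: eq_bigr => j _ /=.
  rewrite mulr_sumr mulr_suml -big_split scaler_sumr; apply: eq_bigr => k _ /=.
  rewrite -scalerAr -scalerAl -scalerDr clifford_anticom3 -scalerBr -scalerDr.
  by rewrite !scalerA mulrC.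
under eq_bigr do under eq_bigr do rewrite big_split sumrB /=.
under eq_bigr do rewrite big_split sumrB /=.
rewrite big_split sumrB /= E1 E2 E3 opprK -mulr2n -mulrSr -scaler_nat scalerA.
by congr (_ *: _); ring.
Qed.

End Cubic.

End Clifford.

(** * Chevalley antisymmetrization in degree three *)

Section TripleSums.
Variables (A : zmodType) (n : nat) (F : 'I_n -> 'I_n -> 'I_n -> A).

(** Every triple of distinct indices is one of the six rearrangements of a unique increasing triple;
    the other triples contribute 0. *)
Lemma sum_increasing_triples :
  (forall i k, F i i k = 0) -> (forall i k, F i k k = 0) -> (forall i k, F i k i = 0) ->
  \sum_(i < n) \sum_(j < n | (i < j)%N) \sum_(k < n | (j < k)%N)
    (F i j k + F j k i + F k i j + F j i k + F k j i + F i k j) =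
  \sum_i \sum_j \sum_k F i j k.
Proof.
move=> F1 F2 F3.
pose S (G : 'I_n -> 'I_n -> 'I_n -> A) := \sum_i \sum_j \sum_k G i j k.
pose c (i j k : 'I_n) x : A := if (i < j < k)%N then x else 0.
have SD G G' : S (fun i j k => G i j k + G' i j k) = S G + S G'.
  rewrite /S -big_split; apply: eq_bigr => i _ /=.
  by rewrite -big_split; apply: eq_bigr => j _ /=; rewrite -big_split.
have S12 G : S G = S (fun i j k => G j i k) by rewrite /S exchange_big.
have S23 G : S G = S (fun i j k => G i k j).
  by apply: eq_bigr => i _; rewrite exchange_big.
transitivity (S (fun i j k => c i j k (F i j k + F j k i + F k i j + F j i k + F k j i + F i k j))).
  apply: eq_bigr => i _; rewrite big_mkcond; apply: eq_bigr => j _ /=.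
  rewrite /c; case: (i < j)%N => /=; last by rewrite big1.
  by rewrite big_mkcond.
transitivity (S (fun i j k => c i j k (F i j k)) + S (fun i j k => c i j k (F j k i)) +
   S (fun i j k => c i j k (F k i j)) + S (fun i j k => c i j k (F j i k)) +
   S (fun i j k => c i j k (F k j i)) + S (fun i j k => c i j k (F i k j))).
  rewrite -!SD; apply: eq_bigr => i _; apply: eq_bigr => j _; apply: eq_bigr => k _.
  by rewrite /c; case: ifP => // _; rewrite !addr0.
have S312 G : S G = S (fun i j k => G k i j) by rewrite S12 S23.
have S231 G : S G = S (fun i j k => G j k i) by rewrite S23 S12.
have S321 G : S G = S (fun i j k => G k j i) by rewrite S12 S312.
rewrite [X in _ + X + _ + _ + _ + _]S312 [X in _ + _ + X + _ + _ + _]S231.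
rewrite [X in _ + _ + _ + X + _ + _]S12 [X in _ + _ + _ + _ + X + _]S321.
rewrite [X in _ + _ + _ + _ + _ + X]S23 -!SD.
apply: eq_bigr => i _; apply: eq_bigr => j _; apply: eq_bigr => k _; rewrite /c.
case: (ltngtP i j) => [ij|ji|/val_inj <-] /=; last by rewrite F1 ?if_same ?addr0.
  case: (ltngtP j k) => [jk|kj|/val_inj <-] /=; last by rewrite F2 ?if_same ?addr0.
    by rewrite [(k < i)%N]ltnNge (ltnW (ltn_trans ij jk)) /= andbF !addr0.
  case: (ltngtP i k) => [ik|ki|/val_inj <-] /=; last by rewrite F3 ?if_same ?addr0.
    by rewrite !add0r.
  by rewrite !addr0 !add0r.
case: (ltngtP i k) => [ik|ki|/val_inj <-] /=; last by rewrite F3 ?if_same ?addr0.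
  case: (ltngtP j k) => [jk|kj|/val_inj <-] /=; last by rewrite F2 ?if_same ?addr0.
    by rewrite !addr0 !add0r.
  by have := ltn_trans kj (ltn_trans ji ik); rewrite ltnn.
case: (ltngtP j k) => [jk|kj|/val_inj <-] /=; last by rewrite F2 ?if_same ?addr0.
  by rewrite !addr0 !add0r.
by rewrite !addr0 !add0r.
Qed.

End TripleSums.

Section Wedge3.
Local Notation o0 := (Ordinal (isT : 0 < 3)%N).
Local Notation o1 := (Ordinal (isT : 1 < 3)%N).
Local Notation o2 := (Ordinal (isT : 2 < 3)%N).

Lemma tperm_if (T : finType) (x y z : T) :
  tperm x y z = if z == x then y else if z == y then x else z.
Proof. by case: tpermP => [->|->|/eqP/negPf -> /eqP/negPf ->] //; rewrite eqxx //; case: eqP. Qed.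

Lemma sum_S3 (A : nmodType) (G : 'S_3 -> A) :
  \sum_(p : 'S_3) G p = \sum_(p <- [:: 1; tperm o0 o1 * tperm o0 o2;
     tperm o0 o2 * tperm o0 o1; tperm o0 o1; tperm o0 o2; tperm o1 o2]%g) G p.
Proof.
set l := (X in _ = \sum_(p <- X) _).
have ul : uniq l.
  (* The images of two points already distinguish the six permutations; counting then shows that the
     list is complete. *)
  apply: (@map_uniq _ _ (fun p : 'S_3 => (p o0, p o1))).
  by rewrite /l [map _ _]/= !permM !perm1 !tperm_if.
have sl : (size (enum {: 'S_3}) <= size l)%N by rewrite -cardE card_Sn.
have [|_ lE] := uniq_min_size ul _ sl; first by move=> p _; rewrite mem_enum.
by rewrite -big_enum; apply: perm_big; apply: uniq_perm => //; exact: enum_uniq.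
Qed.

Lemma cliff_wedge3 (K : fieldType) (W : vectType K) (q : W -> W -> K)
    (Cl : cliffordAlg q) (x y z : W) : (let Y := cliff_in Cl in
  cliff_wedge Cl [tuple x; y; z] = 6%:R^-1 *:
   (Y x * Y y * Y z + Y y * Y z * Y x + Y z * Y x * Y y
    - Y y * Y x * Y z - Y z * Y y * Y x - Y x * Y z * Y y)).
Proof.
rewrite /= /cliff_wedge sum_S3 !big_cons big_nil addr0; congr (_ *: _).
rewrite !big_ord_recl !big_ord0 !mulr1 !odd_permM !odd_tperm odd_perm1 /=.
rewrite !permM !perm1 !tperm_if /=.
by rewrite !(tnth_nth x) /= expr0 expr1 !scale1r !scaleN1r !mulrA !addrA.
Qed.

End Wedge3.

Section CubicTerm.
Variables (K : numFieldType) (W : vectType K) (q : W -> W -> K).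
Variables (Cl : cliffordAlg q) (n : nat) (b d : n.-tuple W).
Variable tau : W -> W -> W -> K.
Hypothesis tau_alt : forall u v w, tau v u w = - tau u v w.
Hypothesis tau_cyc : forall u v w, tau v w u = tau u v w.

(* As [tau] is alternating, the sum over all triples counts each increasing
   triple six times. *)
Lemma wedge_cubic :
  2^-1 *: (\sum_(i < n) \sum_(j < n | (i < j)%N) \sum_(k < n | (j < k)%N)
     tau (tnth b i) (tnth b j) (tnth b k) *:
       cliff_wedge Cl [tuple tnth d i; tnth d j; tnth d k]) =
  12%:R^-1 *: cubic (cliff_in Cl) (tnth b) (tnth d) tau.
Proof.
have tau0 u w : tau u u w = 0.
  have /eqP := tau_alt u u w; rewrite -addr_eq0 -mulr2n mulrn_eq0 /=.
  by move/eqP.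
have tau0' u w : tau u w w = 0 by rewrite 2!tau_cyc tau0.
have tau0'' u w : tau u w u = 0 by rewrite tau_cyc tau0.
pose F i j k := tau (tnth b i) (tnth b j) (tnth b k) *:
  (cliff_in Cl (tnth d i) * cliff_in Cl (tnth d j) * cliff_in Cl (tnth d k)).
rewrite /cubic -(sum_increasing_triples (F := F)); last first.
- by move=> i k; rewrite /F tau0'' scale0r.
- by move=> i k; rewrite /F tau0' scale0r.
- by move=> i k; rewrite /F tau0 scale0r.
(* The factor 1/2 comes from the Dirac operator and 1/6 from the antisymmetrization. *)
rewrite (_ : 12%:R^-1 = 2^-1 * 6%:R^-1 :> K); last by field.
rewrite -scalerA; congr (_ *: _); rewrite scaler_sumr; apply: eq_bigr => i _.
rewrite scaler_sumr; apply: eq_bigr => j _.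
rewrite scaler_sumr; apply: eq_bigr => k _.
rewrite cliff_wedge3 /= /F scalerA mulrC -scalerA; congr (_ *: _).
set t := tau (tnth b i) (tnth b j) (tnth b k).
have -> : tau (tnth b j) (tnth b k) (tnth b i) = t by rewrite tau_cyc.
have -> : tau (tnth b k) (tnth b i) (tnth b j) = t by rewrite 2!tau_cyc.
have -> : tau (tnth b j) (tnth b i) (tnth b k) = - t by rewrite tau_alt.
have -> : tau (tnth b k) (tnth b j) (tnth b i) = - t by rewrite tau_alt tau_cyc.
have -> : tau (tnth b i) (tnth b k) (tnth b j) = - t by rewrite tau_alt 2!tau_cyc.
by rewrite !scalerDr !scalerN !scaleNr.
Qed.

End CubicTerm.

(** * Dual families *)

Section SymmetricForm.
Variables (K : fieldType) (V : vectType K) (B : {symmetric V}).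

Lemma symm_formC u v : B u v = B v u.
Proof. by rewrite hermC expr0 mul1r. Qed.

Lemma symm_form_lin u : scalar (B u).
Proof. by move=> a v w; rewrite linearPr. Qed.

End SymmetricForm.

(** Padding by a zero vector makes the index set nonempty, as polynomials in matrices require, even
    for the zero Lie algebra. *)
Lemma dual_families_pad (K : fieldType) (V : vectType K) N (q : V -> V -> K) (e f : 'I_N -> V) :
  dual_families q e f ->
  dual_families q (fun k : 'I_N.+1 => oapp e 0 (unlift ord0 k))
    (fun k : 'I_N.+1 => oapp f 0 (unlift ord0 k)).
Proof.
move=> [He Hf]; split=> u; rewrite big_ord_recl unlift_none /= scaler0 add0r.
  by rewrite [LHS]He; apply: eq_bigr => i _; rewrite liftK.
by rewrite [LHS]Hf; apply: eq_bigr => i _; rewrite liftK.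
Qed.

Section DualFamiliesExist.
Variables (K : fieldType) (W : vectType K) (q : W -> W -> K).
Hypotheses (q_sym : forall u v, q u v = q v u) (q_lin : forall u, scalar (q u)).

Lemma form_sumr (I : finType) (a : I -> K) (v : I -> W) u :
  q u (\sum_i a i *: v i) = \sum_i a i * q u (v i).
Proof. exact: (@linear_suml K W K^o _ (q_lin u)). Qed.

Lemma symm_form_suml (I : finType) (a : I -> K) (v : I -> W) u :
  q (\sum_i a i *: v i) u = \sum_i a i * q (v i) u.
Proof. by rewrite q_sym form_sumr; apply: eq_bigr => i _; rewrite q_sym. Qed.

Lemma dual_families_of_basis n (b d : n.-tuple W) :
  basis_of fullv b -> basis_of fullv d ->
  (forall i j, q (tnth b i) (tnth d j) = (i == j)%:R) ->
  dual_families q (tnth b) (tnth d).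
Proof.
move=> bb bd dual; split=> u.
  rewrite {1}(coord_basis bb (memvf u)); apply: eq_bigr => i _.
  rewrite -tnth_nth; congr (_ *: _).
  rewrite [in RHS](coord_basis bb (memvf u)) symm_form_suml (bigD1 i) //= -tnth_nth dual eqxx mulr1.
  by rewrite big1 ?addr0 // => j ji; rewrite -tnth_nth dual (negPf ji) mulr0.
rewrite {1}(coord_basis bd (memvf u)); apply: eq_bigr => i _.
rewrite -tnth_nth; congr (_ *: _).
rewrite [in RHS](coord_basis bd (memvf u)) symm_form_suml (bigD1 i) //=.
rewrite -tnth_nth q_sym dual eqxx mulr1.
by rewrite big1 ?addr0 // => j ji; rewrite -tnth_nth q_sym dual eq_sym (negPf ji) mulr0.
Qed.

(** A row in the kernel of the Gram matrix gives a vector orthogonal to everything; the inverse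
    matrix then provides the dual basis. *)
Lemma dual_families_exist : (forall x, (forall y, q x y = 0) -> x = 0) ->
  exists e f : 'I_(\dim {:W}) -> W, dual_families q e f.
Proof.
move=> nondeg; pose v := vbasis {:W}.
have vb : basis_of fullv v by exact: vbasisP.
pose G := \matrix_(i, j) q v`_i v`_j : 'M_(\dim {:W}).
have Gu : G \in unitmx.
  rewrite -row_free_unit -kermx_eq0; apply/eqP/row_matrixP => k.
  set c := row k _; rewrite row0.
  have cG : c *m G = 0 by apply/sub_kermxP; rewrite row_sub.
  pose x := \sum_i c 0 i *: v`_i.
  have xv (j : 'I_(\dim {:W})) : q x v`_j = 0.
    rewrite symm_form_suml; transitivity ((c *m G) 0 j); last by rewrite cG mxE.
    by rewrite mxE; apply: eq_bigr => i _; rewrite [G _ _]mxE.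
  have x0 : x = 0.
    apply: nondeg => y; rewrite (coord_basis vb (memvf y)) form_sumr big1 // => j _.
    by rewrite xv mulr0.
  by apply/rowP => i; rewrite (elimT freeP (basis_free vb) (fun i => c 0 i) x0) mxE.
pose w k := \sum_j (invmx G) j k *: v`_j.
have vw (i k : 'I_(\dim {:W})) : q v`_i (w k) = (i == k)%:R.
  rewrite form_sumr; have /matrixP/(_ i k) := mulmxV Gu; rewrite !mxE => <-.
  by apply: eq_bigr => j _; rewrite mxE mulrC.
exists (fun i => v`_i), w; split=> u.
  rewrite {1}(coord_basis vb (memvf u)); apply: eq_bigr => i _; congr (_ *: _).
  rewrite [in RHS](coord_basis vb (memvf u)) symm_form_suml (bigD1 i) //= vw eqxx mulr1.
  by rewrite big1 ?addr0 // => j ji; rewrite vw (negPf ji) mulr0.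
apply/eqP; rewrite eq_sym -subr_eq0; apply/eqP/nondeg => y.
rewrite (coord_basis vb (memvf y)) form_sumr big1 // => l _.
have qBl a b z : q (a - b) z = q a z - q b z.
  by rewrite !(q_sym _ z) -[a - b]addrC -scaleN1r q_lin mulN1r addrC.
rewrite qBl symm_form_suml (bigD1 l) //= [q (w l) _]q_sym vw eqxx mulr1 big1 ?addr0.
  by rewrite subrr mulr0.
by move=> k kl; rewrite [q (w k) _]q_sym vw eq_sym (negPf kl) mulr0.
Qed.

End DualFamiliesExist.

(** * The subalgebra and its orthogonal complement *)

Section SubLie.
Variables (K : fieldType) (g : lieAlgType K) (r : {vspace g}).
Hypothesis r_sub : lie_subalgebra r.

(** A copy of [subvs_of r] carrying the proof of closure under brackets as a parameter, so that a
    Lie algebra structure can be attached to it. *)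
Definition subLie of lie_subalgebra r : Type := subvs_of r.
Local Notation L := (subLie r_sub).
HB.instance Definition _ := Vector.copy L (subvs_of r).

Definition subLie_val (x : L) : g := vsval x.

Arguments subLie_val : simpl never.

Fact subLie_val_is_linear : linear subLie_val.
Proof. by []. Qed.
HB.instance Definition _ := GRing.isLinear.Build K L g *:%R subLie_val subLie_val_is_linear.

Let val0 : subLie_val 0 = 0. Proof. exact: linear0. Qed.

Let valD x y : subLie_val (x + y) = subLie_val x + subLie_val y.
Proof. exact: linearD. Qed.

Let valB x y : subLie_val (x - y) = subLie_val x - subLie_val y.
Proof. exact: linearB. Qed.

Lemma subLie_valP x : subLie_val x \in r. Proof. exact: subvsP. Qed.

Lemma subLie_val_inj : injective subLie_val. Proof. exact: val_inj. Qed.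

Definition subLie_bracket (x y : L) : L := vsproj r (lie (subLie_val x) (subLie_val y)).

Lemma subLie_bracketE x y :
  subLie_val (subLie_bracket x y) = lie (subLie_val x) (subLie_val y).
Proof. by rewrite /subLie_val vsprojK // r_sub ?subvsP. Qed.

Fact subLie_linearl y : linear (subLie_bracket^~ y).
Proof.
move=> a x x'; apply: subLie_val_inj.
by rewrite subLie_val_is_linear !subLie_bracketE subLie_val_is_linear lieDl lieZl.
Qed.

Fact subLie_linearr x : linear (subLie_bracket x).
Proof.
move=> a y y'; apply: subLie_val_inj.
by rewrite subLie_val_is_linear !subLie_bracketE subLie_val_is_linear linearP.
Qed.

Fact subLie_alt x : subLie_bracket x x = 0.
Proof. by apply: subLie_val_inj; rewrite subLie_bracketE lie_alt val0. Qed.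

Fact subLie_jacobi x y z : subLie_bracket x (subLie_bracket y z) +
  subLie_bracket y (subLie_bracket z x) + subLie_bracket z (subLie_bracket x y) = 0.
Proof.
by apply: subLie_val_inj; rewrite !valD !subLie_bracketE lie_jacobi val0.
Qed.

HB.instance Definition _ := Vector_isLieAlgebra.Build K L
  subLie_linearl subLie_linearr subLie_alt subLie_jacobi.

Lemma subLie_lie x y : subLie_val (lie x y) = lie (subLie_val x) (subLie_val y).
Proof. exact: subLie_bracketE. Qed.

Lemma subLie_valK u : u \in r -> exists x : L, subLie_val x = u.
Proof. by move=> ur; exists (vsproj r u : L); apply: vsprojK. Qed.

(** Complements exist in [g] and are intersected with [r]: if [x] and its component [w] lie in [r],
    so does [x - w]. *)
Lemma subLie_reductive : reductive_in r -> reductive L.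
Proof.
move=> red W sW; pose W0 := (linfun subLie_val @: W)%VS.
have [|W0' [sW0' eW0' cW0']] := red W0.
  move=> x _ xr /memv_imgP[w wW ->]; have [x' <-] := subLie_valK xr.
  by rewrite lfunE /= -subLie_lie -[subLie_val _]lfunE memv_img // sW ?memvf.
exists (linfun subLie_val @^-1: W0')%VS; split.
- move=> x w _; rewrite -!memv_preim !lfunE /= subLie_lie => wW.
  by apply: sW0' => //; apply: subLie_valP.
- apply/eqP; rewrite eqEsubv subvf /=; apply/subvP => x _.
  have : subLie_val x \in (W0 + W0')%VS by rewrite eW0' memvf.
  case/memv_addP => _ /memv_imgP[w wW ->] [w' w'W e].
  rewrite -[x](subrKC w) memv_add // -memv_preim lfunE /= valB e lfunE /=.
  by rewrite addrC addKr.
- apply/eqP; rewrite -subv0; apply/subvP => x; rewrite memv_cap -memv_preim lfunE /=.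
  move=> /andP[xW xW']; rewrite memv0 -(inj_eq subLie_val_inj) val0 -memv0 -cW0'.
  by rewrite memv_cap xW' andbT -[subLie_val _]lfunE memv_img.
Qed.

End SubLie.

Section OrthogonalAction.
Variables (K : fieldType) (g : lieAlgType K) (B : {symmetric g}) (r : {vspace g}).
Hypothesis B_inv : invariant_form B.
Hypothesis r_sub : lie_subalgebra r.
Local Notation s := (orthov B r).
Local Notation L := (subLie r_sub).

Lemma lie_orthov x u : x \in r -> u \in s -> lie x u \in s.
Proof.
move=> xr us; apply/mem_orthovP => v vr.
rewrite symm_formC -B_inv symm_formC.
by move/mem_orthovP: us => -> //; apply: r_sub.
Qed.

Let vsP a (u v : subvs_of s) : vsval (a *: u + v) = a *: vsval u + vsval v.
Proof. exact: linearP. Qed.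

Let vsB (u v : subvs_of s) : vsval (u - v) = vsval u - vsval v.
Proof. exact: linearB. Qed.

Definition ad_s (x : L) (u : subvs_of s) : subvs_of s := vsproj s (lie (subLie_val x) (vsval u)).

Lemma ad_sE x u : vsval (ad_s x u) = lie (subLie_val x) (vsval u).
Proof. by rewrite vsprojK // lie_orthov ?subvsP ?subLie_valP. Qed.

Fact ad_s_is_linear x : linear (ad_s x).
Proof. by move=> a u v; apply: subvs_inj; rewrite vsP !ad_sE vsP linearP. Qed.
HB.instance Definition _ x := GRing.isLinear.Build K _ _ *:%R (ad_s x) (ad_s_is_linear x).

Lemma ad_s_linearl u : linear (ad_s^~ u).
Proof.
move=> a x y; apply: subvs_inj; rewrite vsP !ad_sE.
by rewrite subLie_val_is_linear lieDl lieZl.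
Qed.

Lemma ad_s_lie x y u : ad_s (lie x y) u = ad_s x (ad_s y u) - ad_s y (ad_s x u).
Proof.
apply: subvs_inj; rewrite vsB !ad_sE subLie_lie.
by rewrite [in RHS]lie_der addrK.
Qed.

Local Notation q := (@sform K g B r).

Lemma sformC u v : q u v = q v u.
Proof. by apply: symm_formC. Qed.

Lemma sform_lin (u : subvs_of s) : scalar (q u).
Proof. by move=> a v w; rewrite /sform vsP symm_form_lin. Qed.

Lemma ad_s_skew x : skew q (ad_s x).
Proof.
move=> u v; rewrite /sform !ad_sE lieC symm_formC linearNr; congr (- _).
by rewrite [LHS]symm_formC B_inv.
Qed.

End OrthogonalAction.

(** * The square of the Dirac operator *)

Section DiracSquare.
Variables (K : numFieldType) (g : lieAlgType K) (B : {symmetric g}) (r : {vspace g}).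
Hypothesis B_inv : invariant_form B.
Hypothesis r_sub : lie_subalgebra r.
Local Notation s := (orthov B r).
Local Notation L := (subLie r_sub).
Local Notation q := (@sform K g B r).
Local Notation lval := (@subLie_val K g r r_sub).

Definition subLie_form (x y : L) : K := B (lval x) (lval y).

Lemma subLie_formC x y : subLie_form x y = subLie_form y x.
Proof. exact: symm_formC. Qed.

Lemma subLie_form_lin x : scalar (subLie_form x).
Proof. by move=> a y z; rewrite /subLie_form subLie_val_is_linear symm_form_lin. Qed.

Lemma subLie_form_inv : invariant_form subLie_form.
Proof. by move=> x y z; rewrite /subLie_form !subLie_lie B_inv. Qed.

Lemma subLie_form_nondeg : nondegenerate_on B r ->
  forall x : L, (forall y, subLie_form x y = 0) -> x = 0.
Proof.
move=> nd x Hx; apply: subLie_val_inj; rewrite linear0; apply: nd => [|y yr].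
  exact: subLie_valP.
by have [y' <-] := subLie_valK r_sub yr; apply: Hx.
Qed.

Let B_sumr (I : finType) (a : I -> K) (v : I -> g) u :
  B u (\sum_i a i *: v i) = \sum_i a i * B u (v i).
Proof. by rewrite (form_sumr (symm_form_lin B)). Qed.

Let B_suml (I : finType) (a : I -> K) (v : I -> g) u :
  B (\sum_i a i *: v i) u = \sum_i a i * B (v i) u.
Proof. by rewrite (symm_form_suml (symm_formC B) (symm_form_lin B)). Qed.

Let B_subl u v w : B (u - v) w = B u w - B v w. Proof. exact: linearBl. Qed.

Let B_Nl u v : B (- u) v = - B u v. Proof. exact: linearNl. Qed.

Let B_Dl u v w : B (u + v) w = B u w + B v w. Proof. exact: linearDl. Qed.

Lemma orthov_val (u : subvs_of s) (x : L) : B (vsval u) (lval x) = 0.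
Proof.
by have /mem_orthovP := subvsP u; apply; apply: subLie_valP.
Qed.

Section Decomposition.
Variables (n N : nat) (b d : 'I_n -> subvs_of s) (e f : 'I_N -> L).
Hypotheses (bd : dual_families q b d) (ef : dual_families subLie_form e f).

(** Subtracting the [r]-part written with the dual families leaves a vector orthogonal to [r], which
    is expanded in [b]. This gives the splitting without a dimension count. *)
Lemma orthogonal_expansion u :
  u = \sum_i B u (vsval (d i)) *: vsval (b i) + \sum_k B u (lval (f k)) *: lval (e k).
Proof.
pose us := u - \sum_k B u (lval (f k)) *: lval (e k).
have us_s : us \in s.
  apply/mem_orthovP => w /(subLie_valK r_sub)[x <-].
  rewrite /us B_subl B_suml; apply/eqP; rewrite subr_eq0; apply/eqP.
  have {1}-> : lval x = \sum_k B (lval x) (lval (e k)) *: lval (f k).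
    by rewrite {1}[x]ef.2 linear_sum; apply: eq_bigr => k _; rewrite linearZ.
  rewrite B_sumr; apply: eq_bigr => k _.
  by rewrite /subLie_form [B (lval x) _]symm_formC mulrC.
have <- : us = \sum_i B u (vsval (d i)) *: vsval (b i); last by rewrite subrK.
have {1}-> : us = vsval (Subvs us_s) by [].
rewrite {1}[Subvs us_s]bd.1 linear_sum; apply: eq_bigr => i _.
rewrite linearZ; congr (_ *: _); rewrite /sform /= /us B_subl B_suml.
rewrite big1 ?subr0 // => k _.
by rewrite [B (lval _) _]symm_formC orthov_val mulr0.
Qed.

End Decomposition.

Section CubicForm.

Definition cubic_form (u v w : subvs_of s) : K := B (lie (vsval u) (vsval v)) (vsval w).

Lemma cubic_form_lin u v : scalar (cubic_form u v).
Proof. by move=> a w w'; rewrite /cubic_form [vsval (_ + _)]linearP symm_form_lin. Qed.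

Lemma cubic_form_alt u v w : cubic_form v u w = - cubic_form u v w.
Proof. by rewrite /cubic_form lieC B_Nl. Qed.

Lemma cubic_form_cyc u v w : cubic_form v w u = cubic_form u v w.
Proof. by rewrite /cubic_form symm_formC -B_inv. Qed.

Lemma lie_B_skew x u v : B (lie x u) v = - B u (lie x v).
Proof. by rewrite lieC B_Nl B_inv. Qed.

Lemma cubic_form_inv (x : L) u v w :
  cubic_form (ad_s x u) v w + cubic_form u (ad_s x v) w +
  cubic_form u v (ad_s x w) = 0.
Proof.
rewrite /cubic_form !(ad_sE B_inv) -B_Dl -lie_der.
by rewrite lie_B_skew addNr.
Qed.

End CubicForm.

Section Square.
Variables (n N : nat) (b d : 'I_n -> subvs_of s) (e f : 'I_N -> L).
Hypotheses (bd : dual_families q b d) (ef : dual_families subLie_form e f).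
Variables (A : algType K) (X : {linear g -> A}) (Y : {linear subvs_of s -> A}).
Hypothesis X_lie : lie_map X.
Hypothesis Y_cliff : forall u v, Y u * Y v + Y v * Y u = (- 2 * q u v)%:A.
Hypothesis XY : forall x u, Y u * X x = X x * Y u.

Local Notation xb i := (X (vsval (b i))).
Local Notation yd i := (Y (d i)).

(** Twice the double sum is symmetrized in its two indices; exchanging the Clifford factors yields
    the bracket of [b i] and [b j] and a contraction, which is the Casimir element of the
    complement. *)
Lemma linear_part_square : (\sum_i xb i * yd i) * (\sum_i xb i * yd i) =
  2^-1 *: (\sum_i \sum_j X (lie (vsval (b i)) (vsval (b j))) * (yd i * yd j)) -
  \sum_i X (vsval (d i)) * xb i.
Proof.
pose P := \sum_i \sum_j xb i * xb j * (yd i * yd j).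
have -> : (\sum_i xb i * yd i) * (\sum_i xb i * yd i) = P.
  rewrite mulr_suml; apply: eq_bigr => i _; rewrite mulr_sumr; apply: eq_bigr => j _.
  by rewrite !mulrA; congr (_ * _); rewrite -!mulrA XY.
have P2 : P + P = \sum_i \sum_j X (lie (vsval (b i)) (vsval (b j))) * (yd i * yd j) -
    2 *: \sum_i X (vsval (d i)) * xb i.
  rewrite {2}/P exchange_big -big_split /=.
  have -> : 2 *: \sum_i X (vsval (d i)) * xb i =
      \sum_i \sum_j (2 * q (d j) (d i)) *: (xb j * xb i).
    rewrite scaler_sumr; apply: eq_bigr => i _.
    have -> : X (vsval (d i)) = \sum_j q (d j) (d i) *: xb j.
      rewrite {1}[d i]bd.1 !linear_sum; apply: eq_bigr => j _.
      by rewrite !linearZ sformC.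
    rewrite mulr_suml scaler_sumr; apply: eq_bigr => j _.
    by rewrite -scalerAl scalerA.
  rewrite -sumrB; apply: eq_bigr => i _; rewrite -big_split -sumrB.
  apply: eq_bigr => j _ /=; rewrite (clifford_swap Y_cliff (d j)) X_lie mulrBl mulrBr.
  rewrite mulr_algr mulNr scaleNr [- _ - _]addrC addrA; congr (_ - _).
have -> : P = 2^-1 *: (P + P).
  by rewrite -mulr2n -scaler_nat scalerA mulVf ?scale1r // pnatr_eq0.
by rewrite P2 scalerBr scalerA mulVf ?scale1r // pnatr_eq0.
Qed.

Local Notation al x := (spin_lift Y b d (ad_s x)).
Local Notation v3 := (cubic Y b d cubic_form).
Local Notation v := (12%:R^-1 *: v3).
Local Notation D0 := (\sum_i xb i * yd i).

(* The anticommutator with the cubic term cancels the component of [b_i, b_j]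
   in the orthogonal complement of [r]. *)
Lemma dirac_cross_terms : D0 * v + v * D0 = (- 2^-1) *:
  \sum_i \sum_j
    X (\sum_l B (lie (vsval (b i)) (vsval (b j))) (vsval (d l)) *: vsval (b l)) *
    (yd i * yd j).
Proof.
have -> : D0 * v + v * D0 = 12%:R^-1 *: \sum_l xb l * (yd l * v3 + v3 * yd l).
  rewrite -scalerAr -scalerAl -scalerDr mulr_suml mulr_sumr -big_split.
  congr (_ *: _); apply: eq_bigr => l _ /=.
  rewrite mulrDr !mulrA; congr (_ + _ * _).
  rewrite /cubic mulr_suml mulr_sumr; apply: eq_bigr => i _.
  rewrite mulr_suml mulr_sumr; apply: eq_bigr => j _.
  rewrite mulr_suml mulr_sumr; apply: eq_bigr => k _.
  rewrite -scalerAl -scalerAr; congr (_ *: _); apply: esym.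
  by apply: commrM; [apply: commrM|]; apply: esym; apply: XY.
under eq_bigr do rewrite (anticom_cubic
  Y_cliff bd cubic_form_lin cubic_form_alt cubic_form_cyc) -scalerAr.
rewrite -scaler_sumr scalerA (_ : 12%:R^-1 * - 6%:R = - 2^-1 :> K); last by field.
congr (_ *: _); under eq_bigr do rewrite mulr_sumr.
rewrite exchange_big; apply: eq_bigr => i _ /=.
under eq_bigr do rewrite mulr_sumr.
rewrite exchange_big; apply: eq_bigr => j _ /=.
rewrite linear_sum mulr_suml; apply: eq_bigr => l _.
by rewrite linearZ -scalerAr -scalerAl.
Qed.

(** By invariance, pairing the bracket of [b i] and [b j] with [e k] gives, up to sign, the matrix
    entries of [ad_s (e k)]. The factor 4 undoes the normalization of [spin_lift]. *)
Lemma r_component_sum : \sum_i \sum_j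
    X (\sum_k B (lie (vsval (b i)) (vsval (b j))) (lval (e k)) *: lval (f k)) * (yd i * yd j) =
  4%:R *: \sum_k X (lval (f k)) * al (e k).
Proof.
under eq_bigr do under eq_bigr do rewrite linear_sum mulr_suml.
under eq_bigr do rewrite exchange_big.
rewrite exchange_big scaler_sumr; apply: eq_bigr => k _ /=.
transitivity (X (lval (f k)) * \sum_j (- Y (ad_s (e k) (b j))) * yd j); last first.
  rewrite /spin_lift -scalerAr scalerA mulrN mulfV ?pnatr_eq0 // scaleN1r.
  by under eq_bigr do rewrite mulNr; rewrite sumrN mulrN.
rewrite exchange_big mulr_sumr; apply: eq_bigr => j _ /=.
have -> : - Y (ad_s (e k) (b j)) =
    \sum_i B (lie (vsval (b i)) (vsval (b j))) (lval (e k)) *: yd i.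
  rewrite {1}[ad_s _ _]bd.2 linear_sum -sumrN; apply: eq_bigr => i _.
  rewrite linearZ -scaleNr; congr (_ *: _).
  rewrite /sform (ad_sE B_inv) [B (lie (lval _) _) _]B_inv symm_formC.
  by rewrite [lie (vsval (b j)) _]lieC B_Nl opprK.
rewrite mulr_suml mulr_sumr; apply: eq_bigr => i _.
by rewrite linearZ -!scalerAl -scalerAr.
Qed.

Lemma spin_lift_linear : linear (fun x : L => al x).
Proof.
move=> a x y; rewrite /spin_lift [RHS]addrC scalerA [a * _]mulrC -scalerA -scalerDr.
congr (_ *: _); rewrite scaler_sumr -big_split; apply: eq_bigr => i _ /=.
by rewrite (ad_s_linearl B_inv) linearP mulrDl -scalerAl addrC.
Qed.

Lemma spin_lift_X (x : L) y : al x * X y = X y * al x.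
Proof.
rewrite /spin_lift -scalerAl -scalerAr mulr_suml mulr_sumr; congr (_ *: _).
apply: eq_bigr => i _; apply: esym.
by apply: commrM; apply: esym; apply: XY.
Qed.

Local Notation OmG := (\sum_i X (vsval (d i)) * xb i + \sum_k X (lval (e k)) * X (lval (f k))).

(** Between the square of the linear part and the cross terms, the components of the brackets in the
    complement cancel. What remains of them is the mixed part of the diagonal Casimir element, and
    completing the square leaves the stated corrections. *)
Lemma dirac_square : (D0 + v) * (D0 + v) =
  \sum_k (X (lval (e k)) + al (e k)) * (X (lval (f k)) + al (f k)) - OmG +
  (v * v - \sum_k al (e k) * al (f k)).
Proof.
have fe : dual_families subLie_form f e by case: ef.
have ->: (D0 + v) * (D0 + v) = D0 * D0 + (D0 * v + v * D0) + v * v.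
  by rewrite mulrDr !mulrDl !addrA [D0 * D0 + _ + _]addrAC.
have -> : D0 * D0 + (D0 * v + v * D0) =
    2%:R *: \sum_k X (lval (f k)) * al (e k) - \sum_i X (vsval (d i)) * xb i.
  rewrite linear_part_square dirac_cross_terms scaleNr addrAC -scalerBr; congr (_ - _).
  rewrite [in RHS](_ : 2%:R = 2^-1 * 4%:R :> K); last by field.
  rewrite -scalerA -r_component_sum -sumrB; congr (_ *: _); apply: eq_bigr => i _.
  rewrite -sumrB; apply: eq_bigr => j _; rewrite -mulrBl -linearB; congr (X _ * _).
  by rewrite {1}[lie _ _](orthogonal_expansion bd fe) addrC addKr.
have -> : \sum_k (X (lval (e k)) + al (e k)) * (X (lval (f k)) + al (f k)) =
   \sum_k X (lval (e k)) * X (lval (f k)) + 2%:R *: (\sum_k X (lval (f k)) * al (e k)) +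
   \sum_k al (e k) * al (f k).
  have -> : 2%:R *: (\sum_k X (lval (f k)) * al (e k)) =
      \sum_k (X (lval (e k)) * al (f k) + al (e k) * X (lval (f k))).
    rewrite big_split /= scaler_nat mulr2n; congr (_ + _).
      rewrite (dual_families_swap subLie_formC ef (Phi := fun x y => X (lval x) * al y)) //.
        by move=> y a x x' /=; rewrite linearP mulrDl -scalerAl.
      by move=> x a y y' /=; rewrite spin_lift_linear mulrDr -scalerAr.
    by apply: eq_bigr => k _; rewrite spin_lift_X.
  rewrite -!big_split; apply: eq_bigr => k _ /=.
  by rewrite mulrDr !mulrDl !addrA [_ + al _ * X _ + _]addrAC.
have alg (p1 p2 p3 t w : A) : t - p3 + w = p1 + t + p2 - (p3 + p1) + (w - p2).
  rewrite -[p1 + t + p2]addrA [p3 + p1]addrC opprD [p1 + _ + (- p1 - _)]addrACA subrr add0r.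
  by rewrite [t + p2 - p3]addrAC -[RHS]addrA [p2 + _]addrC subrK.
exact: alg.
Qed.

End Square.

End DiracSquare.

(** * Universal properties *)

Section SubAlgebra.
Local Open Scope classical_set_scope.
Variables (K : fieldType) (A : algType K) (S : subalgClosed A).

Record subalg := Subalg { subalg_val : A; _ : subalg_val \in (S : {pred A}) }.
HB.instance Definition _ := [isSub for subalg_val].
HB.instance Definition _ := [Choice of subalg by <:].
HB.instance Definition _ := [SubChoice_isSubAlgebra of subalg by <:].

Fact subalg_val_scalable : scalable (val : subalg -> A). Proof. by []. Qed.

Fact subalg_val_additive : nmod_morphism (val : subalg -> A).
Proof. by split; [exact: raddf0|exact: raddfD]. Qed.

Fact subalg_val_multiplicative : monoid_morphism (val : subalg -> A).
Proof. by split; [exact: rmorph1|exact: rmorphM]. Qed.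

Definition subalg_incl : {lrmorphism subalg -> A} := HB.pack (val : subalg -> A)
  (GRing.isScalable.Build K subalg A *:%R (val : subalg -> A) subalg_val_scalable)
  (GRing.isNmodMorphism.Build subalg A (val : subalg -> A) subalg_val_additive)
  (GRing.isMonoidMorphism.Build subalg A (val : subalg -> A) subalg_val_multiplicative).

End SubAlgebra.

Section Generation.
Local Open Scope classical_set_scope.
Variables (K : fieldType).

Definition subalg_prop (A : algType K) (P : A -> Prop) : Prop :=
  [/\ P 1, forall k a b, P a -> P b -> P (k *: a + b) & forall a b, P a -> P b -> P (a * b)].

Section Closed.
Variables (A : algType K) (P : A -> Prop).
Hypothesis sP : subalg_prop P.

Definition subalg_pred : {pred A} := [pred a | `[< P a >]].

Fact subalg_pred_closed : subalg_closed subalg_pred.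
Proof.
have [P1 PD PM] := sP; split=> [|k a b|a b]; rewrite !inE.
- exact: P1.
- exact: PD.
- exact: PM.
Qed.

Definition subalg_of : subalgClosed A :=
  HB.pack subalg_pred (GRing.isSubalgClosed.Build K A subalg_pred subalg_pred_closed).

Lemma subalg_ofP (a : subalg subalg_of) : P (val a).
Proof. by have := valP a; rewrite inE. Qed.

Definition subalg_lift (W : lmodType K) (h : W -> A) (hP : forall w, P (h w)) (w : W) :
  subalg subalg_of := Subalg (asboolT (hP w) : h w \in (subalg_of : {pred A})).

Fact subalg_lift_linear (W : lmodType K) (h : {linear W -> A}) hP :
  linear (@subalg_lift W h hP).
Proof. by move=> k u w; apply: val_inj; rewrite /= !linearP. Qed.

End Closed.

End Generation.

Section Universal.
Local Open Scope classical_set_scope.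
Variables (K : fieldType).

(** The elements satisfying [P] form a subalgebra to which the universal map lifts. Composed with
    the inclusion, it fixes the generators, so by uniqueness it is the identity. The Clifford case
    is the same. *)
Lemma env_ind (g : lieAlgType K) (U : envAlg g) (P : U -> Prop) :
  subalg_prop P -> (forall x, P (env_in U x)) -> forall u, P u.
Proof.
move=> sP Pg u; pose h := subalg_lift sP Pg.
pose h' : {linear g -> subalg (subalg_of sP)} :=
  HB.pack h (GRing.isLinear.Build K g _ *:%R h (subalg_lift_linear sP Pg)).
have [|F [Fg _]] := @env_univ K g U (subalg (subalg_of sP)) h'.
  move=> x y; apply: val_inj.
  by rewrite [RHS]rmorphB !rmorphM; apply: env_lie.
have [G [Gg GU]] := @env_univ K g U _ _ (env_lie U).
have valF x : (subalg_incl (subalg_of sP) \o F : {lrmorphism U -> U}) (env_in U x) = env_in U x.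
  by rewrite /= Fg.
have idE x : (idfun : {lrmorphism U -> U}) (env_in U x) = env_in U x by [].
have <- : val (F u) = u.
  by rewrite -[LHS]/((subalg_incl (subalg_of sP) \o F) u) (GU _ valF) -(GU _ idE).
exact: subalg_ofP.
Qed.

Lemma cliff_ind (W : vectType K) (q : W -> W -> K) (Cl : cliffordAlg q) (P : Cl -> Prop) :
  subalg_prop P -> (forall x, P (cliff_in Cl x)) -> forall u, P u.
Proof.
move=> sP Pg u; pose h := subalg_lift sP Pg.
pose h' : {linear W -> subalg (subalg_of sP)} :=
  HB.pack h (GRing.isLinear.Build K W _ *:%R h (subalg_lift_linear sP Pg)).
have [|F [Fg _]] := @cliff_univ K W q Cl (subalg (subalg_of sP)) h'.
  move=> x y; apply: val_inj.
  by rewrite [LHS]rmorphD !rmorphM [RHS]linearZ rmorph1; apply: cliff_rel.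
have [G [Gg GU]] := @cliff_univ K W q Cl _ _ (@cliff_rel K W q Cl).
have valF x :
    (subalg_incl (subalg_of sP) \o F : {lrmorphism Cl -> Cl}) (cliff_in Cl x) = cliff_in Cl x.
  by rewrite /= Fg.
have idE x : (idfun : {lrmorphism Cl -> Cl}) (cliff_in Cl x) = cliff_in Cl x by [].
have <- : val (F u) = u.
  by rewrite -[LHS]/((subalg_incl (subalg_of sP) \o F) u) (GU _ valF) -(GU _ idE).
exact: subalg_ofP.
Qed.

Section TensorSpan.
Variables (V S T : lmodType K) (t : {bilinear V -> S -> T}).
Hypothesis t_tensor : is_tensor t.
Variable P : T -> Prop.
Hypotheses (P0 : P 0) (PD : forall k x y, P x -> P y -> P (k *: x + y)).
Hypothesis Pt : forall v s, P (t v s).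

Let N0 : {pred T} := [pred x | `[< P x >]].
Fact span_closed : submod_closed N0.
Proof. by split=> [|k x y]; rewrite !inE; [exact: P0|exact: PD]. Qed.
Let N : submodClosed T := HB.pack N0 (GRing.isSubmodClosed.Build K T N0 span_closed).

Let A0 : {pred T} := predT.
Fact full_closed : submod_closed A0.
Proof. by split. Qed.
Let A : submodClosed T := HB.pack A0 (GRing.isSubmodClosed.Build K T A0 full_closed).

Let full (x : T) : subsp A := Subsp (isT : x \in (A : {pred T})).

(** The projection to the quotient by the subspace [P] and the zero map agree on pure tensors, hence
    everywhere by uniqueness. *)
Lemma tensor_ind x : P x.
Proof.
pose h (x : T) : subquot A N := subquot_pi _ (full x).
have h_lin : linear h.
  move=> k u w; rewrite /h -linearP; congr subquot_pi; exact: val_inj.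
pose h' : {linear T -> subquot A N} := HB.pack h (GRing.isLinear.Build K T _ *:%R h h_lin).
pose f0 (v : V) (s : S) : subquot A N := 0.
have f0_bil : bilinear_for *:%R *:%R f0.
  by split=> [s|v] k u w /=; rewrite /f0 [_ *: _]scaler0 addr0.
pose f : {bilinear V -> S -> subquot A N} :=
  HB.pack f0 (bilinear_isBilinear.Build K V S (subquot A N) *:%R *:%R f0 f0_bil).
have [F [Ft FU]] := t_tensor f.
have h'0 : h' x = (\0 : {linear T -> subquot A N}) x.
  rewrite (FU h') => [|v s]; first by apply/esym/FU.
  rewrite -[LHS]/(subquot_pi _ (full (t v s))) /f /= /f0.
  rewrite -(linear0 (@subquot_pi K T A N)); apply/eqP; rewrite subquot_piP subr0 /=.
  by rewrite inE; exact: Pt.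
move: h'0; rewrite /= -(linear0 (@subquot_pi K T A N)) => /eqP.
by rewrite subquot_piP subr0 /= inE.
Qed.
End TensorSpan.

End Universal.

(** * Functionals on the enveloping algebra *)

Section EnvelopingFunctional.
Variables (K : fieldType) (g : lieAlgType K) (U : envAlg g) (B : {symmetric g}).
Hypotheses (B_inv : invariant_form B) (B_nondeg : nondegenerate B).
Hypothesis g_red : reductive g.

Lemma symm_form_nondeg x : (forall y, B x y = 0) -> x = 0.
Proof.
move=> H; apply/eqP; rewrite -memv0 -(eqP B_nondeg).
by apply/mem_orthovP => y _; apply: H.
Qed.

(* With [B] nondegenerate, [env_dual y] for all [y] replaces the only part of the
   Poincare-Birkhoff-Witt theorem that is needed: [1] and a basis of [g] are
   linearly independent in [U]. *)
Definition env_dual y := exists phi : U -> K,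
  [/\ scalar phi, phi 1 = 0 & forall x, phi (env_in U x) = B x y].

Lemma env_dualP a y y' : env_dual y -> env_dual y' -> env_dual (a *: y + y').
Proof.
move=> [phi [pl p1 pE]] [phi' [pl' p1' pE']].
exists (fun u => a * phi u + phi' u); split=> [k u u'||x].
- by rewrite pl pl' /=; ring.
- by rewrite p1 p1' mulr0 addr0.
- by rewrite pE pE' symm_form_lin.
Qed.

Lemma env_augmentation : exists eps : {lrmorphism U -> K^o}, forall x, eps (env_in U x) = 0.
Proof.
have [|eps [e0 _]] := @env_univ K g U K^o (\0 : {linear g -> K^o}).
  by move=> x y /=; rewrite mulr0 subrr.
by exists eps.
Qed.

(** A representation composed with a functional gives the right values on [g]; subtracting a
    multiple of the augmentation makes it vanish at 1. *)
Lemma env_dual_of (A : algType K) (f : {linear g -> A}) (psi : A -> K) y :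
  lie_map f -> scalar psi -> (forall x, psi (f x) = B x y) -> env_dual y.
Proof.
move=> fl psil psiE; have [F [FE _]] := @env_univ K g U A f fl.
have [eps eE] := env_augmentation.
exists (fun u => psi (F u) - psi 1 * eps u); split=> [k u u'||x].
- have eE' : eps (k *: u + u') = k * eps u + eps u' :> K by rewrite linearP.
  by rewrite linearP psil eE' /=; ring.
- by rewrite !rmorph1 mulr1 subrr.
- by rewrite FE eE mulr0 subr0.
Qed.

(** For central [z] the form [B x z] kills brackets, so it is a one-dimensional representation. *)
Lemma env_dual_center z : (forall y, lie y z = 0) -> env_dual z.
Proof.
move=> zc; pose h x : K^o := B x z.
have h_lin : linear h by move=> a x y; rewrite /h linearPl.
pose f : {linear g -> K^o} := HB.pack h (GRing.isLinear.Build K g K^o *:%R h h_lin).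
apply: (@env_dual_of K^o f id) => //.
move=> x y; rewrite /= /h B_inv zc linear0r.
by apply/eqP; rewrite eq_sym subr_eq0 mulrC.
Qed.

(* Brackets are represented by matrix coefficients of the adjoint module. *)
Lemma env_dual_lie a c : env_dual (lie a c).
Proof.
have [e0 [f0 ef0]] := dual_families_exist (symm_formC B) (symm_form_lin B) symm_form_nondeg.
have {e0 f0 ef0} [e [f ef]] := ex_intro (fun e => ex (dual_families B e)) _
  (ex_intro _ _ (dual_families_pad ef0)).
(* [ad_coord] acts on rows, so its opposite is the representation. *)
pose h x : 'M[K]_((\dim {:g}).+1) := - ad_coord B e f x.
have h_lin : linear h.
  move=> k x y; rewrite /h scalerN -opprD; congr (- _); apply/matrixP => i j.
  by rewrite !mxE lieDl lieZl linearPl.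
pose hL : {linear g -> 'M[K]_((\dim {:g}).+1)} :=
  HB.pack h (GRing.isLinear.Build K g _ *:%R h h_lin).
have adE x i : lie x (e i) = \sum_j ad_coord B e f x i j *: e j.
  exact: (ad_coordE ef).
have hL_lie : lie_map hL.
  move=> x y; rewrite /= /h !mulNr !mulrN !opprK.
  have adM u v : ad_coord B e f v * ad_coord B e f u =
      \matrix_(i, j) B (lie u (lie v (e i))) (f j).
    apply/matrixP => i j; rewrite [RHS]mxE adE linear_sum /=.
    rewrite (eq_bigr (fun k => ad_coord B e f v i k *: lie u (e k))) => [|k _]; last first.
      by rewrite linearZ.
    rewrite (symm_form_suml (symm_formC B) (symm_form_lin B)) mxE.
    by apply: eq_bigr => k _; rewrite [ad_coord B e f u _ _]mxE.
  rewrite !adM; apply/matrixP => i j; rewrite !mxE (lie_der x y).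
  have -> u v w : B (u + v) w = B u w + B v w by apply: linearDl.
  by rewrite opprD addrCA subrr addr0.
(* The coefficient of the adjoint module between [a] and [c]: on [h x] it equals [B (lie x a) c],
   which is [B x (lie a c)] by invariance. *)
pose psi (M : 'M[K]_((\dim {:g}).+1)) := - \sum_i \sum_j B a (f i) * M i j * B (e j) c.
apply: (@env_dual_of _ hL psi) => //.
  move=> k M M'; rewrite /psi mulrN -opprD mulr_sumr -big_split; congr (- _).
  apply: eq_bigr => i _; rewrite mulr_sumr -big_split; apply: eq_bigr => j _ /=.
  by rewrite !mxE; ring.
move=> x; rewrite /psi /= /h -B_inv.
have -> : lie x a = \sum_k B a (f k) *: lie x (e k).
  by rewrite {1}(ef.1 a) linear_sum; apply: eq_bigr => k _; rewrite linearZ.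
rewrite (symm_form_suml (symm_formC B) (symm_form_lin B)) -sumrN; apply: eq_bigr => i _.
rewrite adE (symm_form_suml (symm_formC B) (symm_form_lin B)) mulr_sumr -sumrN.
by apply: eq_bigr => j _; rewrite mxE mulrN mulNr opprK mulrA.
Qed.

Lemma env_dual_all y : env_dual y.
Proof.
have [z [d [-> zc dD]]] := reductive_decomp g_red y.
rewrite -[z]scale1r; apply: env_dualP; first exact: env_dual_center.
have d0 : env_dual 0 by have := env_dual_lie 0 0; rewrite linear0.
move: dD; rewrite /derived; set X := [seq _ | x <- _, y <- _] => dX.
rewrite (coord_span (X := in_tuple X) dX); apply: (big_ind env_dual) => [//|u v eu ev|i _].
  by rewrite -[u]scale1r; apply: env_dualP.
rewrite -[_ *: _]addr0; apply: env_dualP => //.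
have : (in_tuple X)`_i \in X by rewrite mem_nth.
by case/allpairsP => [[x x'] [_ _ ->]]; apply: env_dual_lie.
Qed.

End EnvelopingFunctional.

(** * Central terms in the square of the Dirac operator *)

Section TensorMaps.
Variables (K : fieldType) (A C : algType K) (AC : algTensor A C).
Local Notation t := (atens AC).

Definition inlA (a : A) : AC := t a 1.
Definition inrA (c : C) : AC := t 1 c.

Fact inlA_is_linear : linear inlA.
Proof. by move=> k a b; rewrite /inlA linearPl. Qed.
HB.instance Definition _ := GRing.isLinear.Build K A AC *:%R inlA inlA_is_linear.

Fact inrA_is_linear : linear inrA.
Proof. by move=> k a b; rewrite /inrA linearPr. Qed.
HB.instance Definition _ := GRing.isLinear.Build K C AC *:%R inrA inrA_is_linear.

Lemma inrA1 : inrA 1 = 1. Proof. exact: atens1. Qed.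
Lemma inlAM a b : inlA (a * b) = inlA a * inlA b.
Proof. by rewrite /inlA atensM mulr1. Qed.
Lemma inrAM a b : inrA (a * b) = inrA a * inrA b.
Proof. by rewrite /inrA atensM mulr1. Qed.
Lemma inl_inr a c : inlA a * inrA c = t a c.
Proof. by rewrite /inlA /inrA atensM mulr1 mul1r. Qed.
Lemma inr_inl a c : inrA c * inlA a = inlA a * inrA c.
Proof. by rewrite /inlA /inrA !atensM !mulr1 !mul1r. Qed.

(* [phi (x) id] for a linear functional [phi] on the first factor. *)
Lemma slice_map (phi : A -> K) : scalar phi ->
  exists F : {linear AC -> C}, forall a c, F (t a c) = phi a *: c.
Proof.
move=> philin; pose h a (c : C) : C := phi a *: c.
have h_bil : bilinear_for *:%R *:%R h.
  split=> [c|a] k u w /=; rewrite /h; first by rewrite philin scalerDl scalerA.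
  by rewrite linearP.
pose f : {bilinear A -> C -> C} :=
  HB.pack h (bilinear_isBilinear.Build K A C C *:%R *:%R h h_bil).
by have [F [FE _]] := @atens_univ K A C AC C f; exists F.
Qed.

End TensorMaps.

Section DiracCentral.
Variables (K : numFieldType) (g : lieAlgType K) (g_red : reductive g).
Variables (B : {symmetric g}) (r : {vspace g}).
Hypotheses (B_inv : invariant_form B) (B_nondeg : nondegenerate B).
Hypothesis r_sub : lie_subalgebra r.
Local Notation s := (orthov B r).
Local Notation L := (subLie r_sub).
Local Notation q := (@sform K g B r).
Local Notation lval := (@subLie_val K g r r_sub).
Variables (U : envAlg g) (C : cliffordAlg q) (UC : algTensor U C).
Variables (n N : nat) (b d : n.-tuple (subvs_of s)) (e f : 'I_N -> L).
Hypotheses (bd : dual_families q (tnth b) (tnth d)).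
Hypothesis ef : dual_families (@subLie_form K g B r r_sub) e f.

Definition gX (x : g) : UC := inlA UC (env_in U x).
Definition sY (u : subvs_of s) : UC := inrA UC (cliff_in C u).

Fact gX_is_linear : linear gX. Proof. by move=> k x y; rewrite /gX !linearP. Qed.
HB.instance Definition _ := GRing.isLinear.Build K g UC *:%R gX gX_is_linear.
Fact sY_is_linear : linear sY. Proof. by move=> k x y; rewrite /sY !linearP. Qed.
HB.instance Definition _ := GRing.isLinear.Build K _ UC *:%R sY sY_is_linear.

Lemma gX_lie : lie_map gX.
Proof. by move=> x y; rewrite /gX env_lie linearB /= !inlAM. Qed.

Lemma sY_cliff u v : sY u * sY v + sY v * sY u = (- 2 * q u v)%:A.
Proof. by rewrite /sY -!inrAM -linearD cliff_rel linearZ /= inrA1. Qed.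

Lemma sY_gX x u : sY u * gX x = gX x * sY u.
Proof. exact: inr_inl. Qed.

Local Notation v := (12%:R^-1 *: cubic sY (tnth b) (tnth d) (@cubic_form K g B r)).
Local Notation vC := (12%:R^-1 *: cubic (cliff_in C) (tnth b) (tnth d) (@cubic_form K g B r)).
Local Notation al x := (spin_lift sY (tnth b) (tnth d) (@ad_s K g B r r_sub x)).
Local Notation alC x := (spin_lift (cliff_in C) (tnth b) (tnth d) (@ad_s K g B r r_sub x)).

Lemma inrA_cubic : inrA UC vC = v.
Proof.
rewrite linearZ /=; congr (_ *: _); rewrite /cubic linear_sum; apply: eq_bigr => i _.
rewrite linear_sum; apply: eq_bigr => j _; rewrite linear_sum; apply: eq_bigr => k _.
by rewrite linearZ /= !inrAM.
Qed.

Lemma inrA_spin_lift (x : L) : inrA UC (alC x) = al x.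
Proof.
rewrite linearZ /=; congr (_ *: _); rewrite linear_sum; apply: eq_bigr => i _.
exact: inrAM.
Qed.

Lemma diracE : dirac UC b d = \sum_i gX (vsval (tnth b i)) * sY (tnth d i) + v.
Proof.
rewrite /dirac; congr (_ + _).
  by apply: eq_bigr => i _; rewrite [RHS]inl_inr.
rewrite -inrA_cubic -wedge_cubic; [|exact: cubic_form_alt|exact: cubic_form_cyc].
rewrite linearZ; congr (_ *: _); rewrite linear_sum; apply: eq_bigr => i _.
rewrite linear_sum; apply: eq_bigr => j _; rewrite linear_sum; apply: eq_bigr => k _.
by rewrite [RHS]linearZ.
Qed.

Definition casU : U := \sum_i env_in U (vsval (tnth d i)) * env_in U (vsval (tnth b i)) +
  \sum_k env_in U (lval (e k)) * env_in U (lval (f k)).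

Definition diag_act (x : L) : UC := gX (lval x) + al x.

Definition cliff_const : C := vC * vC - \sum_k alC (e k) * alC (f k).

Local Notation D := (dirac UC b d).

Lemma dirac_sq : D * D =
  \sum_k diag_act (e k) * diag_act (f k) - inlA UC casU + inrA UC cliff_const.
Proof.
rewrite diracE (dirac_square B_inv bd ef gX_lie sY_cliff sY_gX).
congr (_ - _ + _).
  rewrite /casU linearD !linear_sum; congr (_ + _); apply: eq_bigr => k _; exact/esym/inlAM.
rewrite /cliff_const linearB /= inrAM inrA_cubic; congr (_ - _).
by rewrite [RHS]linear_sum; apply: eq_bigr => k _; rewrite /= inrAM !inrA_spin_lift.
Qed.

(** The families of the complement and of [r] together are dual for [B], and [ad x] is skew for [B];
    centrality extends from [g] to [U] by induction on generators. *)
Lemma casU_central u : casU * u = u * casU.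
Proof.
have comE a c : com a c = 0 -> c * a = a * c.
  by move/eqP; rewrite subr_eq0 => /eqP.
apply: comE; apply: (env_ind (P := fun u => com u casU = 0)) u => [|x].
  split=> [|k a a' Ha Ha'|a a' Ha Ha'].
  - by rewrite /com mulr1 mul1r subrr.
  - by rewrite com_linearl Ha Ha' scaler0 addr0.
  - by rewrite comMl Ha Ha' mulr0 mul0r addr0.
pose E (k : 'I_n + 'I_N) := match k with inl i => vsval (tnth d i) | inr k => lval (e k) end.
pose G (k : 'I_n + 'I_N) := match k with inl i => vsval (tnth b i) | inr k => lval (f k) end.
have db : dual_families q (tnth d) (tnth b) by case: bd.
have fe : dual_families (@subLie_form K g B r r_sub) f e by case: ef.
have EG : dual_families B E G.
  split=> w; rewrite big_sumType /=; exact: orthogonal_expansion.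
have := dual_families_skew (symm_formC B) EG (T := lie x)
  (Phi := fun u v => env_in U u * env_in U v) (lie_B_skew B_inv x).
have comX y : com (env_in U x) (env_in U y) = env_in U (lie x y) by rewrite env_lie.
have -> : com (env_in U x) casU = \sum_k (env_in U (lie x (E k)) * env_in U (G k) +
    env_in U (E k) * env_in U (lie x (G k))).
  rewrite /casU linearD !linear_sum big_sumType; congr (_ + _);
  by apply: eq_bigr => k _; rewrite /= comM !comX.
by apply=> [w a u u'|w a u u'] /=; rewrite linearP (mulrDl, mulrDr) (=^~ scalerAl, =^~ scalerAr).
Qed.

Lemma dirac_inlA z : (forall u, z * u = u * z) -> D * inlA UC z = inlA UC z * D.
Proof.
move=> zc; rewrite diracE -inrA_cubic mulrDl mulrDr inr_inl; congr (_ + _).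
rewrite mulr_suml mulr_sumr; apply: eq_bigr => i _.
by rewrite -mulrA inr_inl !mulrA -!inlAM zc.
Qed.

Let com_gX_sY x u : com (gX x) (sY u) = 0.
Proof. by rewrite /com sY_gX subrr. Qed.

Let com_al_gX x y : com (al x) (gX y) = 0.
Proof. by rewrite /com (spin_lift_X (tnth b) (tnth d) sY_gX) subrr. Qed.

(** The linear part of [D] is the image of the invariant tensor of the complement, and the cubic
    part comes from an invariant form. *)
Lemma com_diag_dirac x : com (diag_act x) D = 0.
Proof.
have comD a a' c : com (a + a' : UC) c = com a c + com a' c.
  by rewrite -[a]scale1r com_linearl !scale1r.
have al_sY u : com (al x) (sY u) = sY (ad_s x u).
  exact: (com_spin_lift (@sformC _ _ _ _) sY_cliff bd u (ad_s_skew B_inv x)).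
have gX_v : com (gX (lval x)) v = 0.
  have c0 : com (gX (lval x)) (cubic sY (tnth b) (tnth d) (@cubic_form K g B r)) = 0.
    rewrite /cubic linear_sum big1 //= => i _; rewrite linear_sum big1 //= => j _.
    rewrite linear_sum big1 //= => k _; rewrite linearZ /= !comM !com_gX_sY.
    by rewrite !mul0r !mulr0 !addr0 mul0r scaler0.
  by rewrite linearZ /= c0; apply: scaler0.
have al_v : com (al x) v = 0.
  have c0 := com_spin_lift_cubic (@sformC _ _ _ _) sY_cliff bd (@cubic_form_lin _ _ _ _)
    (@cubic_form_alt _ _ _ _) (cubic_form_cyc B_inv) (ad_s_skew B_inv x)
    (cubic_form_inv B_inv x).
  by rewrite linearZ /= (c0 B_inv); apply: scaler0.
rewrite diracE linearD linear_sum /= [com _ v]comD gX_v al_v !addr0.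
have := dual_families_skew (@sformC _ _ _ _) bd (T := ad_s x)
  (Phi := fun u v => gX (vsval u) * sY v) (ad_s_skew B_inv x).
under eq_bigr do rewrite comD !comM com_gX_sY com_al_gX mulr0 mul0r addr0 add0r al_sY.
under eq_bigr do rewrite /com -gX_lie -(ad_sE B_inv).
by apply=> [w a u u'|w a u u'] /=; rewrite linearP (mulrDl, mulrDr) (=^~ scalerAl, =^~ scalerAr).
Qed.

Lemma dirac_diag_casimir :
  com (\sum_k diag_act (e k) * diag_act (f k)) D = 0.
Proof.
rewrite comNr linear_sum big1 ?oppr0 // => k _ /=.
by rewrite comM !(comNr D) !com_diag_dirac !oppr0 mul0r mulr0 addr0.
Qed.

Lemma cliff_const_dirac : com (inrA UC cliff_const) D = 0.
Proof.
have comDl (a a' c : UC) : com (a + a') c = com a c + com a' c.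
  by rewrite -[a]scale1r com_linearl !scale1r.
have comNl (a c : UC) : com (- a) c = - com a c.
  by rewrite comNr linearN [in RHS]comNr opprK.
have := dirac_sq; move/(congr1 (fun x => com x D)).
rewrite !comDl comNl dirac_diag_casimir add0r.
have -> : com (inlA UC casU) D = 0 by rewrite /com dirac_inlA ?subrr //; apply: casU_central.
by rewrite oppr0 add0r /com mulrA subrr => <-.
Qed.

(* The functionals on [U] vanishing at [1] and dual to the [b_i] extract from
   [[1 (x) c, D] = 0] the relations [[c, y] = 0] for [y] in the complement. *)
Lemma cliff_const_central a : cliff_const * a = a * cliff_const.
Proof.
set c := cliff_const; pose Q a := com c a = 0.
suff : Q a by move/eqP; rewrite subr_eq0 => /eqP.
apply: (cliff_ind (P := Q)) a => [|u].
  split=> [|k a a' Ha Ha'|a a' Ha Ha'].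
  - by rewrite /Q /com mulr1 mul1r subrr.
  - by rewrite /Q linearP /= Ha Ha' scaler0 addr0.
  - by rewrite /Q comM Ha Ha' mulr0 mul0r addr0.
have [phi [phi_lin phi1 phiE]] := env_dual_all U B_inv B_nondeg g_red (vsval u).
have [F FE] := slice_map UC phi_lin.
have := cliff_const_dirac; rewrite diracE -inrA_cubic => /(congr1 F).
have -> : com (inrA UC c) (\sum_i gX (vsval (tnth b i)) * sY (tnth d i) + inrA UC vC) =
   \sum_i atens UC (env_in U (vsval (tnth b i))) (com c (cliff_in C (tnth d i))) +
   atens UC 1 (com c vC).
  rewrite linearD linear_sum; congr (_ + _); last first.
    by rewrite /= /com -!inrAM -[RHS]/(inrA UC _) linearB.
  apply: eq_bigr => i _ /=; rewrite comM -[atens _ _ _]inl_inr.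
  rewrite {1}/com inr_inl subrr mul0r add0r; congr (_ * _).
  by rewrite /com -!inrAM linearB.
rewrite linearD linear_sum FE phi1 scale0r addr0 linear0 => H; apply: etrans H.
rewrite {1}[u](bd.2) !linear_sum; apply: eq_bigr => i _ /=.
by rewrite FE phiE !linearZ /= symm_formC.
Qed.

End DiracCentral.

(** * Finite-dimensional subspaces *)

Section SetSubspaces.
Local Open Scope classical_set_scope.
Variables (K : fieldType) (V : lmodType K).
Implicit Types (M : set V).

Lemma is_subspaceZ M k v : is_subspace M -> M v -> M (k *: v).
Proof. by move=> [M0 MD] Mv; rewrite -[_ *: _]addr0; apply: MD. Qed.

Lemma is_subspaceD M u v : is_subspace M -> M u -> M v -> M (u + v).
Proof. by move=> [_ MD] Mu Mv; rewrite -[u]scale1r; apply: MD. Qed.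

Lemma is_subspace_sum M (I : Type) (l : seq I) (P : pred I) (u : I -> V) :
  is_subspace M -> (forall i, P i -> M (u i)) -> M (\sum_(i <- l | P i) u i).
Proof.
move=> sM Mu; elim/big_ind: _ => [|x y|i Pi]; [by case: sM|exact: is_subspaceD|exact: Mu].
Qed.

Lemma finite_dim_fin (I : finType) M (e : I -> V) : (forall i, M (e i)) ->
  (forall v, M v -> exists c : I -> K, v = \sum_i c i *: e i) -> finite_dim M.
Proof.
move=> Me spe; exists #|I|, (fun i => e (enum_val i)); split=> // v /spe[c ->].
by exists (fun i => c (enum_val i)); rewrite (reindex_onto enum_val enum_rank) /=;
  [apply: eq_bigl => i; rewrite enum_valK eqxx|move=> i _; rewrite enum_rankK].
Qed.

Definition sum_set M M' : set V := [set x | exists a b, [/\ M a, M' b & x = a + b]].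

Lemma sum_set_subspace M M' : is_subspace M -> is_subspace M' -> is_subspace (sum_set M M').
Proof.
move=> sM sM'; split; first by exists 0, 0; rewrite addr0; split=> //; [case: sM|case: sM'].
move=> k _ _ [a [b [Ma Mb ->]]] [a' [b' [Ma' Mb' ->]]].
exists (k *: a + a'), (k *: b + b'); split; first by apply sM.
  by apply sM'.
by rewrite scalerDr addrACA.
Qed.

Lemma sum_setl M M' x : is_subspace M' -> M x -> sum_set M M' x.
Proof. by move=> [M0 _] Mx; exists x, 0; rewrite addr0. Qed.

Lemma sum_setr M M' x : is_subspace M -> M' x -> sum_set M M' x.
Proof. by move=> [M0 _] Mx; exists 0, x; rewrite add0r. Qed.

Lemma sum_set_finite M M' : is_subspace M -> is_subspace M' ->
  finite_dim M -> finite_dim M' -> finite_dim (sum_set M M').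
Proof.
move=> sM sM' [n [e [Me spe]]] [n' [e' [Me' spe']]].
apply: (@finite_dim_fin ('I_n + 'I_n')%type _
    (fun i => match i with inl i => e i | inr i => e' i end)).
  by move=> [i|i]; [apply: sum_setl|apply: sum_setr].
move=> _ [a [b [/spe[c ->] /spe'[c' ->] ->]]].
exists (fun i => match i with inl i => c i | inr i => c' i end).
by rewrite big_sumType.
Qed.

Lemma image_finite (h : {linear V -> V}) M : finite_dim M -> finite_dim (h @` M).
Proof.
move=> [n [e [Me spe]]]; exists n, (fun i => h (e i)); split=> [i|_ [v /spe[c ->] <-]].
  by exists (e i).
by exists c; rewrite linear_sum; apply: eq_bigr => i _; rewrite linearZ.
Qed.

Lemma image_subspace (h : {linear V -> V}) M : is_subspace M -> is_subspace (h @` M).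
Proof.
move=> [M0 MD]; split; first by exists 0; rewrite ?linear0.
by move=> k _ _ [u Mu <-] [v Mv <-]; exists (k *: u + v); [exact: MD|exact: linearP].
Qed.

Lemma line_subspace (v : V) : is_subspace [set k *: v | k in @setT K].
Proof.
split; first by exists 0; rewrite ?scale0r.
by move=> k _ _ [a _ <-] [b _ <-]; exists (k * a + b); rewrite // scalerDl scalerA.
Qed.

Lemma line_finite (v : V) : finite_dim [set k *: v | k in @setT K].
Proof.
exists 1%N, (fun=> v); split=> [_|_ [a _ <-]]; first by exists 1; rewrite ?scale1r.
by exists (fun=> a); rewrite big_ord1.
Qed.

Section EigenSum.
Variable T : {linear V -> V}.

Lemma eigen_sumD M u v : eigen_sum T M u -> eigen_sum T M v -> eigen_sum T M (u + v).
Proof.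
move=> [l lP ->] [l' lP' ->]; exists (l ++ l'); last by rewrite big_cat.
by move=> p; rewrite mem_cat => /orP[/lP|/lP'].
Qed.

Lemma eigen_sum0 M : eigen_sum T M 0.
Proof. by exists [::]; rewrite ?big_nil. Qed.

Lemma eigen_sum1 M a u : M u -> T u = a *: u -> eigen_sum T M u.
Proof.
move=> Mu Tu; exists [:: (a, u)]; last by rewrite big_seq1.
by move=> p; rewrite inE => /eqP ->.
Qed.

Lemma eigen_sumZ M k u : is_subspace M -> eigen_sum T M u -> eigen_sum T M (k *: u).
Proof.
move=> sM [l lP ->]; rewrite scaler_sumr.
exists [seq (p.1, k *: p.2) | p <- l]; last by rewrite big_map.
move=> _ /mapP[p /lP[Mp Tp] ->] /=; split; first exact: is_subspaceZ.
by rewrite linearZ /= Tp !scalerA mulrC.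
Qed.

Lemma eigen_sum_subset M M' u : M `<=` M' -> eigen_sum T M u -> eigen_sum T M' u.
Proof. by move=> MM' [l lP ->]; exists l => // p /lP[/MM']. Qed.

Lemma eigen_sum_sum M (I : eqType) (l : seq I) (u : I -> V) :
  (forall i, i \in l -> eigen_sum T M (u i)) -> eigen_sum T M (\sum_(i <- l) u i).
Proof.
move=> H; rewrite big_seq; elim/big_ind: _ => [|x y|i /H] //; first exact: eigen_sum0.
exact: eigen_sumD.
Qed.

End EigenSum.

End SetSubspaces.

Section EigenVector.
Local Open Scope classical_set_scope.
Variables (K : numClosedFieldType) (V : lmodType K).

Lemma finite_dim_eigenvector (T : {linear V -> V}) (M : set V) :
  is_subspace M -> finite_dim M -> M <> [set 0] -> (forall v, M v -> M (T v)) ->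
  exists a v, [/\ M v, v != 0 & T v = a *: v].
Proof.
move=> sM fM nM MT; have [n [b [Mb spb frb]]] := finite_dim_basis fM.
have n0 : (0 < n)%N.
  rewrite lt0n; apply/eqP => n0; apply: nM; apply/seteqP; split=> [v /spb[c ->]|_ ->].
    by rewrite big1 // => i; have := ltn_ord i; rewrite {2}n0.
  by case: sM.
have /choice[c cP] : forall i, exists c : 'I_n -> K, T (b i) = \sum_j c j *: b j.
  by move=> i; apply/spb/MT.
pose A := \matrix_(i, j) c i j.
have [a /eigenvalueP[u uA u0]] := eigenvalue_closed A n0.
exists a, (\sum_i u 0 i *: b i); split.
- by apply: is_subspace_sum => // i _; apply: is_subspaceZ.
- apply: contra u0 => /eqP/(frb _) H; apply/eqP/rowP => i; rewrite H mxE //.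
rewrite linear_sum scaler_sumr /=.
rewrite (eq_bigr (fun i => \sum_j (u 0 i * A i j) *: b j)) => [|i _]; last first.
  rewrite linearZ /= cP scaler_sumr; apply: eq_bigr => j _.
  by rewrite scalerA mxE.
rewrite exchange_big; apply: eq_bigr => j _ /=.
rewrite -scaler_suml scalerA; congr (_ *: _).
by have /rowP/(_ j) := uA; rewrite !mxE.
Qed.

End EigenVector.

Section CenterOnComplement.
Local Open Scope classical_set_scope.
Variables (K : numClosedFieldType) (g : lieAlgType K) (B : {symmetric g}).
Variable r : {vspace g}.
Hypotheses (B_inv : invariant_form B) (r_sub : lie_subalgebra r).
Hypothesis r_red : reductive_in r.
Local Notation s := (orthov B r).
Local Notation L := (subLie r_sub).
Local Notation q := (@sform K g B r).
Variables (n : nat) (b d : 'I_n -> subvs_of s).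
Hypothesis bd : dual_families q b d.

(** Induction on the dimension of [W]. An eigenspace of [ad z] in [W] is stable under [r] because
    [z] is central in [r]; [reductive_in] supplies a stable complement in [g], whose intersection
    with [W] is smaller. *)
Lemma center_eigen_sum (z : g) (W : {vspace g}) y :
  z \in r -> {in r, forall x, lie x z = 0} -> ad_stable r W -> y \in W ->
  eigen_sum (lie z) setT y.
Proof.
move=> zr zc; have [k] := ubnP (\dim W); elim: k W y => // k IH W y dimW sW yW.
have [W0|W0] := eqVneq W 0%VS.
  by move: yW; rewrite W0 memv0 => /eqP ->; apply: eigen_sum0.
pose h : {linear g -> g} := lie z.
have [a [u [uW u0 hu]]] : exists a u, [/\ u \in W, u != 0 & h u = a *: u].
  have [||/seteqP[M0 _]|v vW|a [v [vW v0 hv]]] := @finite_dim_eigenvector K g h [set y | y \in W].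
  - by split=> [|c x x' xW x'W]; rewrite /= ?mem0v // memvD // memvZ.
  - exists (\dim W), (fun i => (vbasis W)`_i); split=> [i|v vW].
      by rewrite /= vbasis_mem // mem_nth // size_tuple.
    by exists (fun i => coord (vbasis W) i v); apply: coord_vbasis.
  - have := M0 (vpick W) (memv_pick W) => /= /eqP; rewrite vpick0; exact/negP.
  - exact: sW.
  - by exists a, v.
pose W1 := (W :&: lker (linfun h - a *: \1%VF))%VS.
have W1E w : (w \in W1) = (w \in W) && (h w == a *: w).
  rewrite memv_cap memv_ker; congr (_ && _).
  by rewrite add_lfunE opp_lfunE scale_lfunE id_lfunE lfunE subr_eq0.
have sW1 : ad_stable r W1.
  move=> x w xr; rewrite !W1E => /andP[wW /eqP hw]; rewrite (sW _ _ xr wW) /=.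
  by rewrite /h /= lie_der (lieC z) zc // oppr0 lie0l add0r [lie z w]hw linearZ.
have [W' [sW' eW' cW']] := r_red sW1.
pose W2 := (W :&: W')%VS.
have sW2 : ad_stable r W2.
  by move=> x w xr; rewrite !memv_cap => /andP[wW wW']; rewrite sW // sW'.
have uW1 : u \in W1 by rewrite W1E uW hu eqxx.
have dimW2 : (\dim W2 < k)%N.
  apply: (leq_trans _ (dimW : (\dim W <= k)%N)); rewrite ltn_neqAle (dimvS (capvSl W W')) andbT.
  rewrite (dimv_leqif_sup (capvSl W W')); apply/negP => /subvP/(_ _ uW).
  rewrite memv_cap uW /= => uW'.
  by have : u \in (W1 :&: W')%VS by [rewrite memv_cap uW1]; rewrite cW' memv0 (negPf u0).
have : y \in (W1 + W')%VS by rewrite eW' memvf.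
case/memv_addP => w1 w1W [w' w'W ey]; rewrite ey.
move: w1W; rewrite W1E => /andP[w1W /eqP hw1].
apply: eigen_sumD; first exact: (@eigen_sum1 _ _ h setT a).
apply: IH dimW2 sW2 _; rewrite memv_cap w'W andbT.
have -> : w' = y - w1 by rewrite ey addrC addKr.
exact: memvB.
Qed.

(** The orthogonal projection [pr] of [g] to the complement commutes with [z], by invariance of the
    dual tensor, so it maps eigenvectors to eigenvectors. *)
Lemma center_ad_s_eigen_sum (z : L) y : (forall x, lie x z = 0) ->
  eigen_sum (ad_s z) setT (y : subvs_of s).
Proof.
move=> zc; pose pr (u : g) : subvs_of s := \sum_i B u (vsval (d i)) *: b i.
have pr_lin : linear pr.
  move=> k u u'; rewrite /pr scaler_sumr -big_split; apply: eq_bigr => i _ /=.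
  by rewrite linearPl scalerDl scalerA.
pose prL : {linear g -> subvs_of s} := HB.pack pr (GRing.isLinear.Build K g _ *:%R pr pr_lin).
have zc' : {in r, forall x, lie x (subLie_val z) = 0}.
  move=> x xr; have [x' <-] := subLie_valK r_sub xr.
  by rewrite -subLie_lie zc linear0.
have [l lP ey] := center_eigen_sum (subLie_valP z) zc' (W := fullv)
  (fun _ _ _ _ => memvf _) (memvf (vsval y)).
have -> : y = \sum_(p <- l) prL p.2.
  by rewrite -linear_sum -ey /= /pr {1}[y]bd.1.
apply: eigen_sum_sum => p /lP[_ zp]; apply: (@eigen_sum1 _ _ _ _ p.1) => //=.
have H := dual_families_skew (@sformC K g B r) bd (T := ad_s z)
  (Phi := fun x y => B p.2 (vsval y) *: x) (ad_s_skew B_inv z).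
rewrite /pr linear_sum scaler_sumr /=; apply/eqP; rewrite -subr_eq0 -sumrB.
apply/eqP; rewrite -[RHS]H => [|w k u u'|u k w w'] /=; last first.
- by rewrite symm_form_lin scalerDl scalerA.
- by rewrite scalerDr !scalerA mulrC.
apply: eq_bigr => i _; rewrite linearZ /=; congr (_ + _).
rewrite (ad_sE B_inv) -scaleNr scalerA; congr (_ *: _).
by rewrite -[RHS]opprK -(lie_B_skew B_inv) [lie _ _]zp linearZl_LR mulNr.
Qed.

End CenterOnComplement.

(** * The spin module *)

Section AlgRep.
Local Open Scope classical_set_scope.
Variables (K : fieldType) (A : algType K) (V : algRep A).

Lemma actP k a a' (v : V) : act V (k *: a + a') v = k *: act V a v + act V a' v.
Proof. exact: act_linear. Qed.

Lemma act0 (v : V) : act V 0 v = 0.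
Proof. by apply: (addIr (act V 0 v)); rewrite -{1}[act V 0 v]scale1r -actP scale1r !add0r. Qed.

Lemma actD a a' (v : V) : act V (a + a') v = act V a v + act V a' v.
Proof. by rewrite -[a]scale1r actP !scale1r. Qed.

Lemma actZ k a (v : V) : act V (k *: a) v = k *: act V a v.
Proof. by rewrite -[_ *: a]addr0 actP act0 addr0. Qed.

Lemma actN a (v : V) : act V (- a) v = - act V a v.
Proof. by apply: (addIr (act V a v)); rewrite -actD !addNr act0. Qed.

Lemma act_sum (I : Type) (l : seq I) (P : pred I) (F : I -> A) (v : V) :
  act V (\sum_(i <- l | P i) F i) v = \sum_(i <- l | P i) act V (F i) v.
Proof. by elim/big_rec2: _ => [|i a w _ <-]; rewrite ?act0 // actD. Qed.

End AlgRep.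

Section SpinModule.
Local Open Scope classical_set_scope.
Variables (K : numClosedFieldType) (W : vectType K) (q : W -> W -> K).
Variables (Cl : cliffordAlg q) (S : algRep Cl).
Hypothesis S_irr : irreducible (act S : Cl -> S -> S) setT.
Local Notation Y y := (act S (cliff_in Cl y)).

Lemma cliff_submodule (M : set S) : is_subspace M ->
  (forall y v, M v -> M (Y y v)) -> (exists2 v, M v & v != 0) -> M = setT.
Proof.
move=> sM MY [v Mv v0]; have [_ _ /(_ M)[]] := S_irr.
- split=> // a w Mw; move: w Mw.
  apply: (cliff_ind (P := fun a => forall w, M w -> M (act S a w))) a => [|y w /MY//].
  split=> [w|k a a' Ha Ha' w Mw|a a' Ha Ha' w Mw].
  + by rewrite act1.
  + by rewrite actP; case: sM => _; apply; [exact: Ha|exact: Ha'].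
  + by rewrite actM; apply/Ha/Ha'.
- by [].
- by move=> M0; move: Mv v0; rewrite M0 /= => ->; rewrite eqxx.
- by [].
Qed.

Lemma spin_nonzero : exists v : S, v != 0.
Proof.
have [_ n0 _] := S_irr; apply: contrapT => /forallNP H; apply: n0.
apply/seteqP; split=> [v _|//]; have /negP := H v; rewrite negbK => /eqP ->.
by [].
Qed.

(** The span of the products of sublists of [l], in the order of the list, applied to [v]: at most
    two to the power [size l] vectors. *)
Fixpoint cliff_words (v : S) (l : seq W) : set S :=
  if l is y :: l' then sum_set (cliff_words v l') (Y y @` cliff_words v l')
  else [set k *: v | k in @setT K].

Lemma cliff_words_subspace v l : is_subspace (cliff_words v l).
Proof.
elim: l => [|y l IH] /=; first exact: line_subspace.
by apply: sum_set_subspace => //; apply: image_subspace.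
Qed.

Lemma cliff_words_finite v l : finite_dim (cliff_words v l).
Proof.
elim: l => [|y l IH] /=; first exact: line_finite.
have sl := cliff_words_subspace v l.
by apply: sum_set_finite => //; [apply: image_subspace|apply: image_finite].
Qed.

Lemma act_cliff_swap y y' w : Y y (Y y' w) = (- 2 * q y y') *: w - Y y' (Y y w).
Proof.
have := @cliff_rel K W q Cl y y'; move/(congr1 (fun a => act S a w)).
by rewrite actD !actM actZ act1 => <-; rewrite addrK.
Qed.

(** The Clifford relation moves [y] past the earlier generators until it meets its own copy, whose
    square is scalar. *)
Lemma cliff_words_stable v l y w : y \in l -> cliff_words v l w -> cliff_words v l (Y y w).
Proof.
elim: l w => // x l IH w; rewrite inE => yl /= [a [_ [Ma [c Mc <-] ->]]].
have sl := cliff_words_subspace v l.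
have [->|yx] := eqVneq y x.
  have q2 : Y x (Y x c) = (- q x x) *: c.
    have two0 : (2 : K) != 0 by rewrite pnatr_eq0.
    apply: (scalerI two0); rewrite scaler_nat mulr2n {1}act_cliff_swap subrK.
    by rewrite scalerA mulNr mulrN.
  exists (- q x x *: c), (Y x a); split; first exact: is_subspaceZ.
    by exists a.
  by rewrite linearD q2 addrC.
have {}yl : y \in l by move: yl; rewrite (negPf yx).
exists (Y y a + (- 2 * q y x) *: c), (Y x (- Y y c)); split.
- by apply: is_subspaceD => //; [exact: IH|exact: is_subspaceZ].
- by exists (- Y y c) => //; rewrite -scaleN1r; apply: is_subspaceZ => //; apply: IH.
- by rewrite linearD act_cliff_swap linearN addrA.
Qed.

Variables (n : nat) (b d : 'I_n -> W).
Hypothesis bd : dual_families q b d.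

Lemma spin_finite_dim : finite_dim (@setT S).
Proof.
have [v v0] := spin_nonzero; pose l := [seq b i | i <- enum 'I_n].
have <- : cliff_words v l = setT; last exact: cliff_words_finite.
have sl := cliff_words_subspace v l.
apply: cliff_submodule => // [y w Mw|].
  rewrite [y]bd.1 linear_sum act_sum; apply: is_subspace_sum => // i _.
  rewrite linearZ /= actZ; apply: is_subspaceZ => //; apply: cliff_words_stable => //.
  by apply: map_f; rewrite mem_enum.
exists v => //; elim: l {sl} => [|y l IH]; first by exists 1; rewrite ?scale1r.
by apply: sum_setl => //; apply/image_subspace/cliff_words_subspace.
Qed.

Lemma spin_schur c : (forall a : Cl, c * a = a * c) -> exists k, forall v : S, act S c v = k *: v.
Proof.
move=> cc; have [||||k [v [_ v0 cv]]] := @finite_dim_eigenvector K S (act S c) setT.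
- by split.
- exact: spin_finite_dim.
- by have [_ ? _] := S_irr.
- by [].
exists k; have : [set w : S | act S c w = k *: w] = setT.
  apply: cliff_submodule => [|y w /= cw|]; last by exists v.
  - split=> [|h w w' /= cw cw']; first by rewrite /= linear0 scaler0.
    by rewrite linearP cw cw' scalerDr !scalerA mulrC.
  - by rewrite -actM cc actM cw linearZ.
by move=> E w; have : [set: S] w by []; rewrite -E.
Qed.

(* Translate a single eigenvector by the Clifford generators. *)
Lemma spin_eigen_sum (a : Cl) (T : {linear W -> W}) :
  (forall y, a * cliff_in Cl y - cliff_in Cl y * a = cliff_in Cl (T y)) ->
  (forall y, eigen_sum T setT y) -> forall v : S, eigen_sum (act S a) setT v.
Proof.
move=> aT T_ss v; suff : [set w : S | eigen_sum (act S a) setT w] = setT.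
  by move=> E; suff: [set w : S | eigen_sum (act S a) setT w] v by []; rewrite E.
have [||||k [u [_ u0 au]]] := @finite_dim_eigenvector K S (act S a) setT.
- by split.
- exact: spin_finite_dim.
- by have [_ ? _] := S_irr.
- by [].
apply: cliff_submodule.
- split=> [|h w w' /= Mw Mw']; first exact: eigen_sum0.
  by apply: eigen_sumD => //; apply: eigen_sumZ.
- move=> y w /= [l lP ->]; have [m mP ->] := T_ss y.
  rewrite [cliff_in Cl _]linear_sum act_sum /=; apply: eigen_sum_sum => p pm.
  rewrite linear_sum; apply: eigen_sum_sum => p' p'l.
  have [_ Tp] := mP p pm; have [_ ap'] := lP p' p'l.
  apply: (@eigen_sum1 _ _ _ _ (p'.1 + p.1)) => //=.
  have e : a * cliff_in Cl p.2 = cliff_in Cl p.2 * a + cliff_in Cl (T p.2).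
    by rewrite -aT addrC subrK.
  by rewrite -actM e actD actM ap' Tp linearZ /= linearZ /= actZ scalerDl.
- by exists u => //; exact: (@eigen_sum1 K S (act S a) setT k u I au).
Qed.

End SpinModule.

(** * Local finiteness of the diagonal action *)

Section TensorModule.
Local Open Scope classical_set_scope.
Variables (K : numClosedFieldType) (L : lieAlgType K) (V S T : lmodType K).
Variable t : {bilinear V -> S -> T}.
Variables (rV : L -> {linear V -> V}) (rS : L -> {linear S -> S}).
Variable op : L -> {linear T -> T}.
Hypothesis rV_lie : forall x y v, rV (lie x y) v = rV x (rV y v) - rV y (rV x v).
Hypothesis op_t : forall x v s, op x (t v s) = t (rV x v) s + t v (rS x s).
Hypothesis S_fin : finite_dim (@setT S).
Local Notation central z := (forall y : L, lie y z = 0).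
Hypothesis S_center : forall z, central z -> forall s, eigen_sum (rS z) setT s.

Lemma irreducible_central_scalar (W : set V) z : finite_dim W ->
  irreducible (rV : L -> V -> V) W -> central z ->
  exists a, forall v, W v -> rV z v = a *: v.
Proof.
move=> fW [[sW stW] nW irrW] zc.
have [||||a [u [Wu u0 zu]]] := @finite_dim_eigenvector K V (rV z) W => //.
  by move=> v; apply: stW.
exists a; have [||W0|WE] := irrW [set v | W v /\ rV z v = a *: v].
- split.
    split=> [|k v w [/= Wv zv] [Ww zw]]; first by split; [case: sW|rewrite linear0 scaler0].
    split; first by apply: sW.2.
    by rewrite linearP zv zw scalerDr !scalerA mulrC.
  move=> x v [/= Wv zv]; split; first exact: stW.
  have := rV_lie x z v; rewrite zc => e.
  have rV0 : rV 0 v = 0 by have := rV_lie 0 0 v; rewrite lie0l subrr.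
  by move/eqP: e; rewrite rV0 eq_sym subr_eq0 => /eqP <-; rewrite zv linearZ.
- by move=> v [].
- have : [set v | W v /\ rV z v = a *: v] u by [].
  by rewrite W0 /= => u00; rewrite u00 eqxx in u0.
- by move=> v Wv; move: (Wv); rewrite -{1}WE; case.
Qed.

(** The conditions under which the Casimir operator is known to be semisimple on [M]; they are
    preserved by sums. *)
Definition finite_ss_module (M : set T) := [/\ is_subspace M, finite_dim M,
  forall x w, M w -> M (op x w) &
  forall z, central z -> forall w, M w -> eigen_sum (op z) M w].

Lemma finite_ss_module_sum M M' : finite_ss_module M -> finite_ss_module M' -> finite_ss_module (sum_set M M').
Proof.
move=> [sM fM stM cM] [sM' fM' stM' cM']; split.
- exact: sum_set_subspace.
- exact: sum_set_finite.
- move=> x _ [a [b [Ma Mb ->]]]; exists (op x a), (op x b).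
  by rewrite linearD; split; [exact: stM|exact: stM'|].
- move=> z zc _ [a [b [Ma Mb ->]]]; apply: eigen_sumD.
    by apply: eigen_sum_subset (cM z zc a Ma) => v; apply: sum_setl.
  by apply: eigen_sum_subset (cM' z zc b Mb) => v; apply: sum_setr.
Qed.

(** [M] is the image of [W] tensor [S]. A central element is scalar on [W] by Schur's lemma and
    diagonalizable on [S], and the eigenvalues add up. *)
Lemma finite_ss_module_irreducible (W : set V) : finite_dim W ->
  irreducible (rV : L -> V -> V) W ->
  exists2 M, finite_ss_module M & forall v s, W v -> M (t v s).
Proof.
move=> fW irrW; have [[sW stW] _ _] := irrW.
have [n [e [We spe]]] := fW; have [m [h [_ sph]]] := S_fin.
have tl s : linear (t^~ s) by move=> k v v'; rewrite linearPl.
have tr v : linear (t v) by move=> k s s'; rewrite linearPr.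
pose E (p : 'I_n * 'I_m) := t (e p.1) (h p.2).
pose M := [set x | exists c : 'I_n * 'I_m -> K, x = \sum_p c p *: E p].
have Mt v s : W v -> M (t v s).
  move=> /spe[c ->]; have [c' ->] := sph s I.
  exists (fun p => c p.1 * c' p.2); rewrite (linear_suml (tl _)).
  rewrite -(pair_big xpredT xpredT (fun i j => c i * c' j *: t (e i) (h j))) /=.
  apply: eq_bigr => i _; rewrite (linear_suml (tr _)) scaler_sumr.
  by apply: eq_bigr => j _; rewrite scalerA.
have sM : is_subspace M.
  split; first by exists (fun=> 0); rewrite big1 // => p _; rewrite scale0r.
  move=> k _ _ [c ->] [c' ->]; exists (fun p => k * c p + c' p).
  rewrite scaler_sumr -big_split; apply: eq_bigr => p _.
  by rewrite scalerDl scalerA.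
exists M => //; split=> //.
- by apply: (@finite_dim_fin _ _ ('I_n * 'I_m)%type _ E) => [p|//]; apply: Mt.
- move=> x _ [c ->]; rewrite linear_sum; apply: is_subspace_sum => // p _.
  rewrite linearZ; apply: is_subspaceZ => //.
  by rewrite op_t; apply: is_subspaceD => //; apply: Mt => //; apply: stW.
move=> z zc _ [c ->]; apply: eigen_sum_sum => p _; apply: eigen_sumZ => //.
have [a aP] := irreducible_central_scalar fW irrW zc.
have [l lP hp] := S_center zc (h p.2).
rewrite /E hp (linear_sum (t _)); apply: eigen_sum_sum => p' /lP[_ zp'] /=.
apply: (@eigen_sum1 _ _ _ _ (a + p'.1)); first exact: Mt.
have tZl k v s : t (k *: v) s = k *: t v s by rewrite linearZl_LR.
by rewrite op_t zp' aP // linearZ tZl scalerDl.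
Qed.

Lemma admissible_locally_finite w : is_tensor t -> admissible (rV : L -> V -> V) ->
  exists2 M, finite_ss_module M & M w.
Proof.
move=> tP [I [W [[Wsum _] WP _]]].
have comb k x y : (exists2 M, finite_ss_module M & M x) -> (exists2 M, finite_ss_module M & M y) ->
    exists2 M, finite_ss_module M & M (k *: x + y).
  move=> [M gM Mx] [M' gM' My]; exists (sum_set M M'); first exact: finite_ss_module_sum.
  by exists (k *: x), y; split=> //; apply: is_subspaceZ => //; case: gM.
have good0 : exists2 M, finite_ss_module M & M 0.
  exists [set 0] => //; split=> //.
  - by split=> // k _ _ -> ->; rewrite scaler0 addr0.
  - exists 0%N, (fun=> 0); split=> // _ ->.
    by exists (fun=> 0); rewrite big_ord0.
  - by move=> x _ ->; rewrite /= linear0.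
  - by move=> z _ _ ->; apply: eigen_sum0.
apply: (tensor_ind tP (P := fun w => exists2 M, finite_ss_module M & M w)) => // v s.
have [l [u [Wu ->]]] := Wsum v.
elim: l => [|i l IH]; first by rewrite big_nil linear0l.
rewrite big_cons linearDl -[t (u i) s]scale1r; apply: comb => //.
have [fW irrW] := WP i; have [M gM Mt] := finite_ss_module_irreducible fW irrW.
by exists M => //; apply: Mt.
Qed.

End TensorModule.

(** * Dirac cohomology *)

Section SemisimpleSquare.
Variables (K : fieldType) (T : lmodType K) (D : {linear T -> T}).
Hypothesis D2_ss : forall w, D (D (D (D w))) = 0 -> D (D w) = 0.

Lemma ker_iterD k w : iter k.+2 D w = 0 -> D (D w) = 0.
Proof.
elim: k w => [//|k IH] w; rewrite iterSr => /IH D3.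
by apply: D2_ss; rewrite D3 linear0.
Qed.

(** A class is represented by [x = D^(2k+2) y] with [D x = 0]. Some power of [D] of exponent at
    least 2 kills [y], so [D (D y) = 0], and then [x] itself is 0. *)
Lemma higher_dirac_coh0 k (x : higher_dirac_coh D k.+1) : x = 0.
Proof.
rewrite -[x]subquot_reprK -(linear0 (@subquot_pi K T _ _)).
apply/eqP; rewrite subquot_piP subr0.
suff -> : val (repr x) = 0 by exact: rpred0.
have := valP (repr x); rewrite inE => /andP[/eqP Dx /asboolP[y xE]].
have D2 : D (D y) = 0 by apply: (@ker_iterD (2 * k).+1); rewrite -xE mulnS in Dx.
rewrite -xE mulnS -[(2 + _)%N]/(2 * k).+2 iterSr iterSr D2.
by elim: (2 * k)%N => //= m ->; rewrite linear0.
Qed.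

Lemma dsum_in0_bijective : bijective (@dsum_in K (higher_dirac_coh D) 0).
Proof.
exists (fun f : total_dirac_coh D => f 0%N) => [x|f]; first by rewrite /= dfwithin.
apply: dsumP => -[|k] /=; first by rewrite dfwithin.
by rewrite [RHS]higher_dirac_coh0 dfwithout.
Qed.

Let kerimD0 x : (x \in kerimD D 0) = (x \in kerD D).
Proof. by rewrite !inE; case: eqP => //= _; apply/asboolP; exists x. Qed.

(** [kerimD D 0] and [kerD D] have the same members without being the same predicate, so the two
    quotients are different types. The maps are defined on chosen representatives, and [f0P] and
    [f1P] show independence of the choice. *)
Lemma higher_dirac_coh_0 : exists f : {linear higher_dirac_coh D 0 -> dirac_coh D},
  bijective f /\
  forall (x : subsp (kerimD D 0)) (x' : subsp (kerD D)),
    val x = val x' -> f (subquot_pi _ x) = subquot_pi _ x'.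
Proof.
have toK (x : subsp (kerimD D 0)) : val x \in kerD D by rewrite -kerimD0 (valP x).
have ofK (x : subsp (kerD D)) : val x \in kerimD D 0 by rewrite kerimD0 (valP x).
pose f0 (x : higher_dirac_coh D 0) : dirac_coh D := subquot_pi _ (Subsp (toK (repr x))).
pose f1 (x : dirac_coh D) : higher_dirac_coh D 0 := subquot_pi _ (Subsp (ofK (repr x))).
have f0P (x : subsp (kerimD D 0)) (x' : subsp (kerD D)) : val x = val x' ->
    f0 (subquot_pi _ x) = subquot_pi _ x'.
  move=> xx'; apply/eqP; rewrite subquot_piP linearB /= -xx'.
  rewrite -[_ - _]/(val (repr (subquot_pi (kerimD D 1) x) - x)) -subquot_piP.
  by rewrite subquot_reprK.
have f1P (x : subsp (kerimD D 0)) (x' : subsp (kerD D)) : val x = val x' ->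
    f1 (subquot_pi _ x') = subquot_pi _ x.
  move=> xx'; apply/eqP; rewrite subquot_piP linearB /= xx'.
  rewrite -[_ - _]/(val (repr (subquot_pi (kerimD D 1) x') - x')) -subquot_piP.
  by rewrite subquot_reprK.
have f0_lin : linear f0.
  move=> k x y; pose x' := Subsp (toK (repr x)); pose y' := Subsp (toK (repr y)).
  rewrite -[x]subquot_reprK -[y]subquot_reprK -linearP.
  rewrite (f0P (repr x) x' erefl) (f0P (repr y) y' erefl) -linearP.
  by apply: f0P; rewrite !linearP.
pose f : {linear higher_dirac_coh D 0 -> dirac_coh D} :=
  HB.pack f0 (GRing.isLinear.Build K _ _ *:%R f0 f0_lin).
exists f; split=> //.
exists f1 => x; rewrite -[x]subquot_reprK /=.
  pose y := Subsp (toK (repr x)).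
  by rewrite (f0P (repr x) y erefl) (f1P (repr x) y erefl).
pose y := Subsp (ofK (repr x)).
by rewrite (f1P y (repr x) erefl) (f0P y (repr x) erefl).
Qed.
End SemisimpleSquare.

Lemma commutator_add (A : pzRingType) (p p' a a' : A) : a * p' = p' * a -> a' * p = p * a' ->
  (p + a) * (p' + a') - (p' + a') * (p + a) = p * p' - p' * p + (a * a' - a' * a).
Proof.
move=> ap' a'p; rewrite !mulrDl !mulrDr ap' a'p.
apply/eqP; rewrite subr_eq; apply/eqP; rewrite addrACA [RHS]addrACA.
by rewrite [p * a' + a' * a]addrC !addrA !subrK addrAC.
Qed.

Section DiracOperatorSquare.
Variables (K : numClosedFieldType) (g : lieAlgType K) (g_red : reductive g).
Variables (B : {symmetric g}) (B_nondeg : nondegenerate B) (B_inv : invariant_form B).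
Variables (r : {vspace g}) (r_sub : lie_subalgebra r) (r_red : reductive_in r).
Hypothesis Br_nondeg : nondegenerate_on B r.
Local Notation s := (orthov B r).
Local Notation q := (@sform K g B r).
Local Notation L := (subLie r_sub).
Local Notation lval := (@subLie_val K g r r_sub).
Variables (U : envAlg g) (C : cliffordAlg q) (UC : algTensor U C).
Variables (n : nat) (b d : n.-tuple (subvs_of s)).
Hypothesis bd : dual_families q (tnth b) (tnth d).
Variables (V : algRep U) (S : algRep C) (VS : repTensor UC V S).
Hypotheses (V_adm : admissible (@sub_lie_act K g U V r)) (S_spin : spin_module S).
Hypothesis V_inf : inf_char V.
Local Notation diag := (@diag_act K g B r r_sub U C UC n b d).
Local Notation alC x := (spin_lift (cliff_in C) (tnth b) (tnth d) (@ad_s K g B r r_sub x)).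

Let rV (x : L) : {linear V -> V} := act V (env_in U (lval x)).
Let rS (x : L) : {linear S -> S} := act S (alC x).
Let op (x : L) : {linear VS -> VS} := act VS (diag x).

Let bdC : forall u v, q u v = q v u := @sformC K g B r.

Lemma rV_lie x y v : rV (lie x y) v = rV x (rV y v) - rV y (rV x v).
Proof. by rewrite /rV subLie_lie env_lie actD actN !actM. Qed.

Lemma op_t x v w : op x (rtens VS v w) = rtens VS (rV x v) w + rtens VS v (rS x w).
Proof.
rewrite /op actD -inrA_spin_lift; congr (_ + _).
  by rewrite [LHS]rtens_act act1.
by rewrite [LHS]rtens_act act1.
Qed.

Lemma op_lin w : linear (op^~ w).
Proof.
move=> k x y; rewrite /op -actP; congr (act VS _ w).
rewrite /diag_act (spin_lift_linear B_inv) !linearP scalerDr.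
by rewrite addrACA.
Qed.

Lemma op_lie x y w : op (lie x y) w = op x (op y w) - op y (op x w).
Proof.
rewrite /op -!actM -actN -actD; congr (act VS _ w).
have alX := spin_lift_X (tnth b) (tnth d) (@sY_gX K g B r U C UC).
have comal := spin_lift_lie bdC (@sY_cliff K g B r U C UC) bd (ad_s_skew B_inv x)
  (ad_s_skew B_inv y) (ad_s_lie B_inv x y).
rewrite /diag_act subLie_lie gX_lie -comal /com.
by rewrite [RHS]commutator_add //; apply: alX.
Qed.

Lemma spin_center_eigen_sum z : (forall y : L, lie y z = 0) -> forall v, eigen_sum (rS z) setT v.
Proof.
move=> zc; pose T : {linear subvs_of s -> subvs_of s} :=
  HB.pack (@ad_s K g B r r_sub z) (GRing.isLinear.Build K _ _ *:%R _ (ad_s_is_linear B_inv z)).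
apply: (@spin_eigen_sum K _ q C S S_spin _ _ _ bd _ (T B_inv B_inv)) => y.
  exact: (com_spin_lift bdC (@cliff_rel _ _ _ C) bd y (ad_s_skew B_inv z)).
exact: (center_ad_s_eigen_sum B_inv r_red bd y zc).
Qed.

Lemma diag_act_locally_finite w : exists2 M, finite_ss_module op M & M w.
Proof.
apply: (admissible_locally_finite rV_lie op_t _ spin_center_eigen_sum w (rtens_univ VS)).
  exact: spin_finite_dim bd.
exact: V_adm.
Qed.

Local Notation D := (act VS (dirac UC b d)).

Lemma dirac_square_casimir N (e f : 'I_N -> L) : dual_families (@subLie_form K g B r r_sub) e f ->
  exists c, forall w, D (D w) = \sum_k op (e k) (op (f k) w) - c *: w.
Proof.
move=> ef; have [chi chiP] := V_inf.
have [k kP] := spin_schur S_spin bd (cliff_const_central g_red B_inv B_nondeg UC bd ef).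
(* The Casimir element of [g] enters the square with a minus sign and acts by [chi]; the central
   Clifford element acts on [S] by the scalar [k]. *)
exists (chi (casU U b d e f) - k).
have left z h w : (forall v, act V z v = h *: v) -> act VS (inlA UC z) w = h *: w.
  move=> zh; apply: (tensor_ind (rtens_univ VS) (P := fun w => act VS (inlA UC z) w = h *: w)) w.
  - by rewrite linear0 scaler0.
  - by move=> a x y Hx Hy; rewrite linearP Hx Hy scalerDr !scalerA mulrC.
  by move=> v x; rewrite [LHS]rtens_act zh act1 linearZl_LR.
have right z h w : (forall v, act S z v = h *: v) -> act VS (inrA UC z) w = h *: w.
  move=> zh; apply: (tensor_ind (rtens_univ VS) (P := fun w => act VS (inrA UC z) w = h *: w)) w.
  - by rewrite linear0 scaler0.
  - by move=> a x y Hx Hy; rewrite linearP Hx Hy scalerDr !scalerA mulrC.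
  by move=> v x; rewrite [LHS]rtens_act zh act1 linearZ.
move=> w; rewrite -actM (dirac_sq B_inv UC bd ef) !actD actN act_sum.
rewrite (right _ _ w kP) (left _ (chi (casU U b d e f))).
  rewrite scalerBl opprB [k *: w - _]addrC addrA; congr (_ - _ + _).
  by apply: eq_bigr => i _; rewrite actM.
by apply: chiP; exact: casU_central.
Qed.

Lemma dirac_square_semisimple w : D (D (D (D w))) = 0 -> D (D w) = 0.
Proof.
have nd := @subLie_form_nondeg K g B r r_sub Br_nondeg.
have [e0 [f0 /dual_families_pad ef]] :=
  dual_families_exist (@subLie_formC K g B r r_sub) (@subLie_form_lin K g B r r_sub) nd.
have [c Dc] := dirac_square_casimir ef.
have [M [sM fM stM cM] Mw] := diag_act_locally_finite w.
have := @abstract_casimir_semisimple K L _ (@subLie_formC K g B r r_sub)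
  (@subLie_form_inv K g B r B_inv r_sub) (@subLie_form_lin K g B r r_sub) _ _ _ ef
  (@subLie_reductive K g r r_sub r_red) VS op M op_lin op_lie sM fM stM cM c w Mw.
by rewrite /= -!Dc.
Qed.

End DiracOperatorSquare.
Theorem corollary3p3 (R : realType)
    (g : lieAlgType R[i]) (g_reductive : reductive g)
    (B : {symmetric g}) (B_nondeg : nondegenerate B) (B_inv : invariant_form B)
    (r : {vspace g}) (r_sub : lie_subalgebra r) (r_reductive : reductive_in r)
    (Br_nondeg : nondegenerate_on B r)
    (U : envAlg g) (C : cliffordAlg (@sform _ g B r)) (UC : algTensor U C)
    (n : nat) (b d : n.-tuple (subvs_of (orthov B r))) (bd : dual_bases b d)
    (V : algRep U) (V_gr : gr_module r V)
    (S : algRep C) (S_spin : spin_module S)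
    (VS : repTensor UC V S)
    (V_inf : inf_char V) :
  let D := act VS (dirac UC b d) in
  bijective (@dsum_in _ (higher_dirac_coh D) 0) /\
  exists f : {linear higher_dirac_coh D 0 -> dirac_coh D},
    bijective f /\
    forall (x : subsp (kerimD D 0)) (x' : subsp (kerD D)),
      val x = val x' -> f (subquot_pi _ x) = subquot_pi _ x'.
Proof.
move=> D; have [_ V_adm _] := V_gr; have [bb bd' dual] := bd.
have bdf := dual_families_of_basis (@sformC _ g B r) (@sform_lin _ g B r) bb bd' dual.
have D2 : forall w, D (D (D (D w))) = 0 -> D (D w) = 0.
  exact: (@dirac_square_semisimple R[i] g g_reductive B B_nondeg B_inv r r_sub).
by split; [exact: dsum_in0_bijective|exact: higher_dirac_coh_0].
Qed.
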